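(* Let $\lambda$ be a nonzero complex constant and $G=\mathrm{SL}_2(\mathbb{C})$. Any one-parameter family $\mathbb{G}_{\mathbb{C}}(B_\tau)$ of symmetric $2$-algebraic two-valued groups defined by a solution $(k_2,k_4,k_6)$ of the dynamical system $$k_2'=\frac{\lambda}{2}k_4,\qquad k_4'=\frac{3\lambda}{4}k_6,\qquad k_6'=\frac{\lambda}{4}\left(k_4^2-k_2k_6\right)$$ is obtained, by the action of an element of $G$ on the associated solution $y=-\lambda k_2/4$ of the Chazy equation $y'''=yy''-\frac32(y')^2$, from one of the following three families: the family with $-\lambda k_2/4=E_2(\tau)$; the constant family $k_2\equiv1$, $k_4\equiv k_6\equiv0$; the family $k_2\equiv k_4\equiv k_6\equiv0$. Consequently, the classes of $G$-equivalence of one-parameter families $\mathbb{G}_{\mathbb{C}}(B_\tau)$ are in one-to-one correspondence with the $G$-orbits $G(E_2)$, $G(0)$ and $G(1)$ of the solutions $y=E_2$, $y=0$ and $y=1$ of the Chazy equation; these three orbits are pairwise distinct and exhaust the solutions.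
   Context: Throughout $(-)'=\frac{1}{2\pi i}\frac{d}{d\tau}$, and $E_2(\tau)=1-24\sum_{n\ge1}\sigma_1(n)e^{2\pi i n\tau}$ on the upper half-plane. Families: with $e_1=x+y+z$, $e_2=xy+yz+xz$, $e_3=xyz$, put $$B_\tau(z;x,y)=e_1^2-4e_2+k_2(\tau)e_3+\tfrac{k_4^2(\tau)-k_6(\tau)k_2(\tau)}{4}e_3^2+k_4(\tau)e_1e_3+k_6(\tau)e_2e_3 .$$ For each $\tau$, $\mathbb{G}_{\mathbb{C}}(B_\tau)$ is the two-valued group on $\mathbb{C}$ with multiplication $x\ast y=[z\mid B_\tau(z;x,y)=0]$ (multiset of the roots in $z$, where the coefficient of $z^2$ is nonzero), neutral element $0$ and inverse $\mathrm{inv}(x)=x$; the operation is known to be associative for this form of coefficients. If $(k_2,k_4,k_6)$ solves the dynamical system, then $y=-\lambda k_2/4$ solves the Chazy equation. Conversely, a solution $y$ determines $k_2=-4y/\lambda$, $k_4=\frac{2}{\lambda}k_2'$, $k_6=\frac{4}{3\lambda}k_4'$, which solve the dynamical system. Thus families correspond to Chazy solutions. Action of $G$ on Chazy solutions: for $g=\begin{pmatrix}a&b\\c&d\end{pmatrix}\in\mathrm{SL}_2(\mathbb{C})$, $$(y\|_2 g)(\tau)=\frac{1}{(c\tau+d)^2}\,y\!\left(\frac{a\tau+b}{c\tau+d}\right)-\frac{12}{2\pi i}\,\frac{c}{c\tau+d}.$$ It sends solutions to solutions, and $G$ acts on families via the associated solutions $y$. $G(y_0)$ denotes the orbit of $y_0$.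 Solutions are holomorphic functions on connected open subsets of $\mathbb{C}$, and solutions are identified when they agree up to restriction or analytic continuation; e.g. $E_2\|_2g$ is defined on the image of the upper half-plane under $g^{-1}$. *)

(* Defs.v *)
(* Stdlib reals with Coquelicot's complex numbers C. *)
From Stdlib Require Import Reals List Arith Relations.
From Coquelicot Require Import Coquelicot.
Open Scope C_scope.

(* The values of [val] outside [dom] are junk and are never used. *)
Record dfun := DFun { dom : C -> Prop; val : C -> C }.

Definition meets (V W : C -> Prop) : Prop := exists z, V z /\ W z.

(* Separation by open sets of C is equivalent to connectedness for the subspace
   topology when U is open, the only case used. *)
Definition connected (U : C -> Prop) : Prop :=
  forall V W : C -> Prop, open V -> open W ->
    (forall z, U z -> V z \/ W z) -> meets U V -> meets U W ->
    exists z, U z /\ V z /\ W z.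

Definition domain (U : C -> Prop) : Prop :=
  (exists z, U z) /\ open U /\ connected U.

Definition holomorphic_on (U : C -> Prop) (f : C -> C) : Prop :=
  forall t, U t -> ex_derive (K := C_AbsRing) (V := C_NormedModule) f t.

Definition two_pi_i : C := RtoC (2 * PI) * Ci.

(* [C_derive f t] is the complex derivative only where f is complex
   differentiable, hence the explicit [holomorphic_on] conditions below. *)
Definition Dtau (f : C -> C) (t : C) : C := C_derive f t / two_pi_i.

(* Holomorphy of Dtau y and Dtau (Dtau y) follows from that of y, by Goursat's theorem;
   it is listed so that every derivative in the equation is visibly genuine. *)
Definition chazy (y : dfun) : Prop :=
  domain (dom y) /\
  holomorphic_on (dom y) (val y) /\
  holomorphic_on (dom y) (Dtau (val y)) /\
  holomorphic_on (dom y) (Dtau (Dtau (val y))) /\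
  forall t, dom y t ->
    Dtau (Dtau (Dtau (val y))) t = val y t * Dtau (Dtau (val y)) t - 3 / 2 * (Dtau (val y) t) ^ 2.

Definition dyn_system (lam : C) (U : C -> Prop) (k2 k4 k6 : C -> C) : Prop :=
  domain U /\
  holomorphic_on U k2 /\ holomorphic_on U k4 /\ holomorphic_on U k6 /\
  forall t, U t ->
    Dtau k2 t = lam / 2 * k4 t /\
    Dtau k4 t = 3 * lam / 4 * k6 t /\
    Dtau k6 t = lam / 4 * ((k4 t) ^ 2 - k2 t * k6 t).

Definition restricts (y1 y2 : dfun) : Prop :=
  chazy y1 /\ chazy y2 /\
  forall t, dom y1 t -> dom y2 t /\ val y1 t = val y2 t.

(* A chain of restrictions and extensions, i.e. analytic continuation. *)
Definition same_solution : dfun -> dfun -> Prop := clos_refl_sym_trans dfun restricts.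

Record SL2 := MkSL2 {
  ga : C; gb : C; gc : C; gd : C;
  g_det : ga * gd - gb * gc = 1
}.

Definition moebius (g : SL2) (t : C) : C := (ga g * t + gb g) / (gc g * t + gd g).

Definition act (y : dfun) (g : SL2) : dfun :=
  DFun (fun t => gc g * t + gd g <> 0 /\ dom y (moebius g t))
       (fun t => / (gc g * t + gd g) ^ 2 * val y (moebius g t)
                 - 12 / two_pi_i * (gc g / (gc g * t + gd g))).

(* Orbits are taken modulo [same_solution]: the orbit consists of all solutions
   that are identified with some y0 || g. *)
Definition orbit (y0 : dfun) : dfun -> Prop :=
  fun y => chazy y /\ exists g : SL2, same_solution y (act y0 g).

Definition sigma1 (n : nat) : nat :=
  list_sum (filter (fun d => (n mod d =? 0)%nat) (seq 1 n)).

Definition Cexp (z : C) : C :=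
  ((exp (Re z) * cos (Im z))%R, (exp (Re z) * sin (Im z))%R).

Definition CSeries (a : nat -> C) : C :=
  (Series (fun n => Re (a n)), Series (fun n => Im (a n))).

Definition E2 (t : C) : C :=
  1 - 24 * CSeries (fun n => RtoC (INR (sigma1 (S n)))
                             * Cexp (two_pi_i * RtoC (INR (S n)) * t)).

Definition upper_half_plane (t : C) : Prop := (0 < Im t)%R.

Definition E2_sol : dfun := DFun upper_half_plane E2.

Definition const_sol (c : C) : dfun := DFun (fun _ => True) (fun _ => c).

(* [tv_mul x y z1 z2]: the product x * y is the multiset [z1, z2].  The
   multiplication may be undefined for some pairs (x, y). *)
Record two_valued := TwoValued {
  tv_mul : C -> C -> C -> C -> Prop;
  tv_unit : C;
  tv_inv : C -> C
}.

Definition Bpoly (k2 k4 k6 z x y : C) : C :=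
  let e1 := x + y + z in
  let e2 := x * y + y * z + x * z in
  let e3 := x * y * z in
  e1 ^ 2 - 4 * e2 + k2 * e3 + (k4 ^ 2 - k6 * k2) / 4 * e3 ^ 2
  + k4 * e1 * e3 + k6 * e2 * e3.

(* [z1, z2] is the multiset of roots of B(z; x, y), of degree exactly 2 in z. *)
Definition GC (B : C -> C -> C -> C) : two_valued :=
  TwoValued
    (fun x y z1 z2 => exists a : C, a <> 0 /\
       forall z, B z x y = a * (z - z1) * (z - z2))
    0 (fun x => x).

Record tv_family := Family { fdom : C -> Prop; fgrp : C -> two_valued }.

Definition family_of (U : C -> Prop) (k2 k4 k6 : C -> C) : tv_family :=
  Family U (fun t => GC (Bpoly (k2 t) (k4 t) (k6 t))).

(* Inverse of y = - lam k2 / 4. *)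
Definition family_of_chazy (lam : C) (y : dfun) : tv_family :=
  let k2 := fun t => - 4 * val y t / lam in
  let k4 := fun t => 2 / lam * Dtau k2 t in
  let k6 := fun t => 4 / (3 * lam) * Dtau k4 t in
  family_of (dom y) k2 k4 k6.

(* F is defined by a solution (k2, k4, k6) of the system, and y is the
   associated function - lam k2 / 4. *)
Definition associated (lam : C) (F : tv_family) (y : dfun) : Prop :=
  exists k2 k4 k6 : C -> C,
    dyn_system lam (fdom F) k2 k4 k6 /\
    (forall t, fdom F t -> fgrp F t = GC (Bpoly (k2 t) (k4 t) (k6 t))) /\
    (forall t, dom y t <-> fdom F t) /\
    (forall t, dom y t -> val y t = - lam * k2 t / 4).

Definition is_family (lam : C) (F : tv_family) : Prop := exists y, associated lam F y.

(* The action of G on families goes through the associated solutions. *)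
Definition obtained_by (lam : C) (g : SL2) (F0 F : tv_family) : Prop :=
  exists y0 y, associated lam F0 y0 /\ associated lam F y /\
    same_solution y (act y0 g).

Definition G_equivalent (lam : C) (F F' : tv_family) : Prop :=
  exists g : SL2, obtained_by lam g F F'.

Definition G_class (lam : C) (F : tv_family) : tv_family -> Prop := G_equivalent lam F.

Definition G_classes (lam : C) (c : tv_family -> Prop) : Prop :=
  exists F, is_family lam F /\ c = G_class lam F.

Definition three_orbits (O : dfun -> Prop) : Prop :=
  O = orbit E2_sol \/ O = orbit (const_sol 0) \/ O = orbit (const_sol 1).

Definition bijection_between {S T : Type} (A : S -> Prop) (B : T -> Prop)
  (f : S -> T) : Prop :=
  (forall a, A a -> B (f a)) /\
  (forall a a', A a -> A a' -> f a = f a' -> a = a') /\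
  (forall b, B b -> exists a, A a /\ f a = b).

(* Main.v *)
From Stdlib Require Import Reals List Arith Lia Lra Psatz ZArith Permutation Relations.
From Stdlib Require Import FunctionalExtensionality PropExtensionality Classical ClassicalEpsilon.
From Coquelicot Require Import Coquelicot.
Require Import Defs.
Open Scope C_scope.

(** A solution y of the Chazy equation is determined near a point t0 by y(t0) and by the weighted
    invariants Q = y^2 - 12 y' and R = y^3 - 18 y y' + 36 y'', which satisfy Ramanujan's system and are
    multiplied by (c t + d)^-4 and (c t + d)^-6 under the action of SL2.  If Q = R = 0 the data are
    those of some 0 || g, if Q^3 = R^2 <> 0 those of some 1 || g; if Q^3 <> R^2 one needs tau in the upper
    half-plane and M <> 0 with Q = M^4 E4(tau), R = M^6 E6(tau).

    Everything about E2 is derived from the two doubling identities of a = theta_3^2 and b = theta_4^2,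
    a(x) + b(x) = 2 a(x^2) and a(x) b(x) = b(x^2)^2, which come from sums of two squares; no modularity
    is used.  As formal power series in the nome x, identities such as D log(a/b) = (a^2 - b^2)/2 and
    Ramanujan's equations hold because their defect f satisfies a functional equation relating f(x^2)
    to f(x) that forces f = 0.  Gauss's product for theta_4 links a and b to the divisor sums in E2.
    The same identities say that (a, b) at x^2 is the arithmetic-geometric mean step of (a, b) at x.
    Given Q and R, solve a cubic for the values of a^2 and b^2, iterate the mean until the two numbers
    are nearly equal, invert the ratio of a and b near x = 0, and go back by extracting square roots
    of x. *)

(** The hard case is Q^3 <> R^2: some tau must realise a prescribed ratio of Q^3 to R^2, which is
    the surjectivity of the j-invariant, classically obtained by counting zeros of modular forms.
    The mean can replace that count because X = a^2 and Y = b^2 satisfy 4 (Q^3 - R^2) = 27 (X Y (X -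
    Y))^2, so that Q^3 <> R^2 says exactly that the starting pair of the mean is non-degenerate.
    SL2(C) has three parameters, as many as a third-order equation has initial values; this is why
    matching a solution with a transform of a representative at one point, followed by local
    uniqueness, settles that every solution lies in an orbit. Distinctness of the orbits asks for
    more, since solutions are identified along chains of restrictions: the type of (Q, R) has to be
    constant on a connected domain, and this is proved by showing each type to be an open condition.
    On the side of families, only the groups are given and not (k2, k4, k6); the action of G makes
    sense because the group at t determines k2(t). *)

Open Scope R_scope.

(** * Formal power series *)

Declare Scope fps_scope.
Delimit Scope fps_scope with S.

Definition fps := nat -> R.
Bind Scope fps_scope with fps.

Definition fps_tail (f : fps) : fps := fun n => f (S n).

(** Cauchy product by recursion on the first factor, f g = f(0) g + x (tail f) g, so that the ring
    laws and the product rules follow by induction on the degree with f generalised. The usual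
    finite sum is recovered in [conv_lsum] and [conv_sum]. *)
Fixpoint conv (f g : fps) (n : nat) : R :=
  match n with
  | O => f O * g O
  | S m => f O * g (S m) + conv (fps_tail f) g m
  end.

Definition fadd (f g : fps) : fps := fun n => f n + g n.
Definition fmul (f g : fps) : fps := conv f g.
Definition fopp (f : fps) : fps := fun n => - f n.
Definition fsub (f g : fps) : fps := fun n => f n - g n.
Definition fcst (r : R) : fps := fun n => match n with O => r | _ => 0 end.
Definition fint (z : Z) : fps := fcst (IZR z).

Infix "+" := fadd : fps_scope.
Infix "*" := fmul : fps_scope.
Infix "-" := fsub : fps_scope.
Notation "- x" := (fopp x) : fps_scope.

Lemma conv_S_r f g n : conv f g (S n) = conv f (fps_tail g) n + f (S n) * g O.
Proof.
  revert f; induction n as [|n IH]; intros f; [reflexivity|].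
  change (conv f g (S (S n))) with (f O * g (S (S n)) + conv (fps_tail f) g (S n)).
  rewrite IH; cbn [conv]; unfold fps_tail; ring.
Qed.

Lemma fmul_comm f g : (f * g)%S = (g * f)%S.
Proof.
  apply functional_extensionality; intro n; unfold fmul.
  revert f g; induction n as [|n IH]; intros f g; [apply Rmult_comm|].
  rewrite conv_S_r; cbn [conv]; rewrite IH; ring.
Qed.

Lemma conv_add_l f g h n : conv (f + g)%S h n = conv f h n + conv g h n.
Proof.
  revert f g; induction n as [|n IH]; intros f g; cbn [conv].
  - unfold fadd; ring.
  - change (fps_tail (f + g)%S) with (fps_tail f + fps_tail g)%S; rewrite IH; unfold fadd; ring.
Qed.

Lemma conv_scal_l c f h n : conv (fun k => c * f k) h n = c * conv f h n.
Proof.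
  revert f; induction n as [|n IH]; intros f; cbn [conv]; [ring|].
  change (fps_tail (fun k => c * f k)) with (fun k => c * fps_tail f k); rewrite IH; ring.
Qed.

Lemma conv_0_l h n : conv (fun _ => 0) h n = 0.
Proof.
  induction n as [|n IH]; cbn [conv]; [ring|].
  change (fps_tail (fun _ => 0)) with (fun _ : nat => 0); rewrite IH; ring.
Qed.

Lemma conv_cst_l c h n : conv (fcst c) h n = c * h n.
Proof.
  destruct n; cbn [conv]; [reflexivity|].
  change (fps_tail (fcst c)) with (fun _ : nat => 0); rewrite conv_0_l; simpl; ring.
Qed.

Lemma fmul_assoc f g h : (f * (g * h))%S = (f * g * h)%S.
Proof.
  apply functional_extensionality; intro n; unfold fmul.
  revert f g; induction n as [|n IH]; intros f g; cbn [conv]; [ring|].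
  change (fps_tail (conv f g)) with (fadd (fun k => Rmult (f O) (fps_tail g k)) (conv (fps_tail f) g)).
  rewrite conv_add_l, conv_scal_l, <- IH.
  ring.
Qed.

Lemma fps_ring : ring_theory (fint 0) (fint 1) fadd fmul fsub fopp eq.
Proof.
  split; intros; try (apply functional_extensionality; intro;
    unfold fadd, fopp, fsub, fint, fcst; try destruct x0; ring);
    try (apply functional_extensionality; intro n; unfold fadd, fopp, fsub, fint, fcst; destruct n; ring).
  - apply functional_extensionality; intro n; unfold fmul, fint; rewrite conv_cst_l; ring.
  - apply fmul_comm.
  - apply fmul_assoc.
  - apply functional_extensionality; intro n; apply conv_add_l.
Qed.

(** Lets [ring] compute with the integer constants [fint z] as with numbers of Z. *)
Lemma fps_morph : ring_morph (fint 0) (fint 1) fadd fmul fsub fopp eq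
  0%Z 1%Z Z.add Z.mul Z.sub Z.opp Z.eqb fint.
Proof.
  split; auto; intros; try (apply functional_extensionality; intro n;
   unfold fadd, fopp, fsub, fint, fmul; try rewrite conv_cst_l; unfold fcst;
   destruct n; rewrite ?plus_IZR, ?minus_IZR, ?mult_IZR, ?opp_IZR; ring).
  apply Z.eqb_eq in H; now subst.
Qed.

Ltac fint_cst t :=
  match t with
  | fint ?z => match isZcst z with true => z | _ => constr:(InitialRing.NotConstant) end
  | _ => constr:(InitialRing.NotConstant)
  end.

Add Ring fps_ring_inst : fps_ring (morphism fps_morph, constants [fint_cst]).

(** In terms of the variable x: the operator x d/dx, the substitution of x^2, and the substitution
    of -x. *)
Definition fder (f : fps) : fps := fun n => INR n * f n.
Definition fsq (f : fps) : fps := fun n => if Nat.even n then f (Nat.div2 n) else 0.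
Definition fneg (f : fps) : fps := fun n => (-1) ^ n * f n.

Lemma fder_add f g : fder (f + g) = (fder f + fder g)%S.
Proof. apply functional_extensionality; intro; unfold fder, fadd; ring. Qed.
Lemma fder_sub f g : fder (f - g) = (fder f - fder g)%S.
Proof. apply functional_extensionality; intro; unfold fder, fsub; ring. Qed.
Lemma fder_int z : fder (fint z) = fint 0.
Proof. apply functional_extensionality; intros [|n]; unfold fder, fint, fcst; simpl; ring. Qed.

Lemma tail_fder f : fps_tail (fder f) = (fder (fps_tail f) + fps_tail f)%S.
Proof. apply functional_extensionality; intro; unfold fps_tail, fder, fadd; rewrite S_INR; ring. Qed.

Lemma fder_mul f g : fder (f * g) = (fder f * g + f * fder g)%S.
Proof.
  apply functional_extensionality; intro n; unfold fadd, fmul.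
  revert f; induction n as [|n IH]; intros f.
  - unfold fder; simpl; ring.
  - unfold fder at 1; cbn [conv]; rewrite tail_fder, conv_add_l.
    specialize (IH (fps_tail f)); unfold fder at 1 in IH.
    rewrite S_INR; unfold fder at 1 3; simpl (INR 0); rewrite S_INR.
    transitivity (f O * ((INR n + 1) * g (S n)) + INR n * conv (fps_tail f) g n + conv (fps_tail f) g n); [ring|].
    rewrite IH; ring.
Qed.

Lemma fder_fint_mul z f : fder (fint z * f) = (fint z * fder f)%S.
Proof. rewrite fder_mul, fder_int; ring. Qed.

Lemma fneg_sub f g : fneg (f - g) = (fneg f - fneg g)%S.
Proof. apply functional_extensionality; intro; unfold fneg, fsub; ring. Qed.
Lemma fneg_int z : fneg (fint z) = fint z.
Proof. apply functional_extensionality; intros [|n]; unfold fneg, fint, fcst; simpl; ring. Qed.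
Lemma fneg_der f : fneg (fder f) = fder (fneg f).
Proof. apply functional_extensionality; intro; unfold fneg, fder; ring. Qed.
Lemma fneg_neg f : fneg (fneg f) = f.
Proof.
  apply functional_extensionality; intro; unfold fneg.
  rewrite <- Rmult_assoc, <- Rpow_mult_distr.
  replace (-1 * -1) with 1 by ring; rewrite pow1; ring.
Qed.

Lemma fneg_mul f g : fneg (f * g) = (fneg f * fneg g)%S.
Proof.
  apply functional_extensionality; intro n; unfold fmul.
  revert f; induction n as [|n IH]; intros f.
  - unfold fneg; simpl; ring.
  - unfold fneg at 1; cbn [conv].
    replace (fps_tail (fneg f)) with (fun k => -1 * fneg (fps_tail f) k)
      by (apply functional_extensionality; intro; unfold fps_tail, fneg; simpl; ring).
    rewrite conv_scal_l, <- IH; unfold fneg; simpl; ring.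
Qed.

Lemma fsq_add f g : fsq (f + g) = (fsq f + fsq g)%S.
Proof. apply functional_extensionality; intro n; unfold fsq, fadd; destruct (Nat.even n); ring. Qed.
Lemma fsq_sub f g : fsq (f - g) = (fsq f - fsq g)%S.
Proof. apply functional_extensionality; intro n; unfold fsq, fsub; destruct (Nat.even n); ring. Qed.
Lemma fsq_int z : fsq (fint z) = fint z.
Proof.
  apply functional_extensionality; intros [|[|n]]; unfold fsq, fint, fcst; simpl; auto.
  destruct (Nat.even n); auto.
Qed.

Lemma fsq_mul f g : fsq (f * g) = (fsq f * fsq g)%S.
Proof.
  apply functional_extensionality; intro n; unfold fmul.
  revert f; induction n as [n IH] using lt_wf_ind; intros f.
  destruct n as [|[|n]]; [reflexivity| cbn; unfold fps_tail; cbn; ring |].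
  assert (H : conv (fsq f) (fsq g) (S (S n)) = f O * fsq (fps_tail g) n + conv (fsq (fps_tail f)) (fsq g) n).
  { change (conv (fsq f) (fsq g) (S (S n)))
      with (f O * fsq (fps_tail g) n + (0 * fsq g (S n) + conv (fsq (fps_tail f)) (fsq g) n)); ring. }
  rewrite H, <- IH by lia.
  unfold fsq; simpl; destruct (Nat.even n); unfold fps_tail; cbn; ring.
Qed.

Lemma fder_sq f : fder (fsq f) = (fint 2 * fsq (fder f))%S.
Proof.
  apply functional_extensionality; intro n; unfold fmul, fint; rewrite conv_cst_l; unfold fder, fsq.
  destruct (Nat.even n) eqn:E; [|ring].
  apply Nat.even_spec in E; destruct E as [m ->].
  rewrite Nat.div2_double, mult_INR; simpl; ring.
Qed.

Lemma fneg_sq f : fneg (fsq f) = fsq f.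
Proof.
  apply functional_extensionality; intro n; unfold fneg, fsq.
  destruct (Nat.even n) eqn:E; [|ring].
  apply Nat.even_spec in E; destruct E as [m ->].
  rewrite pow_mult; replace ((-1)^2) with 1 by ring; rewrite pow1; ring.
Qed.

Definition forder (n : nat) (f : fps) := forall k, (k < n)%nat -> f k = 0.

Lemma forder_tail n f : forder (S n) f -> forder n (fps_tail f).
Proof. intros H k Hk; apply H; lia. Qed.

(** Lowest terms multiply. The uniqueness arguments for functional equations compare lowest
    coefficients through this. *)
Lemma forder_mul n m f g : forder n f -> forder m g ->
  forder (n + m) (f * g) /\ (f * g)%S (n + m)%nat = f n * g m.
Proof.
  unfold fmul; revert f; induction n as [|n IH]; intros f Hf Hg.
  - simpl. clear Hf. split.
    + intros k; revert f; induction k as [|k IHk]; intros f Hk; cbn [conv].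
      * rewrite Hg by lia; ring.
      * rewrite IHk, Hg by lia; ring.
    + revert f g Hg; destruct m as [|m]; intros f g Hg; [reflexivity|].
      cbn [conv].
      enough (conv (fps_tail f) g m = 0) by lra.
      assert (Hk : (m < S m)%nat) by lia. revert Hk; generalize (fps_tail f).
      generalize m at 1 3. intros k; induction k as [|k IHk]; intros h Hk; cbn [conv].
      * rewrite Hg by lia; ring.
      * rewrite IHk, Hg by lia; ring.
  - destruct (IH (fps_tail f) (forder_tail _ _ Hf) Hg) as [H1 H2].
    split.
    + intros [|k] Hk; cbn [conv]; rewrite (Hf O) by lia; [ring|].
      rewrite H1 by lia; ring.
    + simpl; rewrite (Hf O), H2 by lia; unfold fps_tail; ring.
Qed.

Lemma fps_ind0 (f : fps) : (forall n, forder n f -> f n = 0) -> f = fint 0.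
Proof.
  intros H; apply functional_extensionality; intro n.
  replace (fint 0 n) with 0 by (destruct n; reflexivity).
  induction n as [n IH] using lt_wf_ind; apply H; exact IH.
Qed.

Lemma fmul_cancel f g : f O <> 0 -> (f * g = fint 0)%S -> g = fint 0.
Proof.
  intros Hf H; apply fps_ind0; intros n Hn.
  assert (H0 : forder 0 f) by (intros k Hk; lia).
  destruct (forder_mul 0 n f g H0 Hn) as [_ E]; simpl in E.
  rewrite H in E.
  assert (fint 0 n = 0) by (destruct n; reflexivity); rewrite H1 in E.
  symmetry in E; apply Rmult_integral in E; tauto.
Qed.

Lemma fint_mul_app z f n : (fint z * f)%S n = IZR z * f n.
Proof. unfold fmul, fint; apply conv_cst_l. Qed.

(** If f had lowest term x^n with n > 0, the left side would start at x^(2 n). It is applied to the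
    defect of a conjectured identity, whose constant term is checked by computation. *)
Lemma fsq_eigen (c : Z) f : c <> 0%Z -> f O = 0 -> (fint c * fsq f = f)%S -> f = fint 0.
Proof.
  intros Hc H0 H; apply fps_ind0; intros n Hn.
  rewrite <- H, fint_mul_app; unfold fsq.
  destruct (Nat.even n) eqn:E; [|ring].
  apply Nat.even_spec in E; destruct E as [m ->]; rewrite Nat.div2_double.
  destruct m; [rewrite H0; ring| rewrite Hn by lia; ring].
Qed.

Open Scope R_scope.

Ltac fext := apply functional_extensionality.

(** * The theta series *)

Definition issq (n : nat) : bool := (Nat.sqrt n * Nat.sqrt n =? n)%nat.

(** theta_3 in the nome, the sum of x^(s^2) over all integers s; s and -s together give the 2. *)
Definition theta : fps := fun n => match n with O => 1 | _ => if issq n then 2 else 0 end.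

Lemma issq_sq s : issq (s * s) = true.
Proof. unfold issq; rewrite Nat.sqrt_square; apply Nat.eqb_refl. Qed.

Lemma issq_spec n : issq n = true -> exists s, n = (s * s)%nat.
Proof. intros H; apply Nat.eqb_eq in H; exists (Nat.sqrt n); auto. Qed.

Lemma theta_sq s : (0 < s)%nat -> theta (s * s)%nat = 2.
Proof. intros H; unfold theta; rewrite issq_sq; destruct s; [lia|reflexivity]. Qed.

Lemma theta_nonsq p m : (p * p < m < S p * S p)%nat -> theta m = 0.
Proof.
  intros H; unfold theta; destruct m; [lia|].
  destruct (issq (S m)) eqn:E; [|auto].
  apply issq_spec in E; destruct E as [s E]; destruct (le_lt_dec s p); nia.
Qed.

(** * Sums of two squares *)

Definition lsum {A : Type} (f : A -> R) (l : list A) : R := fold_right (fun a s => f a + s) 0 l.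

Lemma lsum_ext {A} (f g : A -> R) l : (forall a, In a l -> f a = g a) -> lsum f l = lsum g l.
Proof.
  induction l as [|a l IH]; simpl; intros H; [auto|].
  rewrite H, IH; auto.
Qed.

Lemma lsum_map {A B} (h : A -> B) (f : B -> R) l : lsum f (map h l) = lsum (fun a => f (h a)) l.
Proof. induction l as [|a l IH]; simpl; [auto|]; rewrite IH; auto. Qed.

Lemma lsum_app {A} (f : A -> R) l1 l2 : lsum f (l1 ++ l2) = lsum f l1 + lsum f l2.
Proof. induction l1 as [|a l IH]; simpl; [ring|]; rewrite IH; ring. Qed.

Lemma lsum_plus {A} (f g : A -> R) l : lsum (fun a => f a + g a) l = lsum f l + lsum g l.
Proof. induction l as [|a l IH]; simpl; [ring|]; rewrite IH; ring. Qed.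

Lemma lsum_scal {A} c (f : A -> R) l : lsum (fun a => c * f a) l = c * lsum f l.
Proof. induction l as [|a l IH]; simpl; [ring|]; rewrite IH; ring. Qed.

Lemma lsum_swap {A B} (f : A -> B -> R) l1 l2 :
  lsum (fun a => lsum (f a) l2) l1 = lsum (fun b => lsum (fun a => f a b) l1) l2.
Proof.
  induction l1 as [|a l IH]; simpl.
  - induction l2; simpl; lra.
  - rewrite IH, lsum_plus; auto.
Qed.

Lemma lsum_prod {A B} (f : A * B -> R) l1 l2 :
  lsum f (list_prod l1 l2) = lsum (fun a => lsum (fun b => f (a, b)) l2) l1.
Proof.
  induction l1 as [|a l IH]; simpl; [auto|].
  rewrite lsum_app, lsum_map, IH; auto.
Qed.

Definition indic (b : bool) : R := if b then 1 else 0.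

Lemma lsum_ind {A} (p : A -> bool) l : lsum (fun a => indic (p a)) l = INR (length (filter p l)).
Proof.
  induction l as [|a l IH]; simpl lsum; simpl filter; [auto|].
  rewrite IH; destruct (p a); unfold indic; [|ring].
  simpl length; rewrite S_INR; ring.
Qed.

Lemma conv_lsum f g n : conv f g n = lsum (fun i => f i * g (n - i)%nat) (seq 0 (S n)).
Proof.
  revert f; induction n as [|n IH]; intros f; [simpl; ring|].
  cbn [conv]; rewrite IH.
  change (seq 0 (S (S n))) with (0%nat :: seq 1 (S n)).
  rewrite <- seq_shift; simpl lsum at 2; rewrite lsum_map.
  f_equal; apply lsum_ext; intros; reflexivity.
Qed.

Definition zrange (N : nat) : list Z := map (fun i => (Z.of_nat i - Z.of_nat N)%Z) (seq 0 (2 * N + 1)).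

Lemma In_zrange N z : In z (zrange N) <-> (- Z.of_nat N <= z <= Z.of_nat N)%Z.
Proof.
  unfold zrange; rewrite in_map_iff; split.
  - intros [i [<- H]]; apply in_seq in H; lia.
  - intros H; exists (Z.to_nat (z + Z.of_nat N)); rewrite in_seq; lia.
Qed.

Lemma NoDup_zrange N : NoDup (zrange N).
Proof.
  apply FinFun.Injective_map_NoDup; [|apply seq_NoDup].
  intros i j H; lia.
Qed.

(** The coefficient counts integer square roots of i; |z| <= z^2 keeps all of them in the range. *)
Lemma theta_count N i : (i <= N)%nat ->
  lsum (fun z => indic (z * z =? Z.of_nat i)%Z) (zrange N) = theta i.
Proof.
  intros Hi; rewrite lsum_ind.
  set (l := filter _ _).
  assert (Hl : NoDup l) by apply (NoDup_filter _ (NoDup_zrange N)).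
  assert (Hin : forall z, In z l <-> (z * z = Z.of_nat i)%Z).
  { intros z; unfold l; rewrite filter_In, In_zrange, Z.eqb_eq; split; [tauto|].
    intros H; split; [nia|auto]. }
  assert (Hlen : forall l', NoDup l' -> (forall z, In z l' <-> (z * z = Z.of_nat i)%Z) ->
    length l = length l').
  { intros l' H1 H2; apply Permutation_length, NoDup_Permutation; auto.
    intros z; rewrite Hin, H2; tauto. }
  destruct i as [|i].
  - rewrite (Hlen (0%Z :: nil)); [reflexivity| |].
    + constructor; [simpl; tauto|constructor].
    + intros z; simpl; split; [lia|]. intros H; left; nia.
  - unfold theta; destruct (issq (S i)) eqn:E.
    + apply issq_spec in E; destruct E as [s E].
      rewrite (Hlen (Z.of_nat s :: (- Z.of_nat s)%Z :: nil)); [simpl; ring| |].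
      * constructor; [simpl; intros [H|[]]; nia|].
        constructor; [simpl; tauto|constructor].
      * intros z; rewrite E, Nat2Z.inj_mul; cbn [In]; split; [intros [<-|[<-|[]]]; nia|].
        intros H.
        assert ((z - Z.of_nat s) * (z + Z.of_nat s) = 0)%Z by lia.
        apply Z.mul_eq_0 in H0; lia.
    + rewrite (Hlen nil); [reflexivity|constructor|].
      intros z; cbn [In]; split; [tauto|]; intros H.
      assert (issq (S i) = true); [|congruence].
      replace (S i) with (Z.abs_nat z * Z.abs_nat z)%nat by nia.
      apply issq_sq.
Qed.

Definition two_sq (N k : nat) : list (Z * Z) :=
  filter (fun p => fst p * fst p + snd p * snd p =? Z.of_nat k)%Z (list_prod (zrange N) (zrange N)).

Lemma In_two_sq N k m n : (k <= N)%nat ->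
  In (m, n) (two_sq N k) <-> (m * m + n * n = Z.of_nat k)%Z.
Proof.
  intros H; unfold two_sq; rewrite filter_In, in_prod_iff, !In_zrange; simpl; rewrite Z.eqb_eq.
  split; [tauto|]; intros E; repeat split; auto; nia.
Qed.

Lemma NoDup_prod {A B} (l1 : list A) (l2 : list B) : NoDup l1 -> NoDup l2 -> NoDup (list_prod l1 l2).
Proof.
  intros H1 H2; induction H1 as [|a l Ha H1 IH]; simpl; [constructor|].
  apply NoDup_app; auto.
  - apply FinFun.Injective_map_NoDup; auto.
    intros x y E; congruence.
  - intros [x y] E; apply in_map_iff in E; destruct E as [z [E _]]; injection E as <- <-.
    rewrite in_prod_iff; tauto.
Qed.

Lemma NoDup_two_sq N k : NoDup (two_sq N k).
Proof. apply NoDup_filter, NoDup_prod; apply NoDup_zrange. Qed.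

Lemma theta_mul_count N k : (k <= N)%nat -> (theta * theta)%S k = INR (length (two_sq N k)).
Proof.
  intros Hk; unfold two_sq; rewrite <- lsum_ind, lsum_prod; unfold fmul; rewrite conv_lsum.
  transitivity (lsum (fun i => lsum (fun m => lsum (fun n =>
     indic (m * m =? Z.of_nat i)%Z * indic (n * n =? Z.of_nat (k - i))%Z) (zrange N)) (zrange N)) (seq 0 (S k))).
  { apply lsum_ext; intros i Hi; apply in_seq in Hi.
    rewrite <- (theta_count N i), <- (theta_count N (k - i)) by lia.
    rewrite Rmult_comm, <- lsum_scal; apply lsum_ext; intros m _.
    rewrite lsum_scal; ring. }
  rewrite lsum_swap; apply lsum_ext; intros m _.
  rewrite lsum_swap; apply lsum_ext; intros n _; simpl fst; simpl snd.
  destruct (Z.eqb_spec (m * m + n * n) (Z.of_nat k)) as [E|E].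
  - transitivity (lsum (fun i => indic (i =? Z.abs_nat m * Z.abs_nat m)%nat) (seq 0 (S k))).
    + apply lsum_ext; intros i Hi; apply in_seq in Hi; unfold indic.
      destruct (Z.eqb_spec (m * m) (Z.of_nat i)), (Z.eqb_spec (n * n) (Z.of_nat (k - i))),
        (Nat.eqb_spec i (Z.abs_nat m * Z.abs_nat m)); try ring; exfalso; nia.
    + rewrite lsum_ind.
      rewrite (Permutation_length (l' := (Z.abs_nat m * Z.abs_nat m)%nat :: nil)); [reflexivity|].
      apply NoDup_Permutation; [apply NoDup_filter, seq_NoDup|constructor; [simpl; tauto|constructor]|].
      intros i; rewrite filter_In, in_seq, Nat.eqb_eq; simpl; split; [intros [_ ->]; auto|].
      intros [<-|[]]; split; [nia|auto].
  - transitivity (lsum (fun i : nat => 0 * 0) (seq 0 (S k))); [|rewrite lsum_scal; simpl; ring].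
    apply lsum_ext; intros i Hi; apply in_seq in Hi; unfold indic.
    destruct (Z.eqb_spec (m * m) (Z.of_nat i)), (Z.eqb_spec (n * n) (Z.of_nat (k - i))); try ring.
    exfalso; lia.
Qed.

(* Rotation by 45 degrees: (m, n) -> (m + n, m - n). *)
Lemma two_sq_double k : (theta * theta)%S (2 * k)%nat = (theta * theta)%S k.
Proof.
  rewrite (theta_mul_count (2 * k)), (theta_mul_count (2 * k) k) by lia; f_equal.
  symmetry; rewrite <- (length_map (fun p => (fst p + snd p, fst p - snd p)%Z)).
  apply Permutation_length, NoDup_Permutation; [|apply NoDup_two_sq|].
  - apply FinFun.Injective_map_NoDup; [|apply NoDup_two_sq].
    intros [a b] [c d] H; simpl in H; injection H; intros; f_equal; lia.
  - intros [u v]; rewrite In_two_sq, in_map_iff by lia; split.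
    + intros [[m n] [E H]]; simpl in E; injection E as <- <-.
      apply In_two_sq in H; [|lia]; lia.
    + intros H.
      (* u + v has the parity of u^2 + v^2 = 2 k, and the preimage is ((u + v) / 2, (u - v) / 2). *)
      destruct (Z.Even_or_Odd (u + v)) as [[s Hs]|[s Hs]].
      * exists (s, (u - s)%Z); split; [simpl; f_equal; lia|].
        apply In_two_sq; [lia|].
        replace v with (2 * s - u)%Z in H by lia; lia.
      * exfalso; replace v with (2 * s + 1 - u)%Z in H by lia. lia.
Qed.

(* theta_3^2 and theta_4^2 as series in the nome. *)
Definition th3sq : fps := (theta * theta)%S.
Definition th4sq : fps := fneg th3sq.

(** * The doubling identities and Jacobi's identity *)

Lemma fneg_even_coef f k : fneg f (2 * k)%nat = f (2 * k)%nat.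
Proof. unfold fneg; rewrite pow_mult; replace ((-1) ^ 2) with 1 by ring; rewrite pow1; ring. Qed.
Lemma fneg_odd_coef f k : fneg f (2 * k + 1)%nat = - f (2 * k + 1)%nat.
Proof.
  unfold fneg; rewrite pow_add, pow_mult; replace ((-1) ^ 2) with 1 by ring; rewrite pow1; ring.
Qed.
Lemma fsq_even_coef f k : fsq f (2 * k)%nat = f k.
Proof. unfold fsq; rewrite Nat.even_even, Nat.div2_double; auto. Qed.
Lemma fsq_odd_coef f k : fsq f (2 * k + 1)%nat = 0.
Proof. unfold fsq; rewrite Nat.even_odd; auto. Qed.

Lemma fps_parity (f g : fps) : (forall k, f (2 * k)%nat = g (2 * k)%nat) ->
  (forall k, f (2 * k + 1)%nat = g (2 * k + 1)%nat) -> f = g.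
Proof.
  intros H0 H1; fext; intro n; destruct (Nat.Even_or_Odd n) as [[k ->]|[k ->]]; auto.
Qed.

(** The odd terms cancel and the even ones are doubled; by [two_sq_double] the even part of
    theta_3^2 is theta_3^2 at x^2. *)
Lemma th3sq_add_th4sq : (th3sq + th4sq = fint 2 * fsq th3sq)%S.
Proof.
  apply fps_parity; intros k; rewrite fint_mul_app; unfold fadd, th4sq.
  - rewrite fneg_even_coef, fsq_even_coef; unfold th3sq; rewrite two_sq_double; ring.
  - rewrite fneg_odd_coef, fsq_odd_coef; ring.
Qed.

(** At x^(2 k) a pair with s^2 + t^2 = 2 k carries the sign (-1)^(t^2), which equals (-1)^k because
    s and t have the same parity; [two_sq_double] then passes from 2 k to k. The odd coefficients
    vanish because the product is invariant under x -> -x. *)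
Lemma theta_mul_neg : (theta * fneg theta = fsq th4sq)%S.
Proof.
  set (F := (theta * fneg theta)%S).
  apply fps_parity; intros k.
  - rewrite fsq_even_coef; unfold th4sq, fneg at 1, th3sq; rewrite <- two_sq_double.
    unfold F, fmul; rewrite !conv_lsum, <- lsum_scal; apply lsum_ext; intros i Hi; apply in_seq in Hi.
    assert (Hs : forall n, theta n <> 0 -> exists s, n = (s * s)%nat).
    { intros n Hn; destruct n; [exists 0%nat; auto|]. unfold theta in Hn.
      destruct (issq (S n)) eqn:E; [apply issq_spec; auto|lra]. }
    destruct (Req_dec (theta i) 0) as [E|E]; [rewrite E; ring|].
    destruct (Req_dec (theta (2 * k - i)%nat) 0) as [E'|E']; [unfold fneg; rewrite E'; ring|].
    destruct (Hs _ E) as [s Es], (Hs _ E') as [t Et].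
    unfold fneg; transitivity (theta i * theta (2 * k - i)%nat * (-1) ^ (2 * k - i)); [ring|].
    enough (H : (-1) ^ (2 * k - i) = (-1) ^ k) by (rewrite H; ring).
    rewrite Et.
    assert (Hp : forall a b, Nat.even a = Nat.even b -> (-1) ^ a = (-1) ^ b).
    { assert (He : forall a, (-1) ^ a = if Nat.even a then 1 else -1).
      { intros a; destruct (Nat.Even_or_Odd a) as [[c ->]|[c ->]].
        - rewrite Nat.even_even, pow_mult; replace ((-1) ^ 2) with 1 by ring; apply pow1.
        - rewrite Nat.even_odd, pow_add, pow_mult; replace ((-1) ^ 2) with 1 by ring; rewrite pow1; ring. }
      intros a b H; rewrite !He, H; auto. }
    apply Hp; rewrite Nat.even_mul, Bool.orb_diag.
    assert (H2 : (2 * k = s * s + t * t)%nat) by lia; clear - H2.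
    destruct (Nat.Even_or_Odd s) as [[c ->]|[c ->]], (Nat.Even_or_Odd t) as [[d ->]|[d ->]];
      rewrite ?Nat.even_even, ?Nat.even_odd.
    + replace k with (2 * (c * c + d * d))%nat by lia; rewrite Nat.even_even; auto.
    + exfalso; lia.
    + exfalso; lia.
    + replace k with (2 * (c * c + c + d * d + d) + 1)%nat by lia; rewrite Nat.even_odd; auto.
  - rewrite fsq_odd_coef.
    assert (H : fneg F = F) by (unfold F; rewrite fneg_mul, fneg_neg, fmul_comm; auto).
    assert (H1 : fneg F (2 * k + 1)%nat = F (2 * k + 1)%nat) by (rewrite H; auto).
    rewrite fneg_odd_coef in H1; lra.
Qed.

Lemma th4sq_theta : th4sq = (fneg theta * fneg theta)%S.
Proof. unfold th4sq, th3sq; apply fneg_mul. Qed.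

Lemma th3sq_mul_th4sq : (th3sq * th4sq = fsq th4sq * fsq th4sq)%S.
Proof. rewrite <- theta_mul_neg, th4sq_theta; unfold th3sq; ring. Qed.

Lemma fneg_th4sq : fneg th4sq = th3sq. Proof. apply fneg_neg. Qed.

(* Its vanishing is Jacobi's identity D log (theta_3^2 / theta_4^2) = theta_2^4 / 2. *)
Definition jacobi_defect : fps :=
  (fint 2 * (th4sq * fder th3sq - th3sq * fder th4sq) - (th3sq * th3sq - th4sq * th4sq) * th3sq * th4sq)%S.

(** Differentiating both doubling identities expresses the derivatives at x^2 by those at x. *)
Lemma jacobi_defect_double : (fint 8 * (fsq th4sq * fsq jacobi_defect) = (th3sq - th4sq) * jacobi_defect)%S.
Proof.
  assert (Hd : (fint 4 * (fsq th4sq * fsq (fder th4sq)) = fder th3sq * th4sq + th3sq * fder th4sq)%S).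
  { rewrite <- fder_mul, th3sq_mul_th4sq, fder_mul, fder_sq; ring. }
  assert (Ha : (fint 4 * fsq (fder th3sq) = fder th3sq + fder th4sq)%S).
  { rewrite <- fder_add, th3sq_add_th4sq, fder_fint_mul, fder_sq; ring. }
  unfold jacobi_defect; rewrite !fsq_sub, !fsq_mul, !fsq_sub, !fsq_int, !fsq_mul.
  transitivity ((fint 4 * fsq (fder th3sq)) * (fint 4 * (fsq th4sq * fsq th4sq))
    - (fint 2 * fsq th3sq) * fint 2 * (fint 4 * (fsq th4sq * fsq (fder th4sq)))
    - ((fint 2 * fsq th3sq) * (fint 2 * fsq th3sq) - fint 4 * (fsq th4sq * fsq th4sq))
       * (fint 2 * fsq th3sq) * (fsq th4sq * fsq th4sq))%S; [ring|].
  rewrite Hd, Ha, <- th3sq_mul_th4sq, <- th3sq_add_th4sq; ring.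
Qed.

Lemma th3sq_coefs : th3sq 0%nat = 1 /\ th3sq 1%nat = 4.
Proof.
  assert (H0 : theta 0%nat = 1) by reflexivity.
  assert (H1 : theta 1%nat = 2) by reflexivity.
  unfold th3sq, fmul; cbn [conv]; unfold fps_tail; rewrite H0, H1; split; ring.
Qed.
Lemma th4sq_coefs : th4sq 0%nat = 1 /\ th4sq 1%nat = - 4.
Proof. unfold th4sq, fneg; destruct th3sq_coefs as [-> ->]; simpl; split; ring. Qed.

(** If the defect starts at x^n with n >= 2, the left side of [jacobi_defect_double] has order at
    least 2 n, while the right side starts at x^(n+1), since th3sq - th4sq = 8 x + ...; but 2 n > n
    + 1. For n = 0 and n = 1 the orders do not decide, so these coefficients are computed. *)
Lemma jacobi_defect_0 : jacobi_defect = fint 0.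
Proof.
  destruct th3sq_coefs as [a0 a1], th4sq_coefs as [b0 b1].
  assert (Hz0 : jacobi_defect 0%nat = 0).
  { cbv [jacobi_defect fmul conv fsub fder fint fcst fps_tail]; cbn [INR]; rewrite a0, b0; ring. }
  assert (Hz1 : jacobi_defect 1%nat = 0).
  { cbv [jacobi_defect fmul conv fsub fder fint fcst fps_tail]; cbn [INR]; rewrite a0, b0, a1, b1; ring. }
  assert (Hab0 : forder 1 (th3sq - th4sq)).
  { intros k Hk; replace k with 0%nat by lia; unfold fsub; rewrite a0, b0; ring. }
  apply fps_ind0; intros n Hn.
  destruct n as [|[|n]]; auto.
  destruct (forder_mul _ _ _ _ Hab0 Hn) as [_ E].
  rewrite <- jacobi_defect_double, fint_mul_app in E.
  assert (H : forder (S (S (S n))) (fsq jacobi_defect)).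
  { intros k Hk; unfold fsq; destruct (Nat.even k) eqn:Ek; auto.
    apply Nat.even_spec in Ek; destruct Ek as [m ->]; rewrite Nat.div2_double; apply Hn; lia. }
  assert (H' : forder (1 + S (S n)) (fsq jacobi_defect)) by exact H.
  assert (Hq : fsq jacobi_defect (1 + S (S n))%nat = 0).
  { unfold fsq; destruct (Nat.even (1 + S (S n))) eqn:Ek; auto.
    apply Nat.even_spec in Ek; destruct Ek as [m Em]; rewrite Em, Nat.div2_double; apply Hn; lia. }
  assert (H0 : forder 0 (fsq th4sq)) by (intros k Hk; lia).
  destruct (forder_mul _ _ _ _ H0 H') as [_ E2]; simpl in E2, E.
  simpl in Hq; rewrite E2, Hq in E; unfold fsub in E; rewrite a1, b1 in E; lra.
Qed.

Open Scope R_scope.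

(** * Gauss's product for theta_4 *)

Definition mono (k : nat) : fps := fun n => if (n =? k)%nat then 1 else 0.

Lemma conv_mono k f n : (mono k * f)%S n = if (k <=? n)%nat then f (n - k)%nat else 0.
Proof.
  unfold fmul; revert n; induction k as [|k IH]; intros n.
  - replace (mono 0) with (fcst 1) by (fext; intros [|m]; reflexivity).
    rewrite conv_cst_l, Nat.sub_0_r; simpl; ring.
  - destruct n as [|n]; [unfold mono; simpl; ring|].
    cbn [conv]; replace (fps_tail (mono (S k))) with (mono k) by (fext; reflexivity).
    rewrite IH; unfold mono; simpl; ring.
Qed.

Lemma mono_mul i j : (mono i * mono j = mono (i + j))%S.
Proof.
  fext; intro n; rewrite conv_mono; unfold mono.
  destruct (Nat.leb_spec i n), (Nat.eqb_spec n (i + j)), (Nat.eqb_spec (n - i) j); auto; lia.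
Qed.

Lemma mono_0 : mono 0 = fint 1.
Proof. fext; intros [|n]; reflexivity. Qed.

Lemma fder_mono k : fder (mono k) = (fint (Z.of_nat k) * mono k)%S.
Proof.
  fext; intro n; rewrite fint_mul_app, <- INR_IZR_INZ; unfold fder, mono.
  destruct (Nat.eqb_spec n k); subst; ring.
Qed.

Definition geom (k : nat) : fps := fun n => if (n mod k =? 0)%nat then 1 else 0.

Lemma geom_inv k : (0 < k)%nat -> ((fint 1 - mono k) * geom k = fint 1)%S.
Proof.
  intros Hk.
  replace ((fint 1 - mono k) * geom k)%S with (geom k - mono k * geom k)%S by ring.
  fext; intro n; unfold fsub; rewrite conv_mono; unfold geom, fint, fcst.
  destruct (Nat.leb_spec k n).
  - replace (n mod k)%nat with ((n - k) mod k)%nat.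
    + destruct n; [lia|]; ring.
    + rewrite <- (Nat.Div0.mod_add (n - k) 1 k); f_equal; lia.
  - destruct n.
    + rewrite Nat.Div0.mod_0_l; simpl; ring.
    + rewrite Nat.mod_small by lia; simpl; ring.
Qed.

Lemma fder_geom k : (0 < k)%nat ->
  fder (geom k) = (fint (Z.of_nat k) * mono k * geom k * geom k)%S.
Proof.
  intros Hk.
  assert (H := f_equal fder (geom_inv k Hk)).
  rewrite fder_mul, fder_sub, !fder_int, fder_mono in H.
  assert (H1 := geom_inv k Hk).
  transitivity (((fint 1 - mono k) * geom k) * fder (geom k))%S; [rewrite H1; ring|].
  transitivity (geom k * ((fint 0 - fint (Z.of_nat k) * mono k) * geom k + (fint 1 - mono k) * fder (geom k))
     + fint (Z.of_nat k) * mono k * geom k * geom k)%S; [ring|].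
  rewrite H; ring.
Qed.

(* gprod n = prod_{k=1}^n (1 - x^k) / (1 + x^k), with 1 / (1 + x^k) = (1 - x^k) / (1 - x^{2k}). *)
Fixpoint gprod (n : nat) : fps :=
  match n with
  | O => fint 1
  | S p => (gprod p * ((fint 1 - mono (S p)) * (fint 1 - mono (S p)) * geom (S p + S p)))%S
  end.

Fixpoint gprod_inv (n : nat) : fps :=
  match n with
  | O => fint 1
  | S p => (gprod_inv p * (geom (S p) * (fint 1 + mono (S p))))%S
  end.

Lemma geom_inv2 k : (0 < k)%nat -> ((fint 1 - mono k * mono k) * geom (k + k) = fint 1)%S.
Proof. intros H; rewrite mono_mul; apply geom_inv; lia. Qed.

Lemma gprod_step p : (gprod (S p) * (fint 1 + mono (S p)) = gprod p * (fint 1 - mono (S p)))%S.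
Proof.
  assert (H := geom_inv2 (S p) ltac:(lia)); cbn [gprod].
  transitivity (gprod p * (fint 1 - mono (S p)) *
    ((fint 1 - mono (S p) * mono (S p)) * geom (S p + S p)))%S; [ring|rewrite H; ring].
Qed.

Lemma gprod_inv_step p :
  (gprod_inv (S p) * (fint 1 - mono (S p)) = gprod_inv p * (fint 1 + mono (S p)))%S.
Proof.
  assert (H := geom_inv (S p) ltac:(lia)); cbn [gprod_inv].
  transitivity (gprod_inv p * (fint 1 + mono (S p)) *
    ((fint 1 - mono (S p)) * geom (S p)))%S; [ring|rewrite H; ring].
Qed.

Lemma gprod_mul_inv n : (gprod n * gprod_inv n = fint 1)%S.
Proof.
  induction n as [|n IH]; [cbn; ring|].
  assert (H := geom_inv (S n) ltac:(lia)).
  transitivity (gprod (S n) * (fint 1 + mono (S n)) * (gprod_inv n * geom (S n)))%S.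
  { cbn [gprod_inv]; ring. }
  rewrite gprod_step.
  transitivity ((gprod n * gprod_inv n) * ((fint 1 - mono (S n)) * geom (S n)))%S; [ring|].
  rewrite H, IH; ring.
Qed.

Definition sgnz (n : nat) : Z := if Nat.even n then 1%Z else (-1)%Z.

Lemma sgnz_S n : sgnz (S n) = (- sgnz n)%Z.
Proof. unfold sgnz; rewrite Nat.even_succ, <- Nat.negb_even; destruct (Nat.even n); auto. Qed.

Lemma sgnz_pow n : IZR (sgnz n) = (-1) ^ n.
Proof. induction n as [|n IH]; [reflexivity|]; rewrite sgnz_S, opp_IZR, IH; simpl; ring. Qed.

(* Following Shanks: gprod p * shanksB p p is a polynomial truncation of sum (-1)^j x^(j^2), because
   the difference of the sums A for p + 1 and B for p telescopes, and shanksB p p = 1 mod x^p. *)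
Fixpoint shanksA (n m : nat) : fps :=
  match m with
  | O => fint 0
  | S s => (shanksA n s + fint (sgnz s) * gprod_inv s * (mono (s * n) - mono (S s * n)))%S
  end.

Fixpoint shanksB (n m : nat) : fps :=
  match m with
  | O => fint 0
  | S s => (shanksB n s + fint (sgnz s) * gprod_inv s * (mono (s * n) + mono (S s * n)))%S
  end.

Lemma fint_opp z : fint (- z) = (- fint z)%S.
Proof. fext; intros [|n]; unfold fint, fcst, fopp; rewrite ?opp_IZR; ring. Qed.

(** In the induction step [gprod_inv_step] rewrites the new summand of A so that it cancels against
    the new summand of B. *)
Lemma shanks_telescope p m :
  (shanksA (S p) (S m) - shanksB p m =
   fint (sgnz m) * gprod_inv m * (mono (m * p) - mono (S m * S p)))%S.
Proof.
  induction m as [|m IH].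
  - cbn [shanksA shanksB gprod_inv]; change (sgnz 0) with 1%Z; cbn [Nat.mul]; ring.
  - transitivity ((shanksA (S p) (S m) - shanksB p m)
      + fint (sgnz (S m)) * gprod_inv (S m) * (mono (S m * S p) - mono (S (S m) * S p))
      - fint (sgnz m) * gprod_inv m * (mono (m * p) + mono (S m * p)))%S; [cbn [shanksA shanksB]; ring|].
    rewrite IH, sgnz_S, fint_opp.
    transitivity (- (fint (sgnz m) * gprod_inv (S m) * (mono (S m * p) - mono (S (S m) * S p)))
      + fint (sgnz m) * (gprod_inv (S m) * (fint 1 - mono (S m)) * mono (S m * p)
        - gprod_inv m * (fint 1 + mono (S m)) * mono (S m * p)))%S.
    + replace (mono (S m * S p)) with (mono (S m) * mono (S m * p))%S
        by (rewrite mono_mul; f_equal; lia).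
      ring.
    + rewrite gprod_inv_step; ring.
Qed.

(** Termwise: on both sides the s-th summand has the factor x^(s n) (1 - x^n) (1 + x^n). *)
Lemma shanks_AB n m : ((fint 1 + mono n) * shanksA n m = (fint 1 - mono n) * shanksB n m)%S.
Proof.
  induction m as [|m IH]; [cbn; ring|].
  cbn [shanksA shanksB].
  replace (mono (S m * n)) with (mono n * mono (m * n))%S by (rewrite mono_mul; f_equal; lia).
  transitivity ((fint 1 + mono n) * shanksA n m + (fint 1 - mono n) * (fint (sgnz m) * gprod_inv m *
    (mono (m * n) + mono n * mono (m * n))))%S; [ring|rewrite IH; ring].
Qed.

(** Partial sums of 1 + 2 sum (-1)^j x^(j^2) whose last square is counted once instead of twice:
    each square is shared between two consecutive differences, which is the shape that the
    telescoping produces. *)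
Fixpoint sqsum (p : nat) : fps :=
  match p with
  | O => fint 0
  | S j => (sqsum j + fint (sgnz j) * (mono (j * j) - mono (S j * S j)))%S
  end.

Lemma gauss_finite p : (gprod p * shanksB p p = sqsum p)%S.
Proof.
  induction p as [|p IH]; [cbn; ring|].
  assert (E : (gprod (S p) * shanksB (S p) (S p) = gprod p * shanksA (S p) (S p))%S).
  { assert (H := gprod_step p); assert (H2 := shanks_AB (S p) (S p)).
    assert (Hg := geom_inv (S p) ltac:(lia)).
    (* Inserting (1 - x^(p+1)) [geom (S p)] = 1 stands for cancelling the factor 1 - x^(p+1) of
       [shanks_AB]. *)
    transitivity (gprod (S p) * geom (S p) * ((fint 1 - mono (S p)) * shanksB (S p) (S p)))%S.
    { transitivity (gprod (S p) * shanksB (S p) (S p) * ((fint 1 - mono (S p)) * geom (S p)))%S;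
        [rewrite Hg|]; ring. }
    rewrite <- H2.
    transitivity ((gprod (S p) * (fint 1 + mono (S p))) * geom (S p) * shanksA (S p) (S p))%S; [ring|].
    rewrite H.
    transitivity (gprod p * shanksA (S p) (S p) * ((fint 1 - mono (S p)) * geom (S p)))%S;
      [|rewrite Hg]; ring. }
  rewrite E; cbn [sqsum]; rewrite <- IH.
  transitivity (gprod p * (shanksB p p + (shanksA (S p) (S p) - shanksB p p)))%S; [ring|].
  rewrite shanks_telescope.
  transitivity (gprod p * shanksB p p + (gprod p * gprod_inv p) *
    (fint (sgnz p) * (mono (p * p) - mono (S p * S p))))%S; [ring|].
  rewrite gprod_mul_inv; ring.
Qed.

Definition eqmod (N : nat) (f g : fps) := forall m, (m < N)%nat -> f m = g m.

Lemma eqmod_mul N f f' g g' : eqmod N f f' -> eqmod N g g' -> eqmod N (f * g) (f' * g').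
Proof.
  intros Hf Hg m Hm.
  assert (E : (f * g = f' * g' + ((f - f') * g + f' * (g - g')))%S) by ring.
  rewrite E; unfold fadd at 1 2.
  assert (H0 : forall h, forder 0 h) by (intros h k Hk; lia).
  destruct (forder_mul N 0 (f - f') g) as [H1 _]; auto.
  { intros k Hk; unfold fsub; rewrite Hf by auto; ring. }
  destruct (forder_mul 0 N f' (g - g')) as [H2 _]; auto.
  { intros k Hk; unfold fsub; rewrite Hg by auto; ring. }
  rewrite H1, H2 by lia; ring.
Qed.

Lemma eqmod_add N f f' g g' : eqmod N f f' -> eqmod N g g' -> eqmod N (f + g) (f' + g').
Proof. intros Hf Hg m Hm; unfold fadd; rewrite Hf, Hg; auto. Qed.

Lemma eqmod_refl N f : eqmod N f f. Proof. intros m _; auto. Qed.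

Lemma eqmod_mono N k : (N <= k)%nat -> eqmod N (mono k) (fint 0).
Proof.
  intros H m Hm; unfold mono; destruct (Nat.eqb_spec m k); [lia|destruct m; auto].
Qed.

(** Of all monomials in the sum only the 1 from s = 0 has degree below p. *)
Lemma shanksB_eqmod p m : eqmod p (shanksB p (S m)) (fint 1).
Proof.
  induction m as [|m IH].
  - cbn [shanksB gprod_inv]; change (sgnz 0) with 1%Z; cbn [Nat.mul].
    replace (fint 1) with (fint 0 + fint 1 * fint 1 * (mono 0 + fint 0))%S at 3
      by (rewrite mono_0; ring).
    repeat (apply eqmod_add || apply eqmod_mul || apply eqmod_refl); apply eqmod_mono; lia.
  - replace (fint 1) with (fint 1 + fint (sgnz (S m)) * gprod_inv (S m) * (fint 0 + fint 0))%S by ring.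
    change (shanksB p (S (S m))) with (shanksB p (S m) +
      fint (sgnz (S m)) * gprod_inv (S m) * (mono (S m * p) + mono (S (S m) * p)))%S.
    repeat (apply eqmod_add || apply eqmod_mul || apply eqmod_refl); try apply eqmod_mono; auto; lia.
Qed.

Lemma gprod_sqsum N : eqmod N (gprod N) (sqsum N).
Proof.
  destruct N as [|p]; [intros m Hm; lia|].
  rewrite <- gauss_finite.
  intros m Hm.
  rewrite (eqmod_mul (S p) _ _ _ _ (eqmod_refl _ (gprod (S p))) (shanksB_eqmod (S p) p)) by auto.
  replace (gprod (S p) * fint 1)%S with (gprod (S p)) by ring; reflexivity.
Qed.

Lemma sqsum_coef p m :
  sqsum (S p) m = if (m <? S p * S p)%nat then fneg theta m
                  else if (m =? S p * S p)%nat then IZR (- sgnz p) else 0.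
Proof.
  induction p as [|p IH].
  - cbn [sqsum]; unfold fadd; rewrite fint_mul_app; unfold fsub, mono, fneg.
    change (sgnz 0) with 1%Z; destruct m as [|[|m]]; [cbn; ring|cbn; ring|cbn]. ring.
  - change (sqsum (S (S p))) with (sqsum (S p) + fint (sgnz (S p)) * (mono (S p * S p) - mono (S (S p) * S (S p))))%S.
    unfold fadd; rewrite fint_mul_app, IH; unfold fsub, mono.
    rewrite !sgnz_S, !opp_IZR.
    destruct (Nat.ltb_spec m (S p * S p)), (Nat.ltb_spec m (S (S p) * S (S p))),
      (Nat.eqb_spec m (S p * S p)), (Nat.eqb_spec m (S (S p) * S (S p))); try nia; try ring.
    + subst m; unfold fneg; rewrite theta_sq by lia.
      replace ((-1) ^ (S p * S p)) with (IZR (sgnz (S p))).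
      * rewrite sgnz_S, opp_IZR; ring.
      * rewrite <- sgnz_pow; f_equal; unfold sgnz; rewrite Nat.even_mul, Bool.orb_diag; auto.
    + unfold fneg; rewrite (theta_nonsq (S p)) by lia; ring.
Qed.

(** Gauss's product formula read modulo x^N: [sqsum N] agrees with theta_4 even below x^(N^2). *)
Lemma gprod_theta N : eqmod N (gprod N) (fneg theta).
Proof.
  intros m Hm; rewrite gprod_sqsum by auto; destruct N; [lia|].
  rewrite sqsum_coef; destruct (Nat.ltb_spec m (S N * S N)); [auto|nia].
Qed.

(** * Divisor sums as the logarithmic derivative of theta_4 *)

(** Partial Lambert series: the k-th summand is k x^k / (1 - x^k), because [geom k] is 1 / (1 -
    x^k). *)
Fixpoint lambert (n : nat) : fps :=
  match n with
  | O => fint 0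
  | S p => (lambert p + fint (Z.of_nat (S p)) * (geom (S p) - fint 1))%S
  end.

Lemma fsq_geom k : (0 < k)%nat -> fsq (geom k) = geom (k + k).
Proof.
  intros Hk; apply fps_parity; intros j; rewrite ?fsq_even_coef, ?fsq_odd_coef; unfold geom.
  - replace (k + k)%nat with (2 * k)%nat by lia.
    rewrite Nat.Div0.mul_mod_distr_l.
    destruct (Nat.eqb_spec (j mod k) 0), (Nat.eqb_spec (2 * (j mod k)) 0); auto; lia.
  - destruct (Nat.eqb_spec ((2 * j + 1) mod (k + k)) 0) as [E|E]; auto.
    apply Nat.Div0.mod_divides in E; destruct E as [c E]; lia.
Qed.

(** The k-th factor (1 - x^k)^2 / (1 - x^(2 k)) has logarithmic derivative -2 k x^k / (1 - x^k) + 2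
    k x^(2 k) / (1 - x^(2 k)), which is twice the k-th Lambert term at x^2 minus that at x. *)
Lemma fder_gprod n : fder (gprod n) = (gprod n * (fint 2 * (fsq (lambert n) - lambert n)))%S.
Proof.
  induction n as [|n IH]; [cbn [gprod lambert]; rewrite fder_int, fsq_int; ring|].
  cbn [gprod lambert].
  rewrite !fder_mul, IH, fder_sub, fder_int, fder_mono, fder_geom, fsq_add, fsq_mul, fsq_sub, !fsq_int, fsq_geom by lia.
  assert (H1 := geom_inv (S n) ltac:(lia)).
  assert (H2 := geom_inv2 (S n) ltac:(lia)).
  replace (fint (Z.of_nat (S n + S n))) with (fint 2 * fint (Z.of_nat (S n)))%S.
  2:{ replace (Z.of_nat (S n + S n)) with (2 * Z.of_nat (S n))%Z by lia.
      fext; intros m; rewrite fint_mul_app; destruct m; unfold fint, fcst; rewrite ?mult_IZR; ring. }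
  rewrite <- mono_mul.
  set (m := mono (S n)) in *; set (H := geom (S n)) in *; set (K := geom (S n + S n)) in *.
  set (c := fint (Z.of_nat (S n))).
  assert (E1 : (m * m * K = K - fint 1)%S) by (rewrite <- H2; ring).
  transitivity (gprod n * (fint 2 * (fsq (lambert n) - lambert n)) * ((fint 1 - m) * (fint 1 - m) * K)
    + gprod n * (fint 2 * c * (fint 1 - m) * K * ((fint 1 - m) * (m * m * K) - m)))%S; [ring|].
  rewrite E1.
  transitivity (gprod n * (fint 2 * (fsq (lambert n) - lambert n)) * ((fint 1 - m) * (fint 1 - m) * K)
    + gprod n * (fint 2 * c * (fint 1 - m) * K * ((fint 1 - m) * K - (fint 1 - m) * H)))%S;
    [rewrite H1; ring|ring].
Qed.

Definition fsigma : fps := fun n => INR (sigma1 n).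

Lemma lambert_coef N n : lambert N n =
  match n with O => 0 | _ => lsum (fun k => INR k * indic (n mod k =? 0)%nat) (seq 1 N) end.
Proof.
  induction N as [|N IH]; [destruct n; reflexivity|].
  cbn [lambert]; unfold fadd; rewrite IH, fint_mul_app, <- INR_IZR_INZ.
  unfold fsub, geom, fint, fcst.
  destruct n as [|n]; [rewrite Nat.Div0.mod_0_l; simpl; ring|].
  rewrite seq_S, lsum_app; cbn [lsum fold_right]; unfold indic.
  replace (1 + N)%nat with (S N) by lia; ring.
Qed.

Lemma lambert_sigma N : eqmod (S N) (lambert N) fsigma.
Proof.
  intros n Hn; rewrite lambert_coef; destruct n as [|n]; [reflexivity|].
  unfold fsigma, sigma1.
  replace N with (S n + (N - S n))%nat by lia.
  rewrite seq_app, lsum_app.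
  replace (lsum _ (seq (1 + S n) _)) with 0.
  - rewrite Rplus_0_r; generalize (seq 1 (S n)); intros l; induction l as [|k l IH]; [reflexivity|].
    cbn [lsum fold_right filter]; fold (lsum (fun k => INR k * indic (S n mod k =? 0)%nat) l); rewrite IH; destruct (_ =? 0)%nat; unfold indic.
    + cbn [list_sum fold_right]; rewrite plus_INR; unfold list_sum; ring.
    + ring.
  - transitivity (lsum (fun _ : nat => 0 * 0) (seq (1 + S n) (N - S n))); [rewrite lsum_scal; ring|].
    apply lsum_ext; intros k Hk; apply in_seq in Hk; rewrite Nat.mod_small by lia; unfold indic; simpl; ring.
Qed.

Lemma fsq_eqmod N f g : eqmod N f g -> eqmod N (fsq f) (fsq g).
Proof.
  intros H m Hm; unfold fsq; destruct (Nat.even m); auto; apply H.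
  assert (Nat.div2 m <= m)%nat by (apply Nat.div2_decr; lia); lia.
Qed.

Lemma fder_neg_theta :
  fder (fneg theta) = (fneg theta * (fint 2 * (fsq fsigma - fsigma)))%S.
Proof.
  fext; intros m.
  (* Only coefficients up to m enter, so the product with m + 1 factors can replace theta_4. *)
  assert (H := gprod_theta (S m)).
  unfold fder; rewrite <- H by lia.
  change (INR m * gprod (S m) m) with (fder (gprod (S m)) m); rewrite fder_gprod.
  apply (eqmod_mul (S m)); [auto| |lia].
  apply eqmod_mul; [apply eqmod_refl|].
  assert (HL : eqmod (S m) (lambert (S m)) fsigma) by (intros j Hj; apply lambert_sigma; lia).
  intros j Hj; unfold fsub; rewrite HL, (fsq_eqmod _ _ _ HL); auto.
Qed.

(* E2 as a series in q = x^2; then in the nome x. *)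
Definition eis2 : fps := (fint 1 - fint 24 * fsigma)%S.
Definition eis2_nome : fps := fsq eis2.

Lemma fder_th4sq_P : (fint 6 * fder th4sq = th4sq * (eis2 - eis2_nome))%S.
Proof.
  rewrite th4sq_theta, fder_mul, fder_neg_theta; unfold eis2_nome, eis2.
  rewrite fsq_sub, fsq_mul, !fsq_int; ring.
Qed.

Lemma fder_th3sq_P : (fint 6 * fder th3sq = th3sq * (fneg eis2 - eis2_nome))%S.
Proof.
  assert (H := f_equal fneg fder_th4sq_P).
  rewrite !fneg_mul, fneg_int, fneg_der, fneg_th4sq, fneg_sub in H.
  rewrite H; unfold eis2_nome; rewrite fneg_sq; auto.
Qed.

(** * Ramanujan's equations as identities of formal series *)

Lemma fps_sub_eq f g : (f - g = fint 0)%S -> f = g.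
Proof. intros H; transitivity (g + (f - g))%S; [ring|rewrite H; ring]. Qed.

Lemma th3sq_ne : th3sq 0%nat <> 0. Proof. destruct th3sq_coefs as [-> _]; lra. Qed.
Lemma th4sq_ne : th4sq 0%nat <> 0. Proof. destruct th4sq_coefs as [-> _]; lra. Qed.
Lemma fint_ne z : z <> 0%Z -> fint z 0%nat <> 0.
Proof. intros H; unfold fint, fcst; apply eq_IZR_contrapositive; auto. Qed.

(** Two values of 6 D log (a / b): the left side, by the two preceding derivatives, and 3 (a^2 -
    b^2), by Jacobi's identity. *)
Lemma fneg_P : (fneg eis2 - eis2 = fint 3 * (th3sq * th3sq - th4sq * th4sq))%S.
Proof.
  apply fps_sub_eq, (fmul_cancel th3sq); [apply th3sq_ne|]; apply (fmul_cancel th4sq); [apply th4sq_ne|].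
  transitivity (th4sq * (th3sq * (fneg eis2 - eis2_nome)) - th3sq * (th4sq * (eis2 - eis2_nome))
    - fint 3 * ((th3sq * th3sq - th4sq * th4sq) * th3sq * th4sq))%S; [ring|].
  rewrite <- fder_th3sq_P, <- fder_th4sq_P.
  transitivity (fint 3 * jacobi_defect)%S; [unfold jacobi_defect; ring|rewrite jacobi_defect_0; ring].
Qed.

(** Two values of 6 D log (a b): directly, and through a b = b(x^2)^2. The result is the eigenvalue
    equation of E2 for the Hecke operator at 2, with eigenvalue 3. *)
Lemma eis2_hecke : (eis2 + fneg eis2 + fint 4 * fsq eis2_nome = fint 6 * eis2_nome)%S.
Proof.
  apply fps_sub_eq, (fmul_cancel th3sq); [apply th3sq_ne|]; apply (fmul_cancel th4sq); [apply th4sq_ne|].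
  assert (E1 : (fint 6 * fder (th3sq * th4sq) = th3sq * th4sq * (eis2 + fneg eis2 - fint 2 * eis2_nome))%S).
  { rewrite fder_mul.
    transitivity ((fint 6 * fder th3sq) * th4sq + th3sq * (fint 6 * fder th4sq))%S; [ring|].
    rewrite fder_th3sq_P, fder_th4sq_P; ring. }
  assert (E2 : (fint 6 * fder (th3sq * th4sq) = th3sq * th4sq * (fint 4 * (eis2_nome - fsq eis2_nome)))%S).
  { rewrite th3sq_mul_th4sq, fder_mul, fder_sq.
    transitivity (fint 4 * fsq th4sq * (fsq (fint 6 * fder th4sq)))%S; [rewrite fsq_mul, fsq_int; ring|].
    rewrite fder_th4sq_P, fsq_mul, fsq_sub; unfold eis2_nome; ring. }
  transitivity (th3sq * th4sq * (eis2 + fneg eis2 - fint 2 * eis2_nome) - th3sq * th4sq * (fint 4 * (eis2_nome - fsq eis2_nome)))%S; [ring|].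
  rewrite <- E1, <- E2; ring.
Qed.

(** The defect G satisfies G(x^2) = G(x) by the Hecke relation and the doubling identities, and G(0)
    = 0. *)
Lemma eis2_theta : (eis2 = fint 2 * eis2_nome - fint 2 * (th3sq * th3sq) + th4sq * th4sq)%S.
Proof.
  assert (Hn := fneg_P); assert (Hh := eis2_hecke); assert (Hab := th3sq_add_th4sq); assert (Hm := th3sq_mul_th4sq).
  set (G := (fint 2 * eis2_nome - eis2 - fint 2 * (th3sq * th3sq) + th4sq * th4sq)%S).
  assert (H : (fint 1 * fsq G = G)%S).
  { apply fps_sub_eq, (fmul_cancel (fint 2)); [apply fint_ne; lia|].
    unfold G; rewrite fsq_add, !fsq_sub, !fsq_mul, !fsq_int; change (fsq eis2) with eis2_nome.
    transitivity ((eis2 + fneg eis2 + fint 4 * fsq eis2_nome - fint 6 * eis2_nome) - (fneg eis2 - eis2 - fint 3 * (th3sq * th3sq - th4sq * th4sq))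
      - ((fint 2 * fsq th3sq) * (fint 2 * fsq th3sq) - (th3sq + th4sq) * (th3sq + th4sq))
      + fint 2 * (fsq th4sq * fsq th4sq - th3sq * th4sq))%S; [ring|].
    rewrite Hh, Hn, Hm, Hab; ring. }
  apply fsq_eigen in H; [|lia|].
  - unfold G in H; symmetry; apply fps_sub_eq; rewrite <- H; ring.
  - destruct th3sq_coefs as [a0 _], th4sq_coefs as [b0 _].
    unfold G; cbv [eis2_nome eis2 fsq fadd fmul conv fsub fint fcst fsigma sigma1 Nat.even Nat.div2]; rewrite a0, b0; simpl; ring.
Qed.

Lemma fder_th3sq : (fint 6 * fder th3sq = th3sq * (eis2_nome + th3sq * th3sq - fint 2 * (th4sq * th4sq)))%S.
Proof.
  rewrite fder_th3sq_P; f_equal.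
  transitivity (fneg eis2 - eis2 + eis2 - eis2_nome)%S; [ring|]; rewrite fneg_P, eis2_theta; ring.
Qed.

Lemma fder_th4sq : (fint 6 * fder th4sq = th4sq * (eis2_nome - fint 2 * (th3sq * th3sq) + th4sq * th4sq))%S.
Proof. rewrite fder_th4sq_P; f_equal; rewrite eis2_theta; ring. Qed.

Lemma fsq_P1 : (fint 4 * fsq eis2_nome = fint 2 * eis2_nome + th3sq * th3sq + th4sq * th4sq)%S.
Proof.
  transitivity (eis2 + fneg eis2 + fint 4 * fsq eis2_nome - (fneg eis2 - eis2) - fint 2 * eis2)%S; [ring|].
  rewrite eis2_hecke, fneg_P, eis2_theta; ring.
Qed.

(** Ramanujan's equation for E2, with E4 = a^4 - a^2 b^2 + b^4; the usual 12 becomes 6 because x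
    d/dx is twice q d/dq for q = x^2. The defect G satisfies 4 G(x^2) = G(x), where 4 = 2^2 reflects
    the weight 4. *)
Lemma fder_P1 :
  (fint 6 * fder eis2_nome = eis2_nome * eis2_nome - (th3sq * th3sq * (th3sq * th3sq) - th3sq * th3sq * (th4sq * th4sq) + th4sq * th4sq * (th4sq * th4sq)))%S.
Proof.
  set (G := (fint 6 * fder eis2_nome - eis2_nome * eis2_nome + (th3sq * th3sq * (th3sq * th3sq) - th3sq * th3sq * (th4sq * th4sq) + th4sq * th4sq * (th4sq * th4sq)))%S).
  assert (H : (fint 4 * fsq G = G)%S).
  { apply fps_sub_eq, (fmul_cancel (fint 4)); [apply fint_ne; lia|].
    unfold G; rewrite fsq_add, !fsq_sub, fsq_add, !fsq_sub, !fsq_mul, !fsq_int.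
    transitivity (fint 12 * (fint 4 * (fint 2 * fsq (fder eis2_nome))) - (fint 4 * fsq eis2_nome) * (fint 4 * fsq eis2_nome)
      + ((fint 2 * fsq th3sq) * (fint 2 * fsq th3sq) * (fint 2 * fsq th3sq) * (fint 2 * fsq th3sq)
        - fint 4 * ((fint 2 * fsq th3sq) * (fint 2 * fsq th3sq)) * (fsq th4sq * fsq th4sq)
        + fint 16 * ((fsq th4sq * fsq th4sq) * (fsq th4sq * fsq th4sq)))
      - fint 4 * G)%S; [unfold G; ring|].
    rewrite <- fder_sq, <- fder_fint_mul, fsq_P1, <- th3sq_add_th4sq, <- th3sq_mul_th4sq, !fder_add, fder_fint_mul, !fder_mul.
    transitivity (fint 4 * th3sq * (fint 6 * fder th3sq) + fint 4 * th4sq * (fint 6 * fder th4sq) + fint 24 * fder eis2_nome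
      - (fint 2 * eis2_nome + th3sq * th3sq + th4sq * th4sq) * (fint 2 * eis2_nome + th3sq * th3sq + th4sq * th4sq)
      + ((th3sq + th4sq) * (th3sq + th4sq) * (th3sq + th4sq) * (th3sq + th4sq) - fint 4 * ((th3sq + th4sq) * (th3sq + th4sq)) * (th3sq * th4sq)
        + fint 16 * (th3sq * th4sq * (th3sq * th4sq))) - fint 4 * G)%S; [ring|].
    rewrite fder_th3sq, fder_th4sq; unfold G; ring. }
  apply fsq_eigen in H; [|lia|].
  - unfold G in H; apply fps_sub_eq; rewrite <- H; ring.
  - destruct th3sq_coefs as [a0 _], th4sq_coefs as [b0 _].
    unfold G; cbv [eis2_nome eis2 fder fsq fadd fmul conv fsub fint fcst fsigma sigma1 Nat.even Nat.div2]; rewrite a0, b0; simpl; ring.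
Qed.

Open Scope C_scope.

(** * Complex derivatives *)

Definition cder (f : C -> C) (t l : C) : Prop :=
  is_derive (K := C_AbsRing) (V := C_NormedModule) f t l.

Lemma cder_eps (f : C -> C) (t l : C) : cder f t l <->
  forall eps : R, (0 < eps)%R -> exists d : R, (0 < d)%R /\
    forall z, (Cmod (z - t) < d)%R -> (Cmod (f z - f t - l * (z - t)) <= eps * Cmod (z - t))%R.
Proof.
  split.
  - intros [_ H] eps He.
    destruct (H t (fun P H => H) (mkposreal eps He)) as [d Hd].
    exists d; split; [apply d|]; intros z Hz.
    specialize (Hd z Hz).
    replace (f z - f t - l * (z - t))
      with (minus (minus (f z) (f t)) (scal (K := C_AbsRing) (V := C_NormedModule) (minus z t) l)); [exact Hd|].
    unfold minus, scal, plus, opp; simpl; unfold mult; simpl; ring.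
  - intros H; split; [apply is_linear_scal_l|].
    intros x Hx; apply (is_filter_lim_locally_unique (K := C_AbsRing) (V := AbsRing_NormedModule C_AbsRing)) in Hx; subst x.
    intros eps; destruct (H eps (cond_pos eps)) as [d [Hd0 Hd]].
    exists (mkposreal d Hd0); intros z Hz.
    specialize (Hd z Hz).
    replace (f z - f t - l * (z - t))
      with (minus (minus (f z) (f t)) (scal (K := C_AbsRing) (V := C_NormedModule) (minus z t) l)) in Hd; [exact Hd|].
    unfold minus, scal, plus, opp; simpl; unfold mult; simpl; ring.
Qed.

Lemma open_eps (U : C -> Prop) : open U <->
  forall t, U t -> exists d : R, (0 < d)%R /\ forall z, (Cmod (z - t) < d)%R -> U z.
Proof.
  split.
  - intros H t Ht; apply H in Ht; apply locally_C in Ht; destruct Ht as [d Hd].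
    exists d; split; [apply d|]; intros z Hz; apply Hd; exact Hz.
  - intros H t Ht; apply locally_C; destruct (H t Ht) as [d [Hd0 Hd]].
    exists (mkposreal d Hd0); intros z Hz; apply Hd; exact Hz.
Qed.

Lemma Cmod_sub_sym (x y : C) : Cmod (x - y) = Cmod (y - x).
Proof. rewrite <- (Cmod_opp (x - y)); f_equal; ring. Qed.

Lemma Cmod_tri_sub (x y z : C) : (Cmod (x - z) <= Cmod (x - y) + Cmod (y - z))%R.
Proof. replace (x - z) with ((x - y) + (y - z)) by ring; apply Cmod_triangle. Qed.

Lemma Cmod_sub_ge (x y : C) : (Cmod x - Cmod y <= Cmod (x - y))%R.
Proof.
  assert (H := Cmod_triangle (x - y) y); replace (x - y + y) with x in H by ring; lra.
Qed.

Lemma Cmod_sub_le (x y : C) : (Cmod (x - y) <= Cmod x + Cmod y)%R.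
Proof. unfold Cminus; rewrite <- (Cmod_opp y); apply Cmod_triangle. Qed.

Lemma cder_ext_near (f g : C -> C) (t l : C) (r : R) : (0 < r)%R ->
  (forall z, (Cmod (z - t) < r)%R -> f z = g z) -> cder f t l -> cder g t l.
Proof.
  intros Hr H Hf; apply cder_eps; intros eps He.
  destruct (proj1 (cder_eps _ _ _) Hf eps He) as [e [He0 Hd]].
  exists (Rmin e r); split; [apply Rmin_glb_lt; auto|]; intros z Hz.
  rewrite <- !H; [apply Hd| |].
  - eapply Rlt_le_trans; [apply Hz|apply Rmin_l].
  - unfold Cminus; rewrite Cplus_opp_r, Cmod_0; auto.
  - eapply Rlt_le_trans; [apply Hz|apply Rmin_r].
Qed.

Lemma cder_ext_open (U : C -> Prop) (f g : C -> C) (t l : C) : open U -> U t ->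
  (forall z, U z -> f z = g z) -> cder f t l -> cder g t l.
Proof.
  intros HU Ht H Hf; destruct (proj1 (open_eps U) HU t Ht) as [d [Hd0 Hd]].
  apply (cder_ext_near f g t l d Hd0); auto.
Qed.

Lemma cder_ext (f g : C -> C) (t l : C) : (forall z, f z = g z) -> cder f t l -> cder g t l.
Proof. intros H; apply (cder_ext_near f g t l 1 Rlt_0_1); auto. Qed.

Lemma cder_eq (f : C -> C) (t l l' : C) : l = l' -> cder f t l -> cder f t l'.
Proof. intros ->; auto. Qed.

Lemma cder_const (c t : C) : cder (fun _ => c) t 0.
Proof. apply (is_derive_const (K := C_AbsRing) (V := C_NormedModule)). Qed.

(** C is a normed module over itself in two formally different ways; the product and chain rules
    need the second one. *)
Lemma cder_abs (f : C -> C) (t l : C) :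
  cder f t l <-> is_derive (K := C_AbsRing) (V := AbsRing_NormedModule C_AbsRing) f t l.
Proof. split; intros [_ H]; (split; [apply is_linear_scal_l|exact H]). Qed.

Lemma cder_id (t : C) : cder (fun z => z) t 1.
Proof. apply cder_abs; exact (is_derive_id (K := C_AbsRing) t). Qed.

Lemma cder_plus (f g : C -> C) (t l m : C) :
  cder f t l -> cder g t m -> cder (fun z => f z + g z) t (l + m).
Proof. apply (is_derive_plus (K := C_AbsRing) (V := C_NormedModule)). Qed.

Lemma cder_bounded (f : C -> C) (t l : C) : cder f t l ->
  exists d : R, (0 < d)%R /\ forall z, (Cmod (z - t) < d)%R ->
    (Cmod (f z - f t) <= (Cmod l + 1) * Cmod (z - t))%R.
Proof.
  intros H; destruct (proj1 (cder_eps _ _ _) H 1%R Rlt_0_1) as [d [Hd0 Hd]].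
  exists d; split; auto; intros z Hz; specialize (Hd z Hz).
  replace (f z - f t) with ((f z - f t - l * (z - t)) + l * (z - t)) by ring.
  eapply Rle_trans; [apply Cmod_triangle|]; rewrite Cmod_mult; lra.
Qed.

Lemma cder_continuous (f : C -> C) (t l : C) : cder f t l ->
  forall eps : R, (0 < eps)%R -> exists d : R, (0 < d)%R /\ forall z, (Cmod (z - t) < d)%R ->
    (Cmod (f z - f t) < eps)%R.
Proof.
  intros H eps He; destruct (cder_bounded f t l H) as [d [Hd0 Hd]].
  assert (Hl := Cmod_ge_0 l).
  exists (Rmin d (eps / (Cmod l + 2))); split.
  - apply Rmin_glb_lt; auto; apply Rdiv_lt_0_compat; lra.
  - intros z Hz; assert (H1 : (Cmod (z - t) < d)%R) by (eapply Rlt_le_trans; [apply Hz|apply Rmin_l]).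
    assert (H2 : (Cmod (z - t) < eps / (Cmod l + 2))%R) by (eapply Rlt_le_trans; [apply Hz|apply Rmin_r]).
    specialize (Hd z H1); assert (H3 := Cmod_ge_0 (z - t)).
    assert (H4 : ((Cmod l + 2) * Cmod (z - t) < eps)%R).
    { apply Rmult_lt_compat_l with (r := (Cmod l + 2)%R) in H2; [|lra].
      replace ((Cmod l + 2) * (eps / (Cmod l + 2)))%R with eps in H2 by (field; lra); auto. }
    nra.
Qed.

Lemma cder_mult (f g : C -> C) (t l m : C) :
  cder f t l -> cder g t m -> cder (fun z => f z * g z) t (l * g t + f t * m).
Proof.
  rewrite !cder_abs; intros Hf Hg.
  exact (is_derive_mult (K := C_AbsRing) f g t l m Hf Hg Cmult_comm).
Qed.

Lemma cder_scal (f : C -> C) (c t l : C) : cder f t l -> cder (fun z => c * f z) t (c * l).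
Proof.
  intros H; eapply cder_eq; [|apply cder_mult; [apply cder_const|apply H]]; cbn beta; ring.
Qed.

Lemma cder_minus (f g : C -> C) (t l m : C) :
  cder f t l -> cder g t m -> cder (fun z => f z - g z) t (l - m).
Proof. apply (is_derive_minus (K := C_AbsRing) (V := C_NormedModule)). Qed.

Lemma cder_comp (f g : C -> C) (t l m : C) :
  cder f (g t) l -> cder g t m -> cder (fun z => f (g z)) t (l * m).
Proof.
  rewrite (cder_abs g), Cmult_comm.
  exact (is_derive_comp (K := C_AbsRing) (V := C_NormedModule) f g t l m).
Qed.

Lemma cder_inv (t : C) : t <> 0 -> cder (fun z => / z) t (- / (t * t)).
Proof.
  intros Ht; apply cder_eps; intros eps He.
  assert (Hm : (0 < Cmod t)%R) by (apply Cmod_gt_0; auto).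
  set (a := Cmod t) in *.
  (* The first bound keeps |z| >= a / 2; with it the second makes |z - t| / (|z| a^2) at most
     eps. *)
  exists (Rmin (a / 2) (eps * (a * a * a) / 2)); split.
  { apply Rmin_glb_lt; [lra|]; apply Rdiv_lt_0_compat; [|lra].
    repeat apply Rmult_lt_0_compat; auto. }
  intros z Hz; apply Rmin_Rgt in Hz; destruct Hz as [Z1 Z2].
  assert (Hz : (a / 2 <= Cmod z)%R).
  { assert (H := Cmod_sub_ge t (t - z)); replace (t - (t - z)) with z in H by ring.
    rewrite Cmod_sub_sym in Z1; unfold a in *; lra. }
  assert (z <> 0) by (intros ->; rewrite Cmod_0 in Hz; lra).
  replace (/ z - / t - - / (t * t) * (z - t)) with ((z - t) * (z - t) / (z * (t * t))) by (field; auto).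
  rewrite Cmod_div, !Cmod_mult by (repeat apply Cmult_neq_0; auto).
  fold a; set (h := Cmod (z - t)) in *; assert (Hh : (0 <= h)%R) by apply Cmod_ge_0.
  apply Rle_div_l; [repeat apply Rmult_lt_0_compat; lra|].
  assert (eps * h * (a / 2 * (a * a)) <= eps * h * (Cmod z * (a * a)))%R.
  { apply Rmult_le_compat_l; [nra|]; apply Rmult_le_compat_r; nra. }
  nra.
Qed.

Lemma two_pi_i_neq_0 : two_pi_i <> 0.
Proof.
  unfold two_pi_i; apply Cmult_neq_0.
  - intros H; injection H; assert (H1 := PI_RGT_0); lra.
  - intros H; injection H; lra.
Qed.

Lemma Dtau_eq (f : C -> C) (t l : C) : cder f t (two_pi_i * l) -> Dtau f t = l.
Proof.
  intros H; unfold Dtau; rewrite (is_C_derive_unique f t _ H); field; apply two_pi_i_neq_0.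
Qed.

Lemma Dtau_cder (f : C -> C) (t : C) :
  ex_derive (K := C_AbsRing) (V := C_NormedModule) f t -> cder f t (two_pi_i * Dtau f t).
Proof.
  intros H; unfold Dtau.
  replace (two_pi_i * (C_derive f t / two_pi_i)) with (C_derive f t) by (field; apply two_pi_i_neq_0).
  apply C_derive_correct; auto.
Qed.

Lemma Cmult_integral (x y : C) : x * y = 0 -> x = 0 \/ y = 0.
Proof.
  intros H; destruct (Ceq_dec x 0) as [E|E]; [auto|right].
  destruct (Ceq_dec y 0) as [E'|E']; [auto|exfalso; revert H; apply Cmult_neq_0; auto].
Qed.

Lemma Re_sub (x y : C) : Re (x - y) = (Re x - Re y)%R. Proof. reflexivity. Qed.
Lemma Im_sub (x y : C) : Im (x - y) = (Im x - Im y)%R. Proof. reflexivity. Qed.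

Lemma Csub_eq (x y : C) : x - y = 0 -> x = y.
Proof. intros H; transitivity (x - y + y); [ring|rewrite H; ring]. Qed.

Lemma Cinv_neq_0 (x : C) : x <> 0 -> / x <> 0.
Proof.
  intros Hx Z; apply C1_nz; transitivity (x * / x); [field; auto|rewrite Z; ring].
Qed.

Open Scope R_scope.

(** * Evaluation of power series in the unit disc *)

Definition is_cseries (u : nat -> C) (l : C) : Prop :=
  is_series (fun n => Re (u n)) (Re l) /\ is_series (fun n => Im (u n)) (Im l).

Definition abs_summable (u : nat -> C) : Prop := ex_series (fun n => Cmod (u n)).

Lemma ex_series_dom (a b : nat -> R) : (forall n, Rabs (a n) <= b n) -> ex_series b -> ex_series a.
Proof. apply (ex_series_le (K := R_AbsRing) (V := R_CompleteNormedModule) a b). Qed.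

Lemma C_ext (x y : C) : Re x = Re y -> Im x = Im y -> x = y.
Proof. destruct x, y; unfold Re, Im; simpl; intros; subst; auto. Qed.

Lemma Im_le_Cmod (z : C) : Rabs (Im z) <= Cmod z.
Proof. eapply Rle_trans; [|apply Rmax_Cmod]; apply Rmax_r. Qed.

Lemma abs_summable_re u : abs_summable u -> ex_series (fun n => Rabs (Re (u n))).
Proof.
  intros H; apply (ex_series_dom (fun n => Rabs (Re (u n))) (fun n => Cmod (u n))); auto.
  intros n; rewrite Rabs_Rabsolu; apply re_le_Cmod.
Qed.

Lemma abs_summable_im u : abs_summable u -> ex_series (fun n => Rabs (Im (u n))).
Proof.
  intros H; apply (ex_series_dom (fun n => Rabs (Im (u n))) (fun n => Cmod (u n))); auto.
  intros n; rewrite Rabs_Rabsolu; apply Im_le_Cmod.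
Qed.

Lemma CSeries_correct u : abs_summable u -> is_cseries u (CSeries u).
Proof.
  intros H; split; apply Series_correct, ex_series_Rabs.
  - apply abs_summable_re; auto.
  - apply abs_summable_im; auto.
Qed.

Lemma is_cseries_unique u l : is_cseries u l -> CSeries u = l.
Proof. intros [H1 H2]; apply C_ext; simpl; apply is_series_unique; auto. Qed.

Lemma is_cseries_ext u v l : (forall n, u n = v n) -> is_cseries u l -> is_cseries v l.
Proof.
  intros E [H1 H2]; split; [eapply is_series_ext; [|apply H1]|eapply is_series_ext; [|apply H2]];
  intros n; simpl; rewrite E; auto.
Qed.

Lemma is_cseries_plus u v l m : is_cseries u l -> is_cseries v m ->
  is_cseries (fun n => u n + v n)%C (l + m)%C.
Proof. intros [H1 H2] [H3 H4]; split; apply (is_series_plus (V := R_NormedModule)); auto. Qed.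

Lemma is_cseries_scal c u l : is_cseries u l -> is_cseries (fun n => c * u n)%C (c * l)%C.
Proof.
  intros [H1 H2]; split; simpl.
  - apply (is_series_minus (V := R_NormedModule)); apply (is_series_scal (V := R_NormedModule)); auto.
  - apply (is_series_plus (V := R_NormedModule)); apply (is_series_scal (V := R_NormedModule)); auto.
Qed.

(* Pairing with conj l reduces the bound to real series. *)
Lemma CSeries_bound u l : abs_summable u -> is_cseries u l -> Cmod l <= Series (fun n => Cmod (u n)).
Proof.
  intros H H1; destruct (is_cseries_scal (Cconj l) u l H1) as [H2 _].
  replace (Re (Cconj l * l)%C) with (Cmod l * Cmod l) in H2.
  2:{ replace (Cconj l * l)%C with (RtoC (Cmod l ^ 2)); [simpl; ring|].
      rewrite Cmod2_conj; ring. }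
  assert (H3 : Cmod l * Cmod l <= Cmod l * Series (fun n => Cmod (u n))).
  { rewrite <- (is_series_unique _ _ H2), <- Series_scal_l.
    assert (Hb : forall n, Rabs (Re (Cconj l * u n)%C) <= Cmod l * Cmod (u n)).
    { intros n; rewrite <- (Cmod_conj l), <- Cmod_mult; apply re_le_Cmod. }
    eapply Rle_trans; [apply Rle_abs|]; eapply Rle_trans; [apply Series_Rabs|].
    - apply (ex_series_dom (fun n => Rabs (Re (Cconj l * u n)%C)) (fun n => Cmod l * Cmod (u n))).
      + intros n; rewrite Rabs_Rabsolu; apply Hb.
      + apply (ex_series_scal (V := R_NormedModule)); auto.
    - apply Series_le.
      + intros n; split; [apply Rabs_pos|apply Hb].
      + apply (ex_series_scal (V := R_NormedModule)); auto. }
  assert (H4 := Cmod_ge_0 l); destruct (Req_dec (Cmod l) 0) as [E|E]; [|nra].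
  rewrite E; apply Rle_trans with (Series (fun _ => 0 * 0)).
  - rewrite Series_scal_l; lra.
  - apply Series_le; auto; intros n; split; [lra|]; rewrite Rmult_0_l; apply Cmod_ge_0.
Qed.

Fixpoint cconv (u v : nat -> C) (n : nat) : C :=
  match n with
  | O => (u O * v O)%C
  | S m => (u O * v (S m) + cconv (fun k => u (S k)) v m)%C
  end.

Lemma conv_sum f g n : conv f g n = sum_f_R0 (fun k => f k * g (n - k)%nat) n.
Proof.
  revert f; induction n as [|n IH]; intros f; [reflexivity|].
  cbn [conv]; rewrite IH, (decomp_sum _ (S n)) by lia; reflexivity.
Qed.

Lemma is_series_conv a b la lb : is_series a la -> is_series b lb ->
  ex_series (fun n => Rabs (a n)) -> ex_series (fun n => Rabs (b n)) ->
  is_series (conv a b) (la * lb).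
Proof.
  intros H1 H2 H3 H4; eapply is_series_ext; [|apply (is_series_mult a b la lb); auto].
  intros n; symmetry; apply conv_sum.
Qed.

Lemma cconv_re u v n : Re (cconv u v n) =
  conv (fun k => Re (u k)) (fun k => Re (v k)) n - conv (fun k => Im (u k)) (fun k => Im (v k)) n.
Proof.
  revert u; induction n as [|n IH]; intros u; cbn [cconv conv]; [reflexivity|].
  transitivity ((Re (u O) * Re (v (S n)) - Im (u O) * Im (v (S n))) + Re (cconv (fun k => u (S k)) v n)); [reflexivity|].
  rewrite IH; unfold fps_tail; ring.
Qed.

Lemma cconv_im u v n : Im (cconv u v n) =
  conv (fun k => Re (u k)) (fun k => Im (v k)) n + conv (fun k => Im (u k)) (fun k => Re (v k)) n.
Proof.
  revert u; induction n as [|n IH]; intros u; cbn [cconv conv]; [reflexivity|].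
  transitivity ((Re (u O) * Im (v (S n)) + Im (u O) * Re (v (S n))) + Im (cconv (fun k => u (S k)) v n)); [reflexivity|].
  rewrite IH; unfold fps_tail; ring.
Qed.

Lemma is_cseries_mul u v l m : abs_summable u -> abs_summable v ->
  is_cseries u l -> is_cseries v m -> is_cseries (cconv u v) (l * m)%C.
Proof.
  intros Hu Hv [U1 U2] [V1 V2].
  assert (A1 := abs_summable_re u Hu); assert (A2 := abs_summable_im u Hu).
  assert (A3 := abs_summable_re v Hv); assert (A4 := abs_summable_im v Hv).
  split.
  - eapply is_series_ext; [intros n; symmetry; apply cconv_re|].
    apply (is_series_minus (V := R_NormedModule)); apply is_series_conv; auto.
  - eapply is_series_ext; [intros n; symmetry; apply cconv_im|].
    apply (is_series_plus (V := R_NormedModule)); apply is_series_conv; auto.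
Qed.

(** Absolute convergence in the open unit disc. All series considered have it and the operations
    preserve it, so that no radius of convergence is tracked. *)
Definition disc (f : fps) : Prop := forall r, 0 <= r < 1 -> ex_series (fun n => Rabs (f n) * r ^ n).

Definition term (f : fps) (x : C) (n : nat) : C := (RtoC (f n) * x ^ n)%C.

Definition ev (f : fps) (x : C) : C := CSeries (term f x).

Lemma Cmod_term f x n : Cmod (term f x n) = Rabs (f n) * Cmod x ^ n.
Proof. unfold term; rewrite Cmod_mult, Cmod_R, Cmod_pow; auto. Qed.

Lemma term_summable f x : disc f -> Cmod x < 1 -> abs_summable (term f x).
Proof.
  intros Hf Hx; eapply ex_series_ext; [intros n; symmetry; apply Cmod_term|].
  apply Hf; split; [apply Cmod_ge_0|auto].
Qed.

Lemma ev_correct f x : disc f -> Cmod x < 1 -> is_cseries (term f x) (ev f x).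
Proof. intros; apply CSeries_correct, term_summable; auto. Qed.

Lemma disc_dom f (b : R -> nat -> R) :
  (forall r n, 0 <= r < 1 -> 0 <= r ^ n -> Rabs (f n) * r ^ n <= b r n) ->
  (forall r, 0 <= r < 1 -> ex_series (b r)) -> disc f.
Proof.
  intros H Hb r Hr; apply (ex_series_dom _ (b r)); auto.
  intros n; assert (Hp : 0 <= r ^ n) by (apply pow_le; lra).
  rewrite Rabs_mult, Rabs_Rabsolu, (Rabs_pos_eq (r ^ n)) by auto; auto.
Qed.

Lemma disc_le f g : (forall n, Rabs (f n) <= Rabs (g n)) -> disc g -> disc f.
Proof.
  intros H Hg; apply (disc_dom _ (fun r n => Rabs (g n) * r ^ n)); auto.
  intros r n _ Hp; apply Rmult_le_compat_r; auto.
Qed.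

Lemma disc_add f g : disc f -> disc g -> disc (f + g)%S.
Proof.
  intros Hf Hg; apply (disc_dom _ (fun r n => Rabs (f n) * r ^ n + Rabs (g n) * r ^ n)).
  - intros r n _ Hp; rewrite <- Rmult_plus_distr_r; apply Rmult_le_compat_r; auto; apply Rabs_triang.
  - intros r Hr; apply (ex_series_plus (V := R_NormedModule)); [apply Hf|apply Hg]; auto.
Qed.

Lemma disc_mul f g : disc f -> disc g -> disc (f * g)%S.
Proof.
  intros Hf Hg; apply (disc_dom _ (fun r => conv (fun n => Rabs (f n) * r ^ n) (fun n => Rabs (g n) * r ^ n))).
  - intros r n _ Hp; unfold fmul; rewrite !conv_sum, Rmult_comm.
    eapply Rle_trans; [apply Rmult_le_compat_l; [auto|apply Rabs_triang_gen]|].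
    rewrite scal_sum; apply sum_Rle; intros k Hk; rewrite Rabs_mult; right.
    replace (r ^ n) with (r ^ k * r ^ (n - k)) by (rewrite <- pow_add; f_equal; lia); ring.
  - intros r Hr; destruct (Hf r Hr) as [la Ha], (Hg r Hr) as [lb Hb]; exists (la * lb).
    assert (Hpos : forall h n, Rabs (h n) * r ^ n = Rabs (Rabs (h n) * r ^ n)).
    { intros h n; symmetry; apply Rabs_pos_eq, Rmult_le_pos; [apply Rabs_pos|apply pow_le; lra]. }
    apply is_series_conv; auto; eapply ex_series_ext; [intros n; apply Hpos|eexists; eauto|intros n; apply Hpos|eexists; eauto].
Qed.

Lemma disc_cst c : disc (fcst c).
Proof.
  apply (disc_dom _ (fun r n => Rabs c * r ^ n)).
  - intros r n _ Hp; apply Rmult_le_compat_r; auto.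
    destruct n; simpl; [lra|rewrite Rabs_R0; apply Rabs_pos].
  - intros r Hr; apply (ex_series_scal (V := R_NormedModule)), ex_series_geom; rewrite Rabs_pos_eq; lra.
Qed.

Lemma disc_int z : disc (fint z). Proof. apply disc_cst. Qed.

Lemma disc_sub f g : disc f -> disc g -> disc (f - g)%S.
Proof.
  intros Hf Hg; replace (f - g)%S with (f + fint (-1) * g)%S by ring.
  apply disc_add; auto; apply disc_mul; auto; apply disc_int.
Qed.

Lemma disc_neg f : disc f -> disc (fneg f).
Proof.
  apply disc_le; intros n; unfold fneg; rewrite Rabs_mult, pow_1_abs; lra.
Qed.

Lemma disc_der f : disc f -> disc (fder f).
Proof.
  intros Hf r Hr.
  (* With s / r = 1 + e, Bernoulli's inequality bounds n r^n by s^n / e. *)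
  set (s := (r + 1) / 2); assert (Hs : r < s < 1) by (unfold s; lra).
  destruct (Req_dec r 0) as [->|Hr0].
  { apply (ex_series_dom _ (fun n => 0 ^ n)); [|apply ex_series_geom; rewrite Rabs_R0; lra].
    intros n; rewrite Rabs_mult, Rabs_Rabsolu.
    destruct n; [unfold fder; simpl; rewrite Rmult_0_l, Rabs_R0, Rabs_R1; lra|].
    simpl; rewrite Rmult_0_l, Rabs_R0; lra. }
  set (e := s / r - 1).
  assert (He : 0 < e).
  { unfold e; enough (1 < s / r) by lra; apply Rlt_div_r; lra. }
  apply (ex_series_dom _ (fun n => / e * (Rabs (f n) * s ^ n))).
  - intros n; 
    assert (Hp : 0 <= r ^ n) by (apply pow_le; lra).
    rewrite Rabs_mult, Rabs_Rabsolu, (Rabs_pos_eq (r ^ n)) by auto.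
    unfold fder; rewrite Rabs_mult, (Rabs_pos_eq (INR n)) by apply pos_INR.
    assert (H := poly n e He).
    replace (1 + e) with (s / r) in H by (unfold e; ring).
    replace (s ^ n) with ((s / r) ^ n * r ^ n).
    2:{ rewrite <- Rpow_mult_distr; f_equal; field; auto. }
    replace (INR n) with (/ e * (INR n * e)) by (field; lra).
    assert (H1 := Rabs_pos (f n)).
    assert (H2 : 0 < / e) by (apply Rinv_0_lt_compat; auto).
    replace (/ e * (INR n * e) * Rabs (f n) * r ^ n) with (/ e * (Rabs (f n) * r ^ n) * (INR n * e)) by ring.
    replace (/ e * (Rabs (f n) * ((s / r) ^ n * r ^ n))) with (/ e * (Rabs (f n) * r ^ n) * ((s / r) ^ n)) by ring.
    apply Rmult_le_compat_l; [|lra].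
    apply Rmult_le_pos; [lra|]; apply Rmult_le_pos; auto.
  - apply (ex_series_scal (V := R_NormedModule)), Hf; lra.
Qed.

Lemma sum_n_stretch (a : nat -> R) n :
  sum_n (fun n => if Nat.even n then a (Nat.div2 n) else 0) n = sum_n a (Nat.div2 n).
Proof.
  induction n as [|n IH]; [rewrite !sum_O; reflexivity|].
  rewrite sum_Sn, IH; unfold plus; simpl plus.
  destruct (Nat.Even_or_Odd n) as [[k ->]|[k ->]].
  - replace (S (2 * k)) with (2 * k + 1)%nat by lia.
    rewrite Nat.even_odd; replace (2 * k + 1)%nat with (S (2 * k)) by lia.
    rewrite Nat.div2_succ_double, Nat.div2_double; simpl; ring.
  - replace (S (2 * k + 1)) with (2 * S k)%nat by lia.
    rewrite Nat.even_even; replace (2 * k + 1)%nat with (S (2 * k)) by lia.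
    rewrite Nat.div2_succ_double, Nat.div2_double, sum_Sn; reflexivity.
Qed.

Lemma is_series_stretch (a : nat -> R) l : is_series a l ->
  is_series (fun n => if Nat.even n then a (Nat.div2 n) else 0) l.
Proof.
  intros H; unfold is_series.
  eapply filterlim_ext; [intros n; symmetry; apply sum_n_stretch|].
  apply (filterlim_comp _ _ _ Nat.div2 (sum_n a) eventually eventually); [|exact H].
  intros P [N HN]; exists (2 * N)%nat; intros n Hn; apply HN.
  replace N with (Nat.div2 (2 * N)) by apply Nat.div2_double.
  clear -Hn; destruct (Nat.Even_or_Odd n) as [[k ->]|[k ->]].
  - rewrite !Nat.div2_double; lia.
  - replace (2 * k + 1)%nat with (S (2 * k)) in * by lia.
    rewrite Nat.div2_succ_double, Nat.div2_double; lia.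
Qed.

Lemma disc_sq f : disc f -> disc (fsq f).
Proof.
  intros Hf r Hr; destruct (Hf (r * r)) as [l Hl]; [nra|].
  exists l; eapply is_series_ext; [|apply is_series_stretch, Hl].
  intros n; unfold fsq; simpl; destruct (Nat.Even_or_Odd n) as [[k ->]|[k ->]].
  - rewrite Nat.even_even, Nat.div2_double, pow_mult; simpl; rewrite Rmult_1_r; auto.
  - rewrite Nat.even_odd, Rabs_R0; ring.
Qed.

Lemma ev_add f g x : disc f -> disc g -> Cmod x < 1 -> ev (f + g)%S x = (ev f x + ev g x)%C.
Proof.
  intros Hf Hg Hx; apply is_cseries_unique.
  eapply is_cseries_ext; [|apply is_cseries_plus; apply ev_correct; eauto].
  intros n; unfold term, fadd; rewrite RtoC_plus; ring.
Qed.

Lemma cconv_ext u u' v v' n : (forall n, u n = u' n) -> (forall n, v n = v' n) ->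
  cconv u v n = cconv u' v' n.
Proof.
  intros Hu Hv; revert u u' Hu; induction n as [|n IH]; intros u u' Hu; cbn [cconv].
  - rewrite Hu, Hv; auto.
  - rewrite Hu, Hv, (IH _ (fun k => u' (S k))); auto.
Qed.

Lemma cconv_term f g x n : cconv (term f x) (term g x) n = term (f * g)%S x n.
Proof.
  assert (Hs : forall u v c m, cconv (fun k => c * u k)%C v m = (c * cconv u v m)%C).
  { intros u v c m; revert u; induction m as [|m IH]; intros u; cbn [cconv]; [ring|].
    rewrite (IH (fun k => u (S k))); ring. }
  unfold fmul; revert f; induction n as [|n IH]; intros f.
  - cbn [cconv]; unfold term; simpl; rewrite RtoC_mult; ring.
  - cbn [cconv].
    rewrite (cconv_ext _ (fun k => x * term (fps_tail f) x k)%C _ (term g x)); auto.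
    + rewrite Hs, IH; unfold term; cbn [conv Cpow]; rewrite RtoC_plus, RtoC_mult; ring.
    + intros k; unfold term, fps_tail; cbn [Cpow]; ring.
Qed.

Lemma ev_mul f g x : disc f -> disc g -> Cmod x < 1 -> ev (f * g)%S x = (ev f x * ev g x)%C.
Proof.
  intros Hf Hg Hx; apply is_cseries_unique.
  eapply is_cseries_ext; [intros n; apply cconv_term|].
  apply is_cseries_mul; try apply term_summable; auto; apply ev_correct; auto.
Qed.

Lemma ev_cst c x : ev (fcst c) x = RtoC c.
Proof.
  assert (H : forall a : nat -> R, (forall n, a (S n) = 0) -> is_series a (a O)).
  { intros a Ha; apply (is_series_decr_1 (K := R_AbsRing) (V := R_NormedModule)).
    apply (is_series_ext (fun _ => 0)); [intros n; symmetry; apply Ha|].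
    unfold is_series; eapply filterlim_ext; [|apply filterlim_const].
    intros n; cbn beta; rewrite sum_n_const; transitivity 0; [apply Rplus_opp_r|symmetry; apply Rmult_0_r]. }
  apply is_cseries_unique; split.
  - replace (Re (RtoC c)) with (Re (term (fcst c) x 0)) by (unfold term; simpl; ring).
    apply (H (fun n => Re (term (fcst c) x n))); intros n; unfold term, fcst; simpl; ring.
  - replace (Im (RtoC c)) with (Im (term (fcst c) x 0)) by (unfold term; simpl; ring).
    apply (H (fun n => Im (term (fcst c) x n))); intros n; unfold term, fcst; simpl; ring.
Qed.

Lemma ev_int z x : ev (fint z) x = RtoC (IZR z). Proof. apply ev_cst. Qed.

Lemma ev_sub f g x : disc f -> disc g -> Cmod x < 1 -> ev (f - g)%S x = (ev f x - ev g x)%C.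
Proof.
  intros Hf Hg Hx; replace (f - g)%S with (f + fint (-1) * g)%S by ring.
  rewrite ev_add, ev_mul, ev_int; auto using disc_mul, disc_int; ring.
Qed.

Lemma ev_neg f x : ev (fneg f) x = ev f (- x)%C.
Proof.
  unfold ev; f_equal; fext; intros n; unfold term, fneg.
  replace (- x)%C with ((-1) * x)%C by ring.
  rewrite Cpow_mult_l, RtoC_mult, RtoC_pow; ring.
Qed.

Lemma ev_sq f x : disc f -> Cmod x < 1 -> ev (fsq f) x = ev f (x * x)%C.
Proof.
  intros Hf Hx; apply is_cseries_unique.
  assert (Hx2 : Cmod (x * x)%C < 1) by (rewrite Cmod_mult; assert (H := Cmod_ge_0 x); nra).
  assert (E : forall n, term (fsq f) x n = if Nat.even n then term f (x * x)%C (Nat.div2 n) else RtoC 0).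
  { intros n; unfold term, fsq; destruct (Nat.Even_or_Odd n) as [[k ->]|[k ->]].
    - rewrite Nat.even_even, Nat.div2_double, Cpow_mult_r; do 2 f_equal; simpl; ring.
    - rewrite Nat.even_odd; ring. }
  destruct (ev_correct f (x * x)%C Hf Hx2) as [H1 H2].
  split.
  - eapply is_series_ext; [|apply is_series_stretch, H1].
    intros n; rewrite E; simpl; destruct (Nat.even n); auto.
  - eapply is_series_ext; [|apply is_series_stretch, H2].
    intros n; rewrite E; simpl; destruct (Nat.even n); auto.
Qed.

(** Remainder of the first-order expansion of z^n at x. *)
Definition pow_err (n : nat) (x z : C) : C := (z ^ n - x ^ n - RtoC (INR n) * x ^ (pred n) * (z - x))%C.

(** Induction by z^(n+1) remainder = z (z^n remainder) + n x^(n-1) (z - x)^2. The factor r * r on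
    the left replaces the exponent n - 2 on the right. *)
Lemma pow_err_bound n x z r : 0 < r -> Cmod x <= r -> Cmod z <= r ->
  r * r * Cmod (pow_err n x z) <= INR n * INR n * r ^ n * (Cmod (z - x) * Cmod (z - x)).
Proof.
  intros Hr Hx Hz; assert (Hh := Cmod_ge_0 (z - x)); set (h := Cmod (z - x)) in *.
  induction n as [|n IH].
  - replace (pow_err 0 x z) with (RtoC 0) by (unfold pow_err; simpl; ring).
    rewrite Cmod_0; simpl; lra.
  - replace (pow_err (S n) x z) with
      (z * pow_err n x z + RtoC (INR n) * x ^ (pred n) * ((z - x) * (z - x)))%C.
    2:{ unfold pow_err; rewrite S_INR, RtoC_plus; cbn [pred]; destruct n; simpl; ring. }
    assert (T1 : Cmod (z * pow_err n x z)%C <= r * Cmod (pow_err n x z)).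
    { rewrite Cmod_mult; apply Rmult_le_compat_r; auto; apply Cmod_ge_0. }
    assert (T2 : r * r * Cmod (RtoC (INR n) * x ^ (pred n) * ((z - x) * (z - x)))%C
      <= INR n * r ^ (S n) * (h * h)).
    { rewrite !Cmod_mult, Cmod_R, Cmod_pow, (Rabs_pos_eq (INR n)) by apply pos_INR; fold h.
      destruct n; [simpl; lra|]; cbn [pred].
      assert (P : Cmod x ^ n <= r ^ n) by (apply pow_incr; split; [apply Cmod_ge_0|auto]).
      assert (Q := pos_INR (S n)); assert (0 <= h * h) by nra.
      replace (r ^ (S (S n))) with (r * r * r ^ n) by (simpl; ring).
      replace (r * r * (INR (S n) * Cmod x ^ n * (h * h))) with (r * r * INR (S n) * (h * h) * Cmod x ^ n) by ring.
      replace (INR (S n) * (r * r * r ^ n) * (h * h)) with (r * r * INR (S n) * (h * h) * r ^ n) by ring.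
      apply Rmult_le_compat_l; auto; repeat apply Rmult_le_pos; lra. }
    assert (T := Cmod_triangle (z * pow_err n x z) (RtoC (INR n) * x ^ (pred n) * ((z - x) * (z - x)))).
    assert (Q := pos_INR n); assert (0 <= h * h) by nra.
    assert (Pn : 0 <= r ^ n) by (apply pow_le; lra).
    apply Rle_trans with (r * (r * r * Cmod (pow_err n x z)) + INR n * r ^ S n * (h * h)).
    { assert (0 < r * r) by nra; nra. }
    apply Rle_trans with (r * (INR n * INR n * r ^ n * (h * h)) + INR n * r ^ S n * (h * h)); [nra|].
    rewrite S_INR; simpl.
    replace ((INR n + 1) * (INR n + 1) * (r * r ^ n) * (h * h)) with
      (r * (INR n * INR n * r ^ n * (h * h)) + INR n * (r * r ^ n) * (h * h) + (INR n + 1) * (r * r ^ n * (h * h))) by ring.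
    enough (0 <= (INR n + 1) * (r * r ^ n * (h * h))) by lra.
    apply Rmult_le_pos; [lra|]; apply Rmult_le_pos; auto; apply Rmult_le_pos; lra.
Qed.

(** Here l is the sum of n f_n x^(n-1). The product l x is stated instead of l, since [fder] is x
    d/dx and x may be 0. *)
Lemma ev_cder f x : disc f -> Cmod x < 1 ->
  exists l : C, cder (ev f) x l /\ (l * x)%C = ev (fder f) x.
Proof.
  intros Hf Hx.
  set (v := fun n => (RtoC (INR n * f n) * x ^ (pred n))%C).
  assert (Hx0 := Cmod_ge_0 x).
  set (r := (Cmod x + 1) / 2); assert (Hr : Cmod x < r < 1 /\ 0 < r) by (unfold r; lra).
  destruct Hr as [[Hr1 Hr2] Hr0]; clearbody r.
  assert (Hv : abs_summable v).
  { apply (ex_series_dom _ (fun n => / r * (Rabs (fder f n) * r ^ n))).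
    - intros n; rewrite Rabs_pos_eq by apply Cmod_ge_0.
      unfold v; rewrite Cmod_mult, Cmod_R, Cmod_pow; fold (fder f n).
      destruct n; [unfold fder; simpl; rewrite Rmult_0_l, Rabs_R0; lra|].
      cbn [pred]; replace (/ r * (Rabs (fder f (S n)) * r ^ S n)) with (Rabs (fder f (S n)) * r ^ n)
        by (simpl; field; lra).
      apply Rmult_le_compat_l; [apply Rabs_pos|apply pow_incr; lra].
    - apply (ex_series_scal (V := R_NormedModule)), disc_der; auto; lra. }
  exists (CSeries v); split.
  - assert (HM := disc_der _ (disc_der _ Hf) r (conj (Rlt_le _ _ Hr0) Hr2)).
    (* M is the sum of n^2 |f_n| r^n; by [pow_err_bound] the remainder is at most M |z - x|^2 /
       r^2. *)
    set (M := Series (fun n => Rabs (fder (fder f) n) * r ^ n)).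
    assert (HM0 : 0 <= M).
    { apply Rle_trans with (Series (fun _ => 0 * 0)); [rewrite Series_scal_l; lra|].
      apply Series_le; auto; intros n; split; [lra|]; rewrite Rmult_0_l.
      apply Rmult_le_pos; [apply Rabs_pos|apply pow_le; lra]. }
    apply cder_eps; intros eps He.
    exists (Rmin (r - Cmod x) (eps * (r * r) / (M + 1))); split.
    { apply Rmin_glb_lt; [lra|]; apply Rdiv_lt_0_compat; [|lra]; repeat apply Rmult_lt_0_compat; auto. }
    intros z Hz; apply Rmin_Rgt in Hz; destruct Hz as [Z1 Z2].
    assert (Hzr : Cmod z <= r).
    { assert (H := Cmod_sub_ge z x); lra. }
    set (w := fun n => (RtoC (f n) * pow_err n x z)%C).
    assert (Hw : is_cseries w (ev f z - ev f x - CSeries v * (z - x))%C).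
    { replace (ev f z - ev f x - CSeries v * (z - x))%C
        with (ev f z + ((-1) * ev f x + (- (z - x)) * CSeries v))%C by ring.
      eapply is_cseries_ext; [|apply is_cseries_plus; [apply ev_correct; [auto|lra]|
        apply is_cseries_plus; apply is_cseries_scal; [apply ev_correct; [auto|lra]|apply CSeries_correct; auto]]].
      intros n; unfold w, pow_err, term, v; rewrite RtoC_mult; ring. }
    assert (Hb : forall n, Cmod (w n) <= / (r * r) * (Cmod (z - x) * Cmod (z - x)) * (Rabs (fder (fder f) n) * r ^ n)).
    { intros n; unfold w; rewrite Cmod_mult, Cmod_R.
      assert (H := pow_err_bound n x z r Hr0 (Rlt_le _ _ Hr1) Hzr).
      unfold fder; rewrite !Rabs_mult, (Rabs_pos_eq (INR n)) by apply pos_INR.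
      assert (Hp := Rabs_pos (f n)).
      apply Rmult_le_reg_l with (r * r); [nra|].
      apply Rmult_le_compat_l with (r := Rabs (f n)) in H; auto.
      replace (r * r * (/ (r * r) * (Cmod (z - x) * Cmod (z - x)) * (INR n * (INR n * Rabs (f n)) * r ^ n)))
        with (Rabs (f n) * (INR n * INR n * r ^ n * (Cmod (z - x) * Cmod (z - x)))) by (field; lra).
      lra. }
    assert (Hex : ex_series (fun n => / (r * r) * (Cmod (z - x) * Cmod (z - x)) * (Rabs (fder (fder f) n) * r ^ n))).
    { apply (ex_series_scal (V := R_NormedModule)); auto. }
    assert (Hws : abs_summable w).
    { apply (ex_series_dom _ _) with (2 := Hex); intros n; 
      rewrite Rabs_pos_eq by apply Cmod_ge_0; apply Hb. }
    eapply Rle_trans; [apply (CSeries_bound w); auto|].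
    eapply Rle_trans; [apply Series_le; [intros n; split; [apply Cmod_ge_0|apply Hb]|auto]|].
    rewrite Series_scal_l; fold M.
    set (h := Cmod (z - x)) in *; assert (Hh : 0 <= h) by apply Cmod_ge_0.
    assert (Hh2 : h * (M + 1) <= eps * (r * r)).
    { apply Rlt_div_r in Z2; lra. }
    apply Rmult_le_reg_l with (r * r); [nra|].
    replace (r * r * (/ (r * r) * (h * h) * M)) with (h * (h * M)) by (field; lra).
    replace (r * r * (eps * h)) with (h * (eps * (r * r))) by ring.
    apply Rmult_le_compat_l; auto; nra.
  - symmetry; apply is_cseries_unique; rewrite Cmult_comm.
    eapply is_cseries_ext; [|apply is_cseries_scal, CSeries_correct, Hv].
    intros n; unfold v, term, fder; rewrite !RtoC_mult; destruct n; cbn [pred Cpow]; [change (INR 0) with 0|]; ring.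
Qed.

Lemma disc_ones : disc (fun _ => 1).
Proof.
  intros r Hr; apply (ex_series_ext (fun n => r ^ n)).
  - intros n; cbn beta; rewrite Rabs_R1, Rmult_1_l; reflexivity.
  - apply ex_series_geom; rewrite Rabs_pos_eq; lra.
Qed.

Lemma disc_theta : disc theta.
Proof.
  apply (disc_le _ (fint 2 * (fun _ => 1))%S).
  - intros n; rewrite fint_mul_app; unfold theta.
    destruct n; [|destruct (issq _)]; rewrite ?Rabs_R0, ?Rabs_R1, ?Rabs_pos_eq; lra.
  - apply disc_mul; [apply disc_int|apply disc_ones].
Qed.

Lemma sigma1_le n : (sigma1 n <= n * n)%nat.
Proof.
  unfold sigma1.
  assert (H : forall l : list nat, (forall k, In k l -> (k <= n)%nat) -> forall p,
    (list_sum (filter p l) <= length l * n)%nat).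
  { induction l as [|a l IH]; intros Hl p; simpl; [lia|].
    assert (Ha : (a <= n)%nat) by (apply Hl; left; auto).
    assert (IH' := IH (fun k Hk => Hl k (or_intror Hk)) p).
    destruct (p a); unfold list_sum in *; simpl; lia. }
  eapply Nat.le_trans; [apply H|rewrite length_seq; auto].
  intros k Hk; apply in_seq in Hk; lia.
Qed.

Lemma disc_sigma : disc fsigma.
Proof.
  apply (disc_le _ (fder (fder (fun _ => 1)))).
  - intros n; unfold fsigma, fder; assert (H := le_INR _ _ (sigma1_le n)); rewrite mult_INR in H.
    assert (H1 := pos_INR (sigma1 n)); rewrite !Rabs_pos_eq; nra.
  - apply disc_der, disc_der, disc_ones.
Qed.

Lemma disc_th3sq : disc th3sq. Proof. apply disc_mul; apply disc_theta. Qed.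
Lemma disc_th4sq : disc th4sq. Proof. apply disc_neg, disc_th3sq. Qed.
Lemma disc_P1 : disc eis2_nome.
Proof. apply disc_sq, disc_sub; [apply disc_int|apply disc_mul; [apply disc_int|apply disc_sigma]]. Qed.

Open Scope C_scope.

(** * The complex exponential and the nome *)

Lemma Cmod_le_re_im (z : C) : (Cmod z <= Rabs (Re z) + Rabs (Im z))%R.
Proof.
  replace z with (RtoC (Re z) + Ci * RtoC (Im z)) at 1
    by (destruct z; unfold Cplus, Cmult, RtoC, Ci, Re, Im; simpl; f_equal; ring).
  eapply Rle_trans; [apply Cmod_triangle|].
  rewrite Cmod_mult, !Cmod_R, Cmod_Ci; lra.
Qed.

Lemma Cexp_add (z w : C) : Cexp (z + w) = Cexp z * Cexp w.
Proof.
  destruct z as [a b], w as [c d]; unfold Cexp, Cmult, Re, Im; simpl.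
  rewrite exp_plus, cos_plus, sin_plus; f_equal; ring.
Qed.

Lemma Cexp_0 : Cexp 0 = 1.
Proof. unfold Cexp, RtoC; simpl; rewrite exp_0, cos_0, sin_0; f_equal; ring. Qed.

Lemma Cexp_mul_nat (z : C) (n : nat) : Cexp (RtoC (INR n) * z) = Cexp z ^ n.
Proof.
  induction n as [|n IH]; [simpl; replace (0 * z) with (RtoC 0) by ring; apply Cexp_0|].
  rewrite S_INR, RtoC_plus; replace ((INR n + 1) * z) with (z + INR n * z) by ring.
  rewrite Cexp_add, IH; reflexivity.
Qed.

Lemma Cmod_Cexp (z : C) : Cmod (Cexp z) = exp (Re z).
Proof.
  unfold Cexp, Cmod; simpl.
  replace (_ + _)%R with ((exp (Re z)) * (exp (Re z)))%R.
  - apply sqrt_square, Rlt_le, exp_pos.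
  - assert (H := sin2_cos2 (Im z)); unfold Rsqr in H.
    transitivity (exp (Re z) * exp (Re z) * (sin (Im z) * sin (Im z) + cos (Im z) * cos (Im z)))%R;
      [rewrite H; ring|ring].
Qed.

Lemma Cexp_neq_0 (z : C) : Cexp z <> 0.
Proof. apply Cmod_gt_0; rewrite Cmod_Cexp; apply exp_pos. Qed.

Lemma Cexp_surj (z : C) : z <> 0 -> exists w, Cexp w = z.
Proof.
  intros Hz; assert (Hm : (0 < Cmod z)%R) by (apply Cmod_gt_0; auto).
  set (m := Cmod z) in *.
  assert (Hn : (Re z * Re z + Im z * Im z = m * m)%R).
  { assert (H := Cmod2_alt z); fold m in H; simpl in H; lra. }
  set (u := (Re z / m)%R); set (v := (Im z / m)%R).
  assert (Huv : (u * u + v * v = 1)%R).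
  { unfold u, v; replace 1%R with ((Re z * Re z + Im z * Im z) / (m * m))%R by (rewrite Hn; field; lra).
    field; lra. }
  assert (Hang : exists th, cos th = u /\ sin th = v).
  { assert (Hu : (-1 <= u <= 1)%R) by nra.
    assert (Hs : (sin (acos u) * sin (acos u) = v * v)%R).
    { assert (H := sin2_cos2 (acos u)); unfold Rsqr in H; rewrite cos_acos in H by auto; lra. }
    destruct (Rsqr_eq _ _ Hs) as [E|E].
    - exists (acos u); rewrite cos_acos; auto.
    - exists (- acos u)%R; rewrite cos_neg, sin_neg, cos_acos by auto; split; lra. }
  destruct Hang as [th [H1 H2]].
  exists (ln m, th); unfold Cexp; simpl; rewrite exp_ln, H1, H2 by auto.
  unfold u, v; destruct z as [a b]; simpl; f_equal; field; lra.
Qed.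

Lemma deriv0_bound (f : R -> R) (l : R) : derivable_pt_lim f 0 l ->
  forall eps, (0 < eps)%R -> exists d, (0 < d)%R /\
    forall h, (Rabs h < d)%R -> (Rabs (f h - f 0 - l * h) <= eps * Rabs h)%R.
Proof.
  intros H eps He; destruct (H eps He) as [[d Hd0] Hd]; exists d; split; auto.
  intros h Hh; destruct (Req_dec h 0) as [->|Hne].
  - replace (f 0 - f 0 - l * 0)%R with 0%R by ring; rewrite Rabs_R0; lra.
  - specialize (Hd h Hne Hh); rewrite Rplus_0_l in Hd.
    replace (f h - f 0 - l * h)%R with (((f h - f 0) / h - l) * h)%R by (field; auto).
    rewrite Rabs_mult; apply Rmult_le_compat_r; [apply Rabs_pos|lra].
Qed.

Lemma cder_Cexp (t : C) : cder Cexp t (Cexp t).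
Proof.
  assert (H0 : forall eps, (0 < eps)%R -> exists d, (0 < d)%R /\
    forall h, (Cmod h < d)%R -> (Cmod (Cexp h - 1 - h) <= eps * Cmod h)%R).
  (* For h = a + i b the errors in both components add up to at most eps |a| + 7 eps |b|, whence the
     8; eps <= 1 serves to keep exp a <= 3. *)
  { intros eps0 He0; set (eps := Rmin 1 (eps0 / 8)).
    assert (He : (0 < eps)%R) by (apply Rmin_glb_lt; lra).
    assert (He1 : (eps <= 1)%R) by apply Rmin_l.
    assert (He2 : (8 * eps <= eps0)%R) by (assert (H : (eps <= eps0 / 8)%R) by apply Rmin_r; lra).
    clearbody eps.
    destruct (deriv0_bound exp 1) with eps as [d1 [D1 B1]]; auto.
    { replace 1%R with (exp 0) by apply exp_0; apply derivable_pt_lim_exp. }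
    destruct (deriv0_bound cos 0) with eps as [d2 [D2 B2]]; auto.
    { replace 0%R with (- sin 0)%R at 2 by (rewrite sin_0; ring); apply derivable_pt_lim_cos. }
    destruct (deriv0_bound sin 1) with eps as [d3 [D3 B3]]; auto.
    { replace 1%R with (cos 0) by apply cos_0; apply derivable_pt_lim_sin. }
    exists (Rmin (Rmin d1 d2) (Rmin d3 (eps / 2))); split; [repeat apply Rmin_glb_lt; lra|].
    intros h Hh; apply Rmin_Rgt in Hh; destruct Hh as [Ha Hb].
    apply Rmin_Rgt in Ha; destruct Ha as [Z1 Z2]; apply Rmin_Rgt in Hb; destruct Hb as [Z3 Z4].
    assert (Ra := re_le_Cmod h); assert (Rb := Im_le_Cmod h).
    specialize (B1 (Re h) ltac:(lra)); specialize (B2 (Im h) ltac:(lra)); specialize (B3 (Im h) ltac:(lra)).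
    rewrite exp_0 in B1; rewrite cos_0 in B2; rewrite sin_0 in B3.
    set (a := Re h) in *; set (b := Im h) in *; set (m := Cmod h) in *.
    assert (P1 := Rabs_pos a); assert (P2 := Rabs_pos b).
    assert (Hexp : (0 < exp a <= 3)%R).
    { split; [apply exp_pos|]; eapply Rle_trans; [|apply exp_le_3].
      assert (a <= 1)%R by (assert (H := Rle_abs a); lra).
      destruct H as [H| ->]; [left; apply exp_increasing; auto|right; auto]. }
    assert (Hexp1 : (Rabs (exp a - 1) <= 2 * Rabs a)%R).
    { replace (exp a - 1)%R with ((exp a - 1 - 1 * a) + a)%R by ring.
      eapply Rle_trans; [apply Rabs_triang|]; nra. }
    eapply Rle_trans; [apply Cmod_le_re_im|].
    replace (Re (Cexp h - 1 - h)) with (exp a * (cos b - 1 - 0 * b) + (exp a - 1 - 1 * a))%R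
      by (unfold a, b, Cexp, Re, Im; simpl; unfold Re, Im; ring).
    replace (Im (Cexp h - 1 - h)) with (exp a * (sin b - 0 - 1 * b) + (exp a - 1) * b)%R
      by (unfold a, b, Cexp, Re, Im; simpl; unfold Re, Im; ring).
    assert (T1 : (Rabs (exp a * (cos b - 1 - 0 * b)) <= 3 * (eps * Rabs b))%R).
    { rewrite Rabs_mult, (Rabs_pos_eq (exp a)) by lra; apply Rmult_le_compat; try lra; apply Rabs_pos. }
    assert (T2 : (Rabs (exp a * (sin b - 0 - 1 * b)) <= 3 * (eps * Rabs b))%R).
    { rewrite Rabs_mult, (Rabs_pos_eq (exp a)) by lra; apply Rmult_le_compat; try lra; apply Rabs_pos. }
    assert (T3 : (Rabs ((exp a - 1) * b) <= eps * Rabs b)%R).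
    { rewrite Rabs_mult; apply Rmult_le_compat_r; lra. }
    assert (S1 := Rabs_triang (exp a * (cos b - 1 - 0 * b)) (exp a - 1 - 1 * a)).
    assert (S2 := Rabs_triang (exp a * (sin b - 0 - 1 * b)) ((exp a - 1) * b)).
    nra. }
  apply cder_eps; intros eps He.
  destruct (H0 (eps / Cmod (Cexp t))%R) as [d [Hd Hb]].
  { apply Rdiv_lt_0_compat; auto; apply Cmod_gt_0, Cexp_neq_0. }
  exists d; split; auto; intros z Hz.
  replace (Cexp z - Cexp t - Cexp t * (z - t)) with (Cexp t * (Cexp (z - t) - 1 - (z - t))).
  - rewrite Cmod_mult; specialize (Hb _ Hz).
    assert (Hp : (0 < Cmod (Cexp t))%R) by (apply Cmod_gt_0, Cexp_neq_0).
    apply Rmult_le_compat_l with (r := Cmod (Cexp t)) in Hb; [|lra].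
    replace (Cmod (Cexp t) * (eps / Cmod (Cexp t) * Cmod (z - t)))%R with (eps * Cmod (z - t))%R in Hb
      by (field; lra); auto.
  - replace z with (t + (z - t)) at 3 by ring; rewrite Cexp_add; ring.
Qed.

(** x = exp (pi i t), so that q = exp (2 pi i t) is x^2. *)
Definition nome (t : C) : C := Cexp (two_pi_i / 2 * t).

Lemma Cmod_nome t : Cmod (nome t) = exp (- PI * Im t).
Proof.
  unfold nome; rewrite Cmod_Cexp; f_equal.
  replace (two_pi_i / 2 * t) with (RtoC PI * Ci * t) by (unfold two_pi_i; rewrite RtoC_mult; field).
  unfold Re, Im; simpl; ring.
Qed.

Lemma nome_lt_1 t : upper_half_plane t -> (Cmod (nome t) < 1)%R.
Proof.
  intros H; rewrite Cmod_nome, <- exp_0; apply exp_increasing.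
  assert (H1 := PI_RGT_0); unfold upper_half_plane in H; nra.
Qed.

Lemma nome_surj (x : C) : x <> 0 -> (Cmod x < 1)%R -> exists t, upper_half_plane t /\ nome t = x.
Proof.
  intros Hx H; destruct (Cexp_surj x Hx) as [w Hw].
  assert (P := two_pi_i_neq_0).
  assert (E : nome (2 * w / two_pi_i) = x).
  { unfold nome; rewrite <- Hw; f_equal; field; auto. }
  exists (2 * w / two_pi_i); split; auto.
  rewrite <- E, Cmod_nome, <- exp_0 in H; apply exp_lt_inv in H.
  unfold upper_half_plane; assert (H1 := PI_RGT_0); nra.
Qed.

(** The division by 2 again comes from q = x^2: [Dtau] acts as half of x d/dx. *)
Lemma cder_ev_nome f t : disc f -> upper_half_plane t ->
  cder (fun z => ev f (nome z)) t (two_pi_i * (ev (fder f) (nome t) / 2)).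
Proof.
  intros Hf Ht; destruct (ev_cder f (nome t) Hf (nome_lt_1 t Ht)) as [l [Hl E]].
  assert (Hn : cder nome t (nome t * (two_pi_i / 2))).
  { apply (cder_comp Cexp (fun z => two_pi_i / 2 * z)); [apply cder_Cexp|].
    eapply cder_eq; [|apply cder_scal, cder_id]; ring. }
  eapply cder_eq; [|apply (cder_comp (ev f) nome); [apply Hl|apply Hn]].
  rewrite <- E; field.
Qed.

Lemma E2_ev t : upper_half_plane t -> E2 t = ev eis2_nome (nome t).
Proof.
  intros Ht; assert (Hx := nome_lt_1 t Ht).
  set (q := nome t * nome t).
  assert (Hq : (Cmod q < 1)%R).
  { unfold q; rewrite Cmod_mult; assert (H := Cmod_ge_0 (nome t)); nra. }
  assert (Eq : q = Cexp (two_pi_i * t)).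
  { unfold q, nome; rewrite <- Cexp_add; f_equal; field. }
  assert (HP : disc eis2).
  { apply disc_sub; [apply disc_int|apply disc_mul; [apply disc_int|apply disc_sigma]]. }
  unfold eis2_nome; rewrite ev_sq by auto; fold q; unfold eis2.
  rewrite ev_sub, ev_mul, !ev_int; auto using disc_int, disc_sigma, disc_mul.
  unfold E2; f_equal; f_equal.
  destruct (ev_correct fsigma q disc_sigma Hq) as [H1 H2].
  apply is_cseries_unique.
  (* [E2] sums from index 1; nothing is lost by the shift, because the coefficient of [fsigma] at 0
     is 0. *)
  assert (E : forall n, term fsigma q (S n) = INR (sigma1 (S n)) * Cexp (two_pi_i * INR (S n) * t)).
  { intros n; unfold term, fsigma; f_equal; rewrite Eq, <- Cexp_mul_nat; f_equal; ring. }
  split.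
  - eapply is_series_ext; [intros n; cbn beta; rewrite <- E; reflexivity|].
    apply (is_series_incr_1 (K := R_AbsRing) (V := R_NormedModule) (fun n => Re (term fsigma q n))).
    assert (Z : Re (term fsigma q 0) = 0%R) by (unfold term, fsigma; simpl; ring).
    rewrite Z; eapply (eq_ind _ (is_series _)); [exact H1|symmetry; apply Rplus_0_r].
  - eapply is_series_ext; [intros n; cbn beta; rewrite <- E; reflexivity|].
    apply (is_series_incr_1 (K := R_AbsRing) (V := R_NormedModule) (fun n => Im (term fsigma q n))).
    assert (Z : Im (term fsigma q 0) = 0%R) by (unfold term, fsigma; simpl; ring).
    rewrite Z; eapply (eq_ind _ (is_series _)); [exact H2|symmetry; apply Rplus_0_r].
Qed.

(** * The Chazy equation as a first-order system *)

(** It suffices to name candidates for y' and y'' with their derivatives: as the domain is open,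
    equalities valid on it pass under the next derivative. *)
Lemma chazy_intro (y : dfun) (f1 f2 : C -> C) : domain (dom y) ->
  (forall t, dom y t -> cder (val y) t (two_pi_i * f1 t)) ->
  (forall t, dom y t -> cder f1 t (two_pi_i * f2 t)) ->
  (forall t, dom y t -> cder f2 t (two_pi_i * (val y t * f2 t - 3 / 2 * f1 t ^ 2))) ->
  chazy y /\ (forall t, dom y t -> Dtau (val y) t = f1 t) /\
  (forall t, dom y t -> Dtau (Dtau (val y)) t = f2 t).
Proof.
  intros HU H0 H1 H2; assert (HO : open (dom y)) by apply HU.
  assert (E1 : forall t, dom y t -> Dtau (val y) t = f1 t) by (intros; apply Dtau_eq; auto).
  assert (C1 : forall t, dom y t -> cder (Dtau (val y)) t (two_pi_i * f2 t)).
  { intros t Ht; apply (cder_ext_open (dom y) f1); auto; intros; symmetry; auto. }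
  assert (E2 : forall t, dom y t -> Dtau (Dtau (val y)) t = f2 t) by (intros; apply Dtau_eq; auto).
  assert (C2 : forall t, dom y t -> cder (Dtau (Dtau (val y))) t (two_pi_i * (val y t * f2 t - 3 / 2 * f1 t ^ 2))).
  { intros t Ht; apply (cder_ext_open (dom y) f2); auto; intros; symmetry; auto. }
  repeat split; auto; try apply HU; try (intros t Ht; eexists; eauto; fail).
  - intros t Ht; eexists; apply H0; auto.
  - intros t Ht; eexists; apply C1; auto.
  - intros t Ht; eexists; apply C2; auto.
  - intros t Ht; rewrite (Dtau_eq _ _ _ (C2 t Ht)), E1, E2; auto.
Qed.

Lemma chazy_elim (y : dfun) : chazy y -> forall t, dom y t ->
  cder (val y) t (two_pi_i * Dtau (val y) t) /\
  cder (Dtau (val y)) t (two_pi_i * Dtau (Dtau (val y)) t) /\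
  cder (Dtau (Dtau (val y))) t
    (two_pi_i * (val y t * Dtau (Dtau (val y)) t - 3 / 2 * (Dtau (val y) t) ^ 2)).
Proof.
  intros [_ [H0 [H1 [H2 H]]]] t Ht; split; [|split]; [apply Dtau_cder; auto| |].
  - apply Dtau_cder; apply H1; auto.
  - rewrite <- H by auto; apply Dtau_cder; apply H2; auto.
Qed.

(* For y = E2 these are the Eisenstein series E4 and E6. *)
Definition invQ (y : dfun) (t : C) : C := val y t ^ 2 - 12 * Dtau (val y) t.
Definition invR (y : dfun) (t : C) : C :=
  val y t ^ 3 - 18 * val y t * Dtau (val y) t + 36 * Dtau (Dtau (val y)) t.

(** f1 and f2 are the definitions of [invQ] and [invR] solved for y' and y''; the equation for R'
    then becomes the Chazy equation. *)
Lemma ramanujan_chazy (y : dfun) (Q R : C -> C) : domain (dom y) ->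
  (forall t, dom y t -> cder (val y) t (two_pi_i * ((val y t ^ 2 - Q t) / 12))) ->
  (forall t, dom y t -> cder Q t (two_pi_i * ((val y t * Q t - R t) / 3))) ->
  (forall t, dom y t -> cder R t (two_pi_i * ((val y t * R t - Q t ^ 2) / 2))) ->
  chazy y /\ (forall t, dom y t -> invQ y t = Q t) /\ (forall t, dom y t -> invR y t = R t).
Proof.
  intros HU H0 HQ HR.
  set (f1 := fun t => / 12 * (val y t * val y t - Q t)).
  set (f2 := fun t => / 36 * (18 * (val y t * f1 t) + (R t - val y t * (val y t * val y t)))).
  assert (Hy : forall t, dom y t -> cder (val y) t (two_pi_i * f1 t)).
  { intros t Ht; eapply cder_eq; [|apply H0; auto]; unfold f1; field. }
  assert (H1 : forall t, dom y t -> cder f1 t (two_pi_i * f2 t)).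
  { intros t Ht; eapply cder_eq; [|apply cder_scal, cder_minus; [apply cder_mult; apply Hy; auto|apply HQ; auto]].
    unfold f2, f1; field. }
  destruct (chazy_intro y f1 f2) as [A [B D]]; auto.
  { intros t Ht; eapply cder_eq; [|apply cder_scal, cder_plus;
      [apply cder_scal, cder_mult; [apply Hy|apply H1]; auto
      |apply cder_minus; [apply HR; auto|apply cder_mult; [apply Hy; auto|apply cder_mult; apply Hy; auto]]]].
    unfold f2, f1; field. }
  split; auto; split; intros t Ht; unfold invQ, invR; rewrite B, ?D by auto; unfold f2, f1; field.
Qed.

(** * Theta functions and E2 on the upper half-plane *)

Definition thA (t : C) : C := ev th3sq (nome t).
Definition thB (t : C) : C := ev th4sq (nome t).
(** E4 and E6 as polynomials in X = theta_3^4 and Y = theta_4^4, with theta_2^4 = X - Y in the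
    factors of E6. *)
Definition eisQ (X Y : C) : C := X * X - X * Y + Y * Y.
Definition eisR (X Y : C) : C := (2 * X - Y) * (X + Y) * (2 * Y - X) / 2.

Lemma ev_def f x : ev f x = CSeries (term f x). Proof. reflexivity. Qed.
Lemma nome_neq_0 t : nome t <> 0. Proof. apply Cexp_neq_0. Qed.
Lemma fsub_app (f g : fps) n : (f - g)%S n = (f n - g n)%R. Proof. reflexivity. Qed.

Opaque th3sq th4sq eis2_nome ev nome fadd fsub fmul fint.

Ltac disc_tac := repeat (apply disc_th3sq || apply disc_th4sq || apply disc_P1 || apply disc_int ||
  apply disc_sub || apply disc_add || apply disc_mul).

Lemma ev_fder6 f g x : disc f -> (Cmod x < 1)%R -> (fint 6 * fder f)%S = g ->
  ev (fder f) x = ev g x / 6.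
Proof.
  intros Hf Hx <-; rewrite ev_mul, ev_int; auto using disc_int, disc_der; field.
Qed.

Lemma cder_thA t : upper_half_plane t ->
  cder thA t (two_pi_i * (thA t * (E2 t + thA t * thA t - 2 * (thB t * thB t)) / 12)).
Proof.
  intros Ht; assert (Hx := nome_lt_1 t Ht).
  eapply cder_eq; [|apply cder_ev_nome; [apply disc_th3sq|auto]].
  rewrite (ev_fder6 _ _ _ disc_th3sq Hx fder_th3sq), E2_ev by auto.
  unfold thA, thB; rewrite ev_mul, ev_sub, ev_add, !ev_mul, ev_int by (auto; disc_tac); field.
Qed.

Lemma cder_thB t : upper_half_plane t ->
  cder thB t (two_pi_i * (thB t * (E2 t - 2 * (thA t * thA t) + thB t * thB t) / 12)).
Proof.
  intros Ht; assert (Hx := nome_lt_1 t Ht).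
  eapply cder_eq; [|apply cder_ev_nome; [apply disc_th4sq|auto]].
  rewrite (ev_fder6 _ _ _ disc_th4sq Hx fder_th4sq), E2_ev by auto.
  unfold thA, thB; rewrite ev_mul, ev_add, ev_sub, !ev_mul, ev_int by (auto; disc_tac); field.
Qed.

Lemma open_upper : open upper_half_plane.
Proof.
  apply open_eps; intros t Ht; exists (Im t); split; auto; intros z Hz.
  assert (H := Im_le_Cmod (z - t)); unfold upper_half_plane in *.
  replace (Im (z - t)) with (Im z - Im t)%R in H by (unfold Im; simpl; ring).
  unfold Rabs in H; destruct (Rcase_abs _) in H; lra.
Qed.

Lemma cder_E2 t : upper_half_plane t ->
  cder E2 t (two_pi_i * ((E2 t ^ 2 - eisQ (thA t * thA t) (thB t * thB t)) / 12)).
Proof.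
  intros Ht; assert (Hx := nome_lt_1 t Ht).
  apply (cder_ext_open upper_half_plane (fun z => ev eis2_nome (nome z)));
    [apply open_upper|auto|intros; symmetry; apply E2_ev; auto|].
  eapply cder_eq; [|apply cder_ev_nome; [apply disc_P1|auto]].
  rewrite (ev_fder6 _ _ _ disc_P1 Hx fder_P1), E2_ev by auto.
  unfold thA, thB, eisQ; rewrite ev_sub, ev_add, ev_sub, !ev_mul by (auto; disc_tac); field.
Qed.

(** A form of Halphen's system. It implies Ramanujan's because Q and R are polynomials in X and Y,
    whose derivatives are polynomials in X, Y and y. *)
Lemma halphen_chazy (y : dfun) (X Y : C -> C) : domain (dom y) ->
  (forall t, dom y t -> cder (val y) t (two_pi_i * ((val y t ^ 2 - eisQ (X t) (Y t)) / 12))) ->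
  (forall t, dom y t -> cder X t (two_pi_i * (X t * (val y t + X t - 2 * Y t) / 6))) ->
  (forall t, dom y t -> cder Y t (two_pi_i * (Y t * (val y t - 2 * X t + Y t) / 6))) ->
  chazy y /\ (forall t, dom y t -> invQ y t = eisQ (X t) (Y t)) /\
  (forall t, dom y t -> invR y t = eisR (X t) (Y t)).
Proof.
  intros HD H0 HX HY.
  apply (ramanujan_chazy y (fun t => eisQ (X t) (Y t)) (fun t => eisR (X t) (Y t))); auto.
  - intros t Ht; specialize (HX t Ht); specialize (HY t Ht); unfold eisQ.
    eapply cder_eq; [|apply cder_plus; [apply cder_minus; apply cder_mult|apply cder_mult]; eassumption].
    unfold eisQ, eisR; field.
  - intros t Ht; specialize (HX t Ht); specialize (HY t Ht).
    apply (cder_ext (fun t => / 2 * ((2 * X t - Y t) * (X t + Y t) * (2 * Y t - X t))));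
      [intros z; unfold eisR; field|].
    eapply cder_eq; [|apply cder_scal, cder_mult; [apply cder_mult|];
      [apply cder_minus; [apply cder_scal|]|apply cder_plus|apply cder_minus; [apply cder_scal|]]; eassumption].
    unfold eisQ, eisR; field.
Qed.

Lemma E2_chazy_gen : domain upper_half_plane ->
  chazy E2_sol /\
  (forall t, upper_half_plane t -> invQ E2_sol t = eisQ (thA t * thA t) (thB t * thB t)) /\
  (forall t, upper_half_plane t -> invR E2_sol t = eisR (thA t * thA t) (thB t * thB t)).
Proof.
  intros HD.
  apply (halphen_chazy E2_sol (fun t => thA t * thA t) (fun t => thB t * thB t)); auto.
  - apply cder_E2.
  - intros t Ht; eapply cder_eq; [|apply cder_mult; apply cder_thA; auto]; simpl val; field.
  - intros t Ht; eapply cder_eq; [|apply cder_mult; apply cder_thB; auto]; simpl val; field.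
Qed.

Open Scope C_scope.

(** * Values of the theta series in the unit disc *)

Lemma Cmod_sq_lt_1 (x : C) : (Cmod x < 1)%R -> (Cmod (x * x) < 1)%R.
Proof. intros H; rewrite Cmod_mult; assert (H1 := Cmod_ge_0 x); nra. Qed.

Lemma ev_ab_add x : (Cmod x < 1)%R -> ev th3sq x + ev th4sq x = 2 * ev th3sq (x * x).
Proof.
  intros Hx; rewrite <- ev_add by (auto using disc_th3sq, disc_th4sq).
  rewrite th3sq_add_th4sq, ev_mul, ev_int, ev_sq; auto using disc_int, disc_sq, disc_th3sq.
Qed.

Lemma ev_ab_mul x : (Cmod x < 1)%R -> ev th3sq x * ev th4sq x = ev th4sq (x * x) * ev th4sq (x * x).
Proof.
  intros Hx; rewrite <- ev_mul by (auto using disc_th3sq, disc_th4sq).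
  rewrite th3sq_mul_th4sq, ev_mul, ev_sq; auto using disc_sq, disc_th4sq.
Qed.

Lemma ev_th3sq_opp x : ev th3sq (- x) = ev th4sq x.
Proof. rewrite <- ev_neg; reflexivity. Qed.

Lemma ev_th4sq_opp x : ev th4sq (- x) = ev th3sq x.
Proof. rewrite <- ev_th3sq_opp; f_equal; ring. Qed.

Lemma ev_0 f : ev f 0 = f O.
Proof.
  rewrite <- (ev_cst (f O) 0), !ev_def; f_equal; fext; intros [|n]; unfold term, fcst.
  - reflexivity.
  - rewrite Cpow_S; ring.
Qed.

Lemma ev_continuous f x : disc f -> (Cmod x < 1)%R -> forall eps, (0 < eps)%R ->
  exists d, (0 < d)%R /\ forall z, (Cmod (z - x) < d)%R -> (Cmod (ev f z - ev f x) < eps)%R.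
Proof. intros Hf Hx; destruct (ev_cder f x Hf Hx) as [l [H _]]; apply (cder_continuous _ _ _ H). Qed.

(** Repeated squaring tends to 0 in the disc, so a property stable under squaring can be refuted by
    looking near 0 only. *)
Lemma iter_sq_small (P : C -> Prop) (x : C) : (Cmod x < 1)%R -> P x ->
  (forall y, (Cmod y < 1)%R -> P y -> P (y * y)) ->
  forall d, (0 < d)%R -> exists y, (Cmod y < d)%R /\ P y.
Proof.
  intros Hx HP HS d Hd; assert (H0 := Cmod_ge_0 x).
  assert (H : forall n, exists y, (Cmod y <= Cmod x ^ (S n))%R /\ P y).
  { induction n as [|n [y [Hy Py]]]; [exists x; split; [simpl; lra|auto]|].
    assert (Hle : (Cmod x ^ (S n) <= Cmod x)%R).
    { assert (Cmod x ^ n <= 1)%R by (rewrite <- (pow1 n); apply pow_incr; lra); simpl; nra. }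
    exists (y * y); split; [|apply HS; auto; lra].
    rewrite Cmod_mult; change (Cmod x ^ S (S n))%R with (Cmod x * Cmod x ^ S n)%R.
    apply Rmult_le_compat; try apply Cmod_ge_0; lra. }
  destruct (pow_lt_1_zero (Cmod x)) with d as [N HN]; auto.
  { rewrite Rabs_pos_eq; auto. }
  destruct (H N) as [y [Hy Py]]; exists y; split; auto.
  specialize (HN (S N) ltac:(lia)); rewrite Rabs_pos_eq in HN by (apply pow_le; auto); lra.
Qed.

(** By a b = b(x^2)^2 a zero of b at x gives one at x^2, hence zeros arbitrarily near 0, where b is
    close to 1. *)
Lemma ev_th4sq_neq_0 x : (Cmod x < 1)%R -> ev th4sq x <> 0.
Proof.
  intros Hx E.
  assert (H0 : (Cmod 0 < 1)%R) by (rewrite Cmod_0; lra).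
  destruct (ev_continuous th4sq 0 disc_th4sq H0 1 Rlt_0_1) as [d [Hd Hc]].
  destruct (iter_sq_small (fun y => ev th4sq y = 0) x Hx E) with d as [y [Hy Ey]]; auto.
  { intros y Hy Ey; assert (H := ev_ab_mul y Hy); rewrite Ey, Cmult_0_r in H.
    symmetry in H; apply Cmult_integral in H; tauto. }
  specialize (Hc y ltac:(replace (y - 0) with y by ring; auto)).
  rewrite Ey, ev_0 in Hc; destruct th4sq_coefs as [Hb _]; rewrite Hb in Hc.
  replace (0 - 1) with (- (1)) in Hc by ring; rewrite Cmod_m1 in Hc; lra.
Qed.

Lemma ev_th3sq_neq_0 x : (Cmod x < 1)%R -> ev th3sq x <> 0.
Proof. intros Hx; rewrite <- ev_th4sq_opp; apply ev_th4sq_neq_0; rewrite Cmod_opp; auto. Qed.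

Lemma disc_tail f : disc f -> disc (fps_tail f).
Proof.
  intros Hf r Hr; destruct (Req_dec r 0) as [->|Hr0].
  - apply (ex_series_ext (fun n => Rabs (fcst (f 1%nat) n) * 0 ^ n)%R).
    + intros [|n]; unfold fps_tail, fcst; simpl; [reflexivity|]; rewrite !Rmult_0_l, !Rmult_0_r; reflexivity.
    + apply disc_cst; lra.
  - apply (ex_series_ext (fun n => / r * (Rabs (f (S n)) * r ^ (S n)))%R).
    + intros n; unfold fps_tail; simpl; field; auto.
    + apply (ex_series_scal (V := R_NormedModule)).
      apply (ex_series_incr_1 (K := R_AbsRing) (V := R_NormedModule) (fun n => Rabs (f n) * r ^ n)%R); auto.
Qed.

(** (a - b) / x, whose value 8 at 0 makes x a local parameter for the ratio of a and b. *)
Definition th_diff_quot : fps := fps_tail (th3sq - th4sq)%S.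

Lemma disc_th_diff_quot : disc th_diff_quot.
Proof. apply disc_tail, disc_sub; [apply disc_th3sq|apply disc_th4sq]. Qed.

Lemma ev_ab_sub x : (Cmod x < 1)%R -> ev th3sq x - ev th4sq x = x * ev th_diff_quot x.
Proof.
  intros Hx; rewrite <- ev_sub by (auto using disc_th3sq, disc_th4sq).
  assert (H : is_cseries (fun n => x * term th_diff_quot x n) (x * ev th_diff_quot x)).
  { apply is_cseries_scal, ev_correct; auto using disc_th_diff_quot. }
  rewrite (ev_def (th3sq - th4sq)%S); apply is_cseries_unique.
  assert (Z : (th3sq - th4sq)%S O = 0%R).
  { rewrite fsub_app; destruct th3sq_coefs as [-> _], th4sq_coefs as [-> _]; ring. }
  assert (E0 : term (th3sq - th4sq)%S x 0 = 0) by (unfold term; rewrite Z; simpl; ring).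
  assert (ES : forall n, term (th3sq - th4sq)%S x (S n) = x * term th_diff_quot x n).
  { intros n; unfold term, th_diff_quot, fps_tail; simpl; ring. }
  destruct H as [H1 H2]; split.
  - apply (is_series_decr_1 (K := R_AbsRing) (V := R_NormedModule)); rewrite E0.
    eapply (eq_ind _ (is_series _)); [eapply is_series_ext; [|apply H1]|].
    + intros n; cbn beta; rewrite ES; reflexivity.
    + symmetry; transitivity (Re (x * ev th_diff_quot x) + - 0)%R; [reflexivity|rewrite Ropp_0; apply Rplus_0_r].
  - apply (is_series_decr_1 (K := R_AbsRing) (V := R_NormedModule)); rewrite E0.
    eapply (eq_ind _ (is_series _)); [eapply is_series_ext; [|apply H2]|].
    + intros n; cbn beta; rewrite ES; reflexivity.
    + symmetry; transitivity (Im (x * ev th_diff_quot x) + - 0)%R; [reflexivity|rewrite Ropp_0; apply Rplus_0_r].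
Qed.

Lemma th_diff_quot_0 : ev th_diff_quot 0 = 8.
Proof.
  rewrite ev_0; f_equal; unfold th_diff_quot, fps_tail; rewrite fsub_app.
  destruct th3sq_coefs as [_ ->], th4sq_coefs as [_ ->]; ring.
Qed.

(** a = b at y gives a^2 = b^2 at y^2; there a + b <> 0, being twice a value of a, so a = b at y^2
    too. Near 0 this contradicts a - b = x g(x) with g(0) = 8. *)
Lemma ev_ab_sub_neq_0 x : (Cmod x < 1)%R -> x <> 0 -> ev th3sq x <> ev th4sq x.
Proof.
  intros Hx Hx0 E.
  assert (H0 : (Cmod 0 < 1)%R) by (rewrite Cmod_0; lra).
  destruct (ev_continuous th_diff_quot 0 disc_th_diff_quot H0 8) as [d [Hd Hc]]; [lra|].
  destruct (iter_sq_small (fun y => y <> 0 /\ ev th3sq y = ev th4sq y) x Hx (conj Hx0 E)) with (Rmin d 1)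
    as [y [Hy [Hy0 Ey]]].
  { intros y Hy [Hy0 Ey]; split; [apply Cmult_neq_0; auto|].
    assert (H := ev_ab_add y Hy); assert (H1 := ev_ab_mul y Hy).
    assert (Hyy := Cmod_sq_lt_1 y Hy).
    assert (E1 : (ev th3sq (y * y) - ev th4sq (y * y)) * (ev th3sq (y * y) + ev th4sq (y * y)) = 0).
    { transitivity ((2 * ev th3sq (y * y)) * (2 * ev th3sq (y * y)) / 4 - ev th4sq (y * y) * ev th4sq (y * y)); [field|].
      rewrite <- H, <- H1, Ey; field. }
    apply Cmult_integral in E1; destruct E1 as [E1|E1].
    - replace (ev th3sq (y * y)) with (ev th3sq (y * y) - ev th4sq (y * y) + ev th4sq (y * y)) by ring.
      rewrite E1; ring.
    - exfalso; rewrite ev_ab_add in E1 by auto.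
      apply Cmult_integral in E1; destruct E1 as [E1|E1].
      + injection E1; lra.
      + revert E1; apply ev_th3sq_neq_0, Cmod_sq_lt_1; auto. }
  { apply Rmin_glb_lt; lra. }
  apply Rmin_Rgt in Hy; destruct Hy as [Y1 Y2].
  assert (Z := ev_ab_sub y Y2).
  replace (ev th3sq y - ev th4sq y) with (RtoC 0) in Z by (rewrite Ey; ring).
  symmetry in Z; apply Cmult_integral in Z; destruct Z as [Z|Z]; [auto|].
  specialize (Hc y ltac:(replace (y - 0) with y by ring; auto)).
  rewrite Z, th_diff_quot_0 in Hc; replace (0 - 8) with (- RtoC 8) in Hc by ring.
  rewrite Cmod_opp, Cmod_R, Rabs_pos_eq in Hc; lra.
Qed.

Lemma pow_diff_bound n (x z : C) r : (0 < r)%R -> (Cmod x <= r)%R -> (Cmod z <= r)%R ->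
  (r * Cmod (z ^ n - x ^ n) <= INR n * r ^ n * Cmod (z - x))%R.
Proof.
  intros Hr Hx Hz; assert (Hh := Cmod_ge_0 (z - x)); induction n as [|n IH].
  - replace (z ^ 0 - x ^ 0) with (RtoC 0) by (simpl; ring); rewrite Cmod_0; simpl; lra.
  - replace (z ^ S n - x ^ S n) with (z * (z ^ n - x ^ n) + x ^ n * (z - x)) by (simpl; ring).
    assert (T := Cmod_triangle (z * (z ^ n - x ^ n)) (x ^ n * (z - x))).
    rewrite !Cmod_mult, Cmod_pow in T.
    assert (P : (Cmod x ^ n <= r ^ n)%R) by (apply pow_incr; split; [apply Cmod_ge_0|auto]).
    assert (P0 : (0 <= r ^ n)%R) by (apply pow_le; lra).
    assert (T1 : (Cmod z * Cmod (z ^ n - x ^ n) <= r * Cmod (z ^ n - x ^ n))%R)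
      by (apply Rmult_le_compat_r; auto; apply Cmod_ge_0).
    assert (T2 : (Cmod x ^ n * Cmod (z - x) <= r ^ n * Cmod (z - x))%R) by (apply Rmult_le_compat_r; auto).
    rewrite S_INR; simpl.
    apply Rle_trans with (r * (r * Cmod (z ^ n - x ^ n) + r ^ n * Cmod (z - x)))%R;
      [apply Rmult_le_compat_l; lra|nra].
Qed.

Lemma ev_lipschitz f r : disc f -> (0 < r < 1)%R -> exists L, (0 <= L)%R /\
  forall x z, (Cmod x <= r)%R -> (Cmod z <= r)%R -> (Cmod (ev f z - ev f x) <= L * Cmod (z - x))%R.
Proof.
  intros Hf Hr.
  assert (HM := disc_der _ Hf r (conj (Rlt_le _ _ (proj1 Hr)) (proj2 Hr))).
  set (M := Series (fun n => Rabs (fder f n) * r ^ n)%R).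
  assert (HM0 : (0 <= M)%R).
  { apply Rle_trans with (Series (fun _ => 0 * 0)%R); [rewrite Series_scal_l; lra|].
    apply Series_le; auto; intros n; split; [lra|]; rewrite Rmult_0_l.
    apply Rmult_le_pos; [apply Rabs_pos|apply pow_le; lra]. }
  exists (/ r * M)%R; split.
  { apply Rmult_le_pos; auto; left; apply Rinv_0_lt_compat; lra. }
  intros x z Hx Hz; set (h := Cmod (z - x)); assert (Hh : (0 <= h)%R) by apply Cmod_ge_0.
  set (w := fun n => RtoC (f n) * (z ^ n - x ^ n)).
  assert (Hw : is_cseries w (ev f z - ev f x)).
  { replace (ev f z - ev f x) with (ev f z + (-1) * ev f x) by ring.
    eapply is_cseries_ext; [|apply is_cseries_plus; [|apply is_cseries_scal]; apply ev_correct; auto; lra].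
    intros n; unfold w, term; ring. }
  assert (Hb : forall n, (Cmod (w n) <= / r * h * (Rabs (fder f n) * r ^ n))%R).
  { intros n; unfold w; rewrite Cmod_mult, Cmod_R.
    assert (H := pow_diff_bound n x z r (proj1 Hr) Hx Hz); fold h in H.
    unfold fder; rewrite Rabs_mult, (Rabs_pos_eq (INR n)) by apply pos_INR.
    apply Rmult_le_reg_l with r; [lra|].
    replace (r * (/ r * h * (INR n * Rabs (f n) * r ^ n)))%R with (Rabs (f n) * (INR n * r ^ n * h))%R by (field; lra).
    replace (r * (Rabs (f n) * Cmod (z ^ n - x ^ n)))%R with (Rabs (f n) * (r * Cmod (z ^ n - x ^ n)))%R by ring.
    apply Rmult_le_compat_l; auto; apply Rabs_pos. }
  assert (Hex : ex_series (fun n => / r * h * (Rabs (fder f n) * r ^ n))%R)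
    by (apply (ex_series_scal (V := R_NormedModule)); auto).
  assert (Hws : abs_summable w).
  { apply (ex_series_dom _ _) with (2 := Hex); intros n; rewrite Rabs_pos_eq by apply Cmod_ge_0; apply Hb. }
  eapply Rle_trans; [apply (CSeries_bound w); auto|].
  eapply Rle_trans; [apply Series_le; [intros n; split; [apply Cmod_ge_0|apply Hb]|auto]|].
  rewrite Series_scal_l; fold M; right; ring.
Qed.

(** The limit of the iterates of 0 is obtained as the sum of the absolutely convergent series of
    their increments. *)
Lemma contraction_fixed_point (T : C -> C) (rho : R) : (0 < rho)%R ->
  (forall x, (Cmod x <= rho)%R -> (Cmod (T x) <= rho)%R) ->
  (forall x z, (Cmod x <= rho)%R -> (Cmod z <= rho)%R -> (Cmod (T z - T x) <= / 2 * Cmod (z - x))%R) ->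
  exists x : C, (Cmod x <= rho)%R /\ T x = x.
Proof.
  intros Hr HT HL.
  set (x := fun n => Nat.iter n T 0).
  assert (Hx : forall n, (Cmod (x n) <= rho)%R).
  { induction n as [|n IH]; [unfold x; simpl; rewrite Cmod_0; lra|apply HT; auto]. }
  assert (Hd : forall n, (Cmod (x (S n) - x n) <= rho * (/ 2) ^ n)%R).
  { induction n as [|n IH].
    - replace (x 1%nat - x O) with (x 1%nat) by (change (x O) with (RtoC 0); ring).
      rewrite pow_O, Rmult_1_r; apply Hx.
    - change (x (S (S n)) - x (S n)) with (T (x (S n)) - T (x n)).
      eapply Rle_trans; [apply HL; auto|].
      replace (rho * (/ 2) ^ S n)%R with (/ 2 * (rho * (/ 2) ^ n))%R by (cbn [pow]; ring).
      apply Rmult_le_compat_l; [lra|auto]. }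
  set (u := fun n => x (S n) - x n).
  assert (Hg : ex_series (fun n => rho * (/ 2) ^ n)%R).
  { apply (ex_series_scal (V := R_NormedModule)), ex_series_geom; rewrite Rabs_pos_eq; lra. }
  assert (Hu : abs_summable u).
  { apply (ex_series_dom _ _) with (2 := Hg); intros n; rewrite Rabs_pos_eq by apply Cmod_ge_0; apply Hd. }
  destruct (CSeries_correct u Hu) as [S1 S2]; set (l := CSeries u) in *.
  assert (Hsum : forall n, sum_n (fun n => Re (u n)) n = Re (x (S n)) /\ sum_n (fun n => Im (u n)) n = Im (x (S n))).
  { induction n as [|n [I1 I2]]; [rewrite !sum_O|rewrite !sum_Sn, I1, I2];
    unfold u; rewrite Re_sub, Im_sub.
    - change (x O) with (RtoC 0); split; apply Rminus_0_r.
    - split; apply Rplus_minus. }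
  assert (Hlim : forall eps, (0 < eps)%R -> exists N, forall n, (N <= n)%nat -> (Cmod (x (S n) - l) < eps)%R).
  { intros eps He; assert (He2 : (0 < eps / 2)%R) by lra.
    assert (L1 : is_lim_seq (sum_n (fun n => Re (u n))) (Re l)) by exact S1.
    assert (L2 : is_lim_seq (sum_n (fun n => Im (u n))) (Im l)) by exact S2.
    apply is_lim_seq_spec in L1; apply is_lim_seq_spec in L2.
    destruct (L1 (mkposreal _ He2)) as [N1 H1]; destruct (L2 (mkposreal _ He2)) as [N2 H2].
    exists (Nat.max N1 N2); intros n Hn.
    specialize (H1 n ltac:(lia)); specialize (H2 n ltac:(lia)); cbn [pos] in H1, H2.
    destruct (Hsum n) as [E1 E2]; rewrite E1 in H1; rewrite E2 in H2.
    eapply Rle_lt_trans; [apply Cmod_le_re_im|].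
    rewrite Re_sub, Im_sub; lra. }
  assert (Hl : (Cmod l <= rho)%R).
  { apply le_epsilon; intros eps He; destruct (Hlim eps He) as [N HN].
    specialize (HN N (Nat.le_refl N)); specialize (Hx (S N)).
    rewrite Cmod_sub_sym in HN; assert (H := Cmod_sub_ge l (x (S N))); lra. }
  exists l; split; auto.
  assert (Hz : Cmod (T l - l) = 0%R).
  { apply Rle_antisym; [|apply Cmod_ge_0]; apply le_epsilon; intros eps He.
    destruct (Hlim (eps / 2)%R ltac:(lra)) as [N HN].
    assert (H1 := HN N (Nat.le_refl N)); assert (H2 := HN (S N) ltac:(lia)).
    assert (H3 := HL (x (S N)) l (Hx _) Hl); rewrite Cmod_sub_sym in H1.
    assert (H4 := Cmod_tri_sub (T l) (T (x (S N))) l).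
    change (T (x (S N))) with (x (S (S N))) in *; lra. }
  apply Cmod_eq_0 in Hz; replace (T l) with (T l - l + l) by ring; rewrite Hz; ring.
Qed.

(** With a - b = x g(x) and a + b = 2 a(x^2) the equation reads x g(x) = 2 k a(x^2). Isolating 8 x,
    where 8 = g(0), makes x a fixed point of T, which contracts a small disc when k is small. *)
Lemma ab_local_inversion : exists k0, (0 < k0)%R /\ forall k, (Cmod k < k0)%R ->
  exists x : C, (Cmod x < 1)%R /\ ev th3sq x - ev th4sq x = k * (ev th3sq x + ev th4sq x).
Proof.
  destruct (ev_lipschitz th3sq (/ 2) disc_th3sq ltac:(lra)) as [La [HLa0 HLa]].
  destruct (ev_lipschitz th_diff_quot (/ 2) disc_th_diff_quot ltac:(lra)) as [Lg [HLg0 HLg]].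
  (* Makes rho La, rho Lg and rho at most 1/2. The three contributions to 8 (T z - T x) are then at
     most 2 h, h and h, which yields the ratio 4/8. *)
  set (rho := (/ (2 * (2 + La + Lg)))%R).
  assert (Hrho : (0 < rho)%R) by (apply Rinv_0_lt_compat; lra).
  assert (Hrho1 : (rho * (2 * (2 + La + Lg)) = 1)%R) by (unfold rho; field; lra).
  clearbody rho.
  assert (HrL : (rho * La <= / 2 /\ rho * Lg <= / 2 /\ rho <= / 2)%R) by nra.
  (* |k| < 1 is for the contraction, |k| < 2 rho for |T 0| = |k| / 4 <= rho / 2, so that T maps the
     disc to itself. *)
  exists (Rmin 1 (2 * rho)); split; [apply Rmin_glb_lt; lra|].
  intros k Hk; apply Rmin_Rgt in Hk; destruct Hk as [K1 K2].
  assert (Hk0 := Cmod_ge_0 k).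
  set (T := fun x => (2 * k * ev th3sq (x * x) - x * (ev th_diff_quot x - 8)) / 8).
  assert (HT : forall x z, (Cmod x <= rho)%R -> (Cmod z <= rho)%R -> (Cmod (T z - T x) <= / 2 * Cmod (z - x))%R).
  { intros x z Hx Hz; set (h := Cmod (z - x)); assert (Hh : (0 <= h)%R) by apply Cmod_ge_0.
    assert (Hx0 := Cmod_ge_0 x); assert (Hz0 := Cmod_ge_0 z).
    assert (HH : forall y, (Cmod y <= rho)%R -> (Cmod (y * y) <= / 2)%R).
    { intros y Hy; rewrite Cmod_mult; assert (H := Cmod_ge_0 y); nra. }
    replace (T z - T x) with (/ 8 * (2 * k * (ev th3sq (z * z) - ev th3sq (x * x)) -
      ((z - x) * (ev th_diff_quot z - ev th_diff_quot 0) + x * (ev th_diff_quot z - ev th_diff_quot x)))) by (unfold T; rewrite th_diff_quot_0; field).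
    rewrite Cmod_mult.
    replace (Cmod (/ 8)) with (/ 8)%R by (rewrite Cmod_inv, Cmod_R, Rabs_pos_eq by (try lra; intros H; injection H; lra); auto).
    assert (B1 : (Cmod (2 * k * (ev th3sq (z * z) - ev th3sq (x * x))) <= 2 * (1 * (1 * h)))%R).
    { rewrite !Cmod_mult, Cmod_R, Rabs_pos_eq by lra; rewrite Rmult_assoc.
      apply Rmult_le_compat_l; [lra|]; apply Rmult_le_compat; auto; try lra; [apply Cmod_ge_0|].
      eapply Rle_trans; [apply HLa; auto|].
      replace (z * z - x * x) with ((z + x) * (z - x)) by ring; rewrite Cmod_mult; fold h.
      assert (H := Cmod_triangle z x).
      apply Rle_trans with (La * (2 * rho * h))%R; [|nra].
      apply Rmult_le_compat_l; auto; apply Rmult_le_compat_r; lra. }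
    assert (B2 : (Cmod ((z - x) * (ev th_diff_quot z - ev th_diff_quot 0)) <= h * 1)%R).
    { rewrite Cmod_mult; fold h; apply Rmult_le_compat_l; auto.
      eapply Rle_trans; [apply HLg; [rewrite Cmod_0; lra|lra]|].
      replace (z - 0) with z by ring; nra. }
    assert (B3 : (Cmod (x * (ev th_diff_quot z - ev th_diff_quot x)) <= 1 * h)%R).
    { rewrite Cmod_mult; apply Rle_trans with (rho * (Lg * h))%R; [|nra].
      apply Rmult_le_compat; auto; [apply Cmod_ge_0|]; apply HLg; lra. }
    assert (C1 := Cmod_sub_le (2 * k * (ev th3sq (z * z) - ev th3sq (x * x)))
      ((z - x) * (ev th_diff_quot z - ev th_diff_quot 0) + x * (ev th_diff_quot z - ev th_diff_quot x))).
    assert (C2 := Cmod_triangle ((z - x) * (ev th_diff_quot z - ev th_diff_quot 0)) (x * (ev th_diff_quot z - ev th_diff_quot x))).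
    lra. }
  assert (HT0 : (Cmod (T 0) <= rho / 2)%R).
  { replace (T 0) with (/ 4 * k).
    - rewrite Cmod_mult, Cmod_inv, Cmod_R, Rabs_pos_eq by (try lra; intros H; injection H; lra); lra.
    - unfold T; replace (0 * 0) with (RtoC 0) by ring; rewrite ev_0.
      destruct th3sq_coefs as [-> _]; field. }
  destruct (contraction_fixed_point T rho Hrho) as [x [Hx E]]; auto.
  { intros x Hx; assert (H := HT 0 x ltac:(rewrite Cmod_0; lra) Hx).
    replace (x - 0) with x in H by ring.
    assert (H1 := Cmod_sub_ge (T x) (T 0)); lra. }
  exists x; assert (Hx1 : (Cmod x < 1)%R) by lra; split; auto.
  rewrite ev_ab_sub, ev_ab_add by auto; unfold T in E.
  transitivity (8 * x + x * (ev th_diff_quot x - 8)); [ring|]; rewrite <- E at 1; field.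
Qed.

(** * The arithmetic-geometric mean *)

(** M is the limit of the mean started at (A, B) and run along x, x^2, x^4, ..., since a and b tend
    to 1 at 0. *)
Definition theta_pair (A B : C) : Prop := exists M x : C, M <> 0 /\ x <> 0 /\ (Cmod x < 1)%R /\
  A = M * ev th3sq x /\ B = M * ev th4sq x.

Lemma C2_neq_0 : RtoC 2 <> 0.
Proof. intros H; injection H; lra. Qed.

Lemma Csqrt_ex (z : C) : exists w, w * w = z.
Proof.
  destruct (Ceq_dec z 0) as [->|Hz]; [exists 0; ring|].
  destruct (Cexp_surj z Hz) as [w Hw]; exists (Cexp (w / 2)).
  rewrite <- Cexp_add, <- Hw; f_equal; field.
Qed.

Lemma Ccbrt_ex (z : C) : z <> 0 -> exists w, w * w * w = z.
Proof.
  intros Hz; destruct (Cexp_surj z Hz) as [w Hw]; exists (Cexp (w / 3)).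
  rewrite <- !Cexp_add, <- Hw; f_equal; field.
Qed.

(** For a square root s of x, the sum and the product of A and B are those of M a(s) and M b(s), so
    the two pairs agree up to order; if the order is wrong, -s exchanges a and b. *)
Lemma theta_pair_descend A B A1 B1 : theta_pair A1 B1 -> A + B = 2 * A1 -> A * B = B1 * B1 ->
  theta_pair A B.
Proof.
  intros [M [x [HM [Hx0 [Hx [-> ->]]]]]] H1 H2.
  destruct (Csqrt_ex x) as [s <-].
  assert (Hs0 : s <> 0) by (intros ->; apply Hx0; ring).
  assert (Hs : (Cmod s < 1)%R).
  { rewrite Cmod_mult in Hx; assert (H := Cmod_ge_0 s); nra. }
  assert (E1 : A + B = M * ev th3sq s + M * ev th4sq s).
  { rewrite H1; transitivity (M * (2 * ev th3sq (s * s))); [ring|]; rewrite <- ev_ab_add by auto; ring. }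
  assert (E2 : A * B = (M * ev th3sq s) * (M * ev th4sq s)).
  { rewrite H2; transitivity (M * M * (ev th4sq (s * s) * ev th4sq (s * s))); [ring|].
    rewrite <- ev_ab_mul by auto; ring. }
  assert (E : (A - M * ev th3sq s) * (A - M * ev th4sq s) = 0).
  { transitivity (A * A - A * (M * ev th3sq s + M * ev th4sq s) + (M * ev th3sq s) * (M * ev th4sq s)); [ring|].
    rewrite <- E1, <- E2; ring. }
  apply Cmult_integral in E; destruct E as [E|E].
  - assert (EA : A = M * ev th3sq s) by (rewrite <- (Cplus_0_r (M * _)), <- E; ring).
    exists M, s; repeat split; auto.
    transitivity (A + B - A); [ring|]; rewrite E1, EA; ring.
  - assert (EA : A = M * ev th4sq s) by (rewrite <- (Cplus_0_r (M * _)), <- E; ring).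
    exists M, (- s); rewrite Cmod_opp, ev_th3sq_opp, ev_th4sq_opp; repeat split; auto.
    + intros H; apply Hs0; replace s with (- - s) by ring; rewrite H; ring.
    + transitivity (A + B - A); [ring|]; rewrite E1, EA; ring.
Qed.

(** [ab_local_inversion] adjusts the ratio, and M then fixes the scale. *)
Lemma theta_pair_small : exists k0, (0 < k0)%R /\ forall A B : C, A + B <> 0 -> A <> B ->
  (Cmod ((A - B) / (A + B)) < k0)%R -> theta_pair A B.
Proof.
  destruct ab_local_inversion as [k0 [Hk0 H]]; exists k0; split; auto.
  intros A B HAB Hne Hk; destruct (H _ Hk) as [x [Hx E]].
  assert (Hs : ev th3sq x + ev th4sq x <> 0).
  { rewrite ev_ab_add by auto; apply Cmult_neq_0; [apply C2_neq_0|].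
    apply ev_th3sq_neq_0, Cmod_sq_lt_1; auto. }
  exists ((A + B) / (ev th3sq x + ev th4sq x)), x.
  assert (HM : (A + B) / (ev th3sq x + ev th4sq x) <> 0).
  { intros Z; apply HAB; replace (A + B) with ((A + B) / (ev th3sq x + ev th4sq x) * (ev th3sq x + ev th4sq x)) by (field; auto).
    rewrite Z; ring. }
  assert (Ea : ev th3sq x = ((A - B) / (A + B) + 1) / 2 * (ev th3sq x + ev th4sq x)).
  { transitivity ((ev th3sq x - ev th4sq x + (ev th3sq x + ev th4sq x)) / 2); [field|]; rewrite E; field; auto. }
  assert (Eb : ev th4sq x = (1 - (A - B) / (A + B)) / 2 * (ev th3sq x + ev th4sq x)).
  { transitivity ((ev th3sq x + ev th4sq x - (ev th3sq x - ev th4sq x)) / 2); [field|]; rewrite E; field; auto. }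
  repeat split; auto.
  - intros ->; apply Hne; rewrite !ev_0 in E; destruct th3sq_coefs as [Ha _], th4sq_coefs as [Hb _].
    rewrite Ha, Hb in E.
    assert (Z : A - B = 0).
    { transitivity ((A - B) / (A + B) * (1 + 1) * ((A + B) / 2)); [field; auto|].
      rewrite <- E; field. }
    replace A with (A - B + B) by ring; rewrite Z; ring.
  - rewrite Ea at 2; field; auto.
  - rewrite Eb at 2; field; auto.
Qed.

(** For A = theta_3^2 and B = theta_4^2 this is k^2 = 1 - k'^2, the squared modulus of the elliptic
    integrals. *)
Definition kap (A B : C) : C := 1 - (B / A) * (B / A).

Lemma Cmod_1_plus (b : C) : (Cmod (1 + b) ^ 2 = 1 + 2 * Re b + Cmod b ^ 2)%R.
Proof. rewrite !Cmod2_alt; unfold Re, Im; simpl; ring. Qed.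

Lemma Cmod_1_minus (b : C) : (Cmod (1 - b) ^ 2 = 1 - 2 * Re b + Cmod b ^ 2)%R.
Proof. rewrite !Cmod2_alt; unfold Re, Im; simpl; ring. Qed.

Lemma Cmod_1_plus_ge (b : C) : (0 <= Re b)%R -> (1 <= Cmod (1 + b))%R.
Proof.
  intros H; assert (E := Cmod_1_plus b); assert (H1 := Cmod_ge_0 (1 + b)); assert (H2 := Cmod_ge_0 b).
  destruct (Rle_lt_dec 1 (Cmod (1 + b))); auto; exfalso; nra.
Qed.

Lemma agm_ratio (A B : C) : A <> 0 -> A + B <> 0 -> (A - B) / (A + B) = kap A B / ((1 + B / A) * (1 + B / A)).
Proof.
  intros HA HS; unfold kap; field; repeat split; auto.
Qed.

(** B1 is the square root of A B on the side of A1. The last equation is Landen's transformation,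
    from A1^2 - B1^2 = ((A - B) / 2)^2. *)
Lemma agm_step (A B : C) : A <> 0 -> B <> 0 -> A <> B -> A + B <> 0 -> exists A1 B1 : C,
  A1 <> 0 /\ B1 <> 0 /\ A1 <> B1 /\ A1 + B1 <> 0 /\ A + B = 2 * A1 /\ A * B = B1 * B1 /\
  (0 <= Re (B1 / A1))%R /\ kap A1 B1 = (A - B) / (A + B) * ((A - B) / (A + B)).
Proof.
  intros HA HB Hne HS.
  destruct (Csqrt_ex (A * B)) as [b Hb].
  set (A1 := (A + B) / 2).
  assert (HA1 : A1 <> 0).
  { intros Z; apply HS; replace (A + B) with (2 * A1) by (unfold A1; field); rewrite Z; ring. }
  assert (Hs : exists B1, B1 * B1 = A * B /\ (0 <= Re (B1 / A1))%R).
  { destruct (Rle_lt_dec 0 (Re (b / A1))) as [H|H]; [exists b; auto|].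
    exists (- b); split; [rewrite <- Hb; ring|].
    replace (- b / A1) with (- (b / A1)) by (field; auto); unfold Re in *; simpl in *; lra. }
  destruct Hs as [B1 [HB1 Hre]].
  assert (Hsq : (A1 - B1) * (A1 + B1) = (A - B) / 2 * ((A - B) / 2)).
  { transitivity (A1 * A1 - B1 * B1); [ring|]; rewrite HB1; unfold A1; field. }
  assert (Hnz : (A - B) / 2 * ((A - B) / 2) <> 0).
  { assert ((A - B) / 2 <> 0); [|apply Cmult_neq_0; auto].
    intros Z; apply Hne; replace A with (2 * ((A - B) / 2) + B) by field; rewrite Z; ring. }
  exists A1, B1; repeat split; auto.
  - intros Z; rewrite Z in HB1; symmetry in HB1; replace (0 * 0) with (RtoC 0) in HB1 by ring.
    apply Cmult_integral in HB1; tauto.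
  - intros Z; apply Hnz; rewrite <- Hsq, Z; ring.
  - intros Z; apply Hnz; rewrite <- Hsq, Z; ring.
  - unfold A1; field.
  - unfold kap; replace (1 - B1 / A1 * (B1 / A1)) with ((A1 * A1 - B1 * B1) / (A1 * A1)) by (field; auto).
    rewrite HB1; unfold A1; field; auto.
Qed.

(** For b = B / A with Re b >= 0 one has |1 - b| <= |1 + b| and |1 + b| >= 1, strictly if b <> 0;
    the quotient is (1 - b) / (1 + b) = [kap] / (1 + b)^2. *)
Lemma re_nonneg_facts (A B : C) : A <> 0 -> A + B <> 0 -> (0 <= Re (B / A))%R ->
  (Cmod ((A - B) / (A + B)) <= 1)%R /\ (Cmod ((A - B) / (A + B)) <= Cmod (kap A B))%R /\
  (B <> 0 -> kap A B <> 0 -> (Cmod ((A - B) / (A + B)) < Cmod (kap A B))%R).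
Proof.
  intros HA HS H.
  assert (Hnz : 1 + B / A <> 0).
  { intros Z; apply HS; replace (A + B) with (A * (1 + B / A)) by (field; auto); rewrite Z; ring. }
  assert (H1 := Cmod_1_plus_ge _ H).
  assert (H0 := Cmod_ge_0 (kap A B)).
  assert (E : Cmod ((A - B) / (A + B)) = (Cmod (kap A B) / (Cmod (1 + B / A) * Cmod (1 + B / A)))%R).
  { rewrite agm_ratio, Cmod_div, Cmod_mult by (auto using Cmult_neq_0); auto. }
  split; [|split].
  - replace ((A - B) / (A + B)) with ((1 - B / A) / (1 + B / A)) by (field; repeat split; auto).
    rewrite Cmod_div by auto; apply Rle_div_l; [lra|].
    assert (E1 := Cmod_1_plus (B / A)); assert (E2 := Cmod_1_minus (B / A)).
    assert (H2 := Cmod_ge_0 (1 - B / A)).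
    destruct (Rle_lt_dec (Cmod (1 - B / A)) (Cmod (1 + B / A))) as [Hle|Hlt]; [lra|exfalso].
    assert (Cmod (1 + B / A) ^ 2 < Cmod (1 - B / A) ^ 2)%R by (simpl; nra).
    lra.
  - assert (Hm : (1 <= Cmod (1 + B / A) * Cmod (1 + B / A))%R) by nra.
    rewrite E; apply Rle_div_l; [lra|].
    rewrite <- (Rmult_1_r (Cmod (kap A B))) at 1; apply Rmult_le_compat_l; lra.
  - intros HB Hk; rewrite E; apply Rlt_div_l; [nra|].
    apply Cmod_gt_0 in Hk.
    assert (HBA : (0 < Cmod (B / A))%R).
    { apply Cmod_gt_0; intros Z; apply HB; replace B with (B / A * A) by (field; auto); rewrite Z; ring. }
    assert (E1 := Cmod_1_plus (B / A)).
    assert (Hm : (1 < Cmod (1 + B / A) * Cmod (1 + B / A))%R).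
    { replace (Cmod (1 + B / A) * Cmod (1 + B / A))%R with (Cmod (1 + B / A) ^ 2)%R by ring.
      rewrite E1; nra. }
    rewrite <- (Rmult_1_r (Cmod (kap A B))) at 1; apply Rmult_lt_compat_l; lra.
Qed.

Lemma kap_neq_0 (A B : C) : A <> 0 -> A <> B -> A + B <> 0 -> kap A B <> 0.
Proof.
  intros HA Hne HS Z; assert (E : (A - B) * (A + B) = 0).
  { transitivity (kap A B * (A * A)); [unfold kap; field; auto|rewrite Z; ring]. }
  apply Cmult_integral in E; destruct E as [E|E]; auto.
  apply Hne; replace A with (A - B + B) by ring; rewrite E; ring.
Qed.

(* When 0 <= Re (B / A), one step of the mean at least squares |kap|, so that kap tends to 0
   as soon as it has been made smaller than 1 in modulus. *)
Lemma agm_theta_pair (A B : C) : A <> 0 -> B <> 0 -> A <> B -> A + B <> 0 -> (0 <= Re (B / A))%R ->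
  theta_pair A B.
Proof.
  destruct theta_pair_small as [k0 [Hk0 Hsmall]].
  assert (Hiter : forall q, (0 <= q < 1)%R -> forall (n : nat) (A B : C), A <> 0 -> B <> 0 -> A <> B -> A + B <> 0 ->
    (0 <= Re (B / A))%R -> (Cmod (kap A B) <= q)%R -> (Cmod (kap A B) * q ^ n < k0)%R -> theta_pair A B).
  { intros q Hq n; induction n as [|n IH]; intros A' B' HA HB Hne HS Hre Hk Hn;
      destruct (re_nonneg_facts A' B' HA HS Hre) as [F1 [F2 _]].
    - apply Hsmall; auto; simpl in Hn; lra.
    - destruct (agm_step A' B' HA HB Hne HS) as [A1 [B1 [HA1 [HB1 [Hne1 [HS1 [E1 [E2 [Hre1 Ek]]]]]]]]].
      apply (theta_pair_descend A' B' A1 B1); auto.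
      assert (Hk1 : (Cmod (kap A1 B1) <= q * Cmod (kap A' B'))%R).
      { rewrite Ek, Cmod_mult; apply Rmult_le_compat; try apply Cmod_ge_0; lra. }
      assert (G := Cmod_ge_0 (kap A' B')).
      apply IH; auto; [nra|].
      eapply Rle_lt_trans; [apply Rmult_le_compat_r; [apply pow_le; lra|apply Hk1]|].
      simpl in Hn; lra. }
  intros HA HB Hne HS Hre.
  (* [Hiter] needs a bound q < 1. One step gives |kap| <= 1, a second one |kap| < 1. *)
  destruct (agm_step A B HA HB Hne HS) as [A1 [B1 [HA1 [HB1 [Hne1 [HS1 [E1 [E2 [Hre1 Ek1]]]]]]]]].
  apply (theta_pair_descend A B A1 B1); auto.
  destruct (agm_step A1 B1 HA1 HB1 Hne1 HS1) as [A2 [B2 [HA2 [HB2 [Hne2 [HS2 [E3 [E4 [Hre2 Ek2]]]]]]]]].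
  apply (theta_pair_descend A1 B1 A2 B2); auto.
  destruct (re_nonneg_facts A B HA HS Hre) as [F1 _].
  destruct (re_nonneg_facts A1 B1 HA1 HS1 Hre1) as [_ [_ F3]].
  specialize (F3 HB1 (kap_neq_0 _ _ HA1 Hne1 HS1)).
  assert (K1 : (Cmod (kap A1 B1) <= 1)%R).
  { rewrite Ek1, Cmod_mult; assert (H := Cmod_ge_0 ((A - B) / (A + B))); nra. }
  assert (K2 : (Cmod (kap A2 B2) < 1)%R).
  { rewrite Ek2, Cmod_mult; assert (H := Cmod_ge_0 ((A1 - B1) / (A1 + B1))); nra. }
  set (q := Cmod (kap A2 B2)) in *; assert (Hq : (0 <= q)%R) by apply Cmod_ge_0.
  destruct (pow_lt_1_zero q) with k0 as [N HN]; auto; [rewrite Rabs_pos_eq; auto|].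
  specialize (HN N (Nat.le_refl N)); rewrite Rabs_pos_eq in HN by (apply pow_le; auto).
  apply (Hiter q) with N; auto; [unfold q; lra|fold q].
  assert (0 <= q ^ N)%R by (apply pow_le; auto); nra.
Qed.

(* X + Y, Y - 2 X and X - 2 Y are the roots of u^3 - 3 Q u - 2 R, given by Cardano's formula. *)
Lemma eis_surj (Q R : C) : Q ^ 3 <> R ^ 2 -> exists X Y : C, X <> 0 /\ Y <> 0 /\ X <> Y /\
  eisQ X Y = Q /\ eisR X Y = R.
Proof.
  intros HD.
  (* The sign of the root is chosen so that s below is non-zero and Q / s makes sense; if both signs
     failed, R^2 and Q^3 would both be 0. *)
  assert (Hw : exists w, w * w = R ^ 2 - Q ^ 3 /\ R + w <> 0).
  { destruct (Csqrt_ex (R ^ 2 - Q ^ 3)) as [w Hw].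
    destruct (Ceq_dec (R + w) 0) as [Z|Z]; [|exists w; auto].
    exists (- w); split; [rewrite <- Hw; ring|]; intros Z'.
    apply HD; replace (R ^ 2) with (((R + w + (R + - w)) / 2) ^ 2) by field.
    replace (Q ^ 3) with (R ^ 2 - w * w) by (rewrite Hw; ring).
    replace (R ^ 2 - w * w) with ((R + w) * (R + - w)) by ring; rewrite Z, Z'; field. }
  destruct Hw as [w [Hw Hne]].
  destruct (Ccbrt_ex _ Hne) as [s Hs].
  assert (Hs0 : s <> 0) by (intros ->; apply Hne; rewrite <- Hs; ring).
  destruct (Csqrt_ex (-3)) as [r Hr].
  (* A primitive cube root of unity. *)
  set (om := (-1 + r) / 2).
  assert (Hom : om * om = -1 - om).
  { transitivity ((1 - 2 * r + r * r) / 4); [unfold om; field|rewrite Hr; unfold om; field]. }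
  clearbody om.
  set (p := Q / s).
  assert (Hsp : s * p = Q) by (unfold p; field; auto).
  assert (Hp3 : p * p * p = R - w).
  { transitivity (Q ^ 3 / (R + w)); [rewrite <- Hs; unfold p; field; auto|].
    replace (Q ^ 3) with (R ^ 2 - w * w) by (rewrite Hw; ring); field; auto. }
  clearbody p.
  set (X := ((1 - om) * s + (2 + om) * p) / 3).
  set (Y := ((2 + om) * s + (1 - om) * p) / 3).
  assert (EQ : eisQ X Y = Q).
  { rewrite <- Hsp; unfold eisQ, X, Y; field_simplify_eq.
    replace (om ^ 2) with (-1 - om) by (rewrite <- Hom; ring). ring. }
  assert (ER : eisR X Y = R).
  { transitivity ((s * s * s + p * p * p) / 2); [|rewrite Hs, Hp3; field].
    unfold eisR, X, Y; field_simplify_eq.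
    replace (om ^ 3) with (RtoC 1)
      by (symmetry; transitivity (om * (om * om)); [ring|]; rewrite Hom; transitivity (- om - om * om); [ring|rewrite Hom; ring]).
    replace (om ^ 2) with (-1 - om) by (rewrite <- Hom; ring). ring. }
  (* The discriminant of the cubic: Q^3 <> R^2 means exactly that X and Y are non-zero and
     distinct. *)
  assert (Hdisc : 4 * (Q ^ 3 - R ^ 2) = 27 * (X * X * Y * Y * (X - Y) * (X - Y))).
  { rewrite <- EQ, <- ER; unfold eisQ, eisR; field. }
  assert (Hnz : 4 * (Q ^ 3 - R ^ 2) <> 0).
  { apply Cmult_neq_0; [intros H; injection H; lra|].
    intros Z; apply HD; replace (Q ^ 3) with (Q ^ 3 - R ^ 2 + R ^ 2) by ring; rewrite Z; ring. }
  exists X, Y; repeat split; auto; intros Z; apply Hnz; rewrite Hdisc, Z; ring.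
Qed.

(** In substance the surjectivity of the j-invariant. The sign of B is free, as only A^2 = X and B^2
    = Y are prescribed, and is used to obtain Re (B / A) >= 0. *)
Lemma E4_E6_surj (Q R : C) : Q ^ 3 <> R ^ 2 -> exists M t : C, M <> 0 /\ upper_half_plane t /\
  Q = M ^ 4 * eisQ (thA t * thA t) (thB t * thB t) /\
  R = M ^ 6 * eisR (thA t * thA t) (thB t * thB t).
Proof.
  intros HD; destruct (eis_surj Q R HD) as [X [Y [HX [HY [HXY [<- <-]]]]]].
  destruct (Csqrt_ex X) as [A HA]; destruct (Csqrt_ex Y) as [B0 HB0].
  assert (HA0 : A <> 0) by (intros ->; apply HX; rewrite <- HA; ring).
  assert (HB : exists B, B * B = Y /\ (0 <= Re (B / A))%R).
  { destruct (Rle_lt_dec 0 (Re (B0 / A))) as [H|H]; [exists B0; auto|].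
    exists (- B0); split; [rewrite <- HB0; ring|].
    replace (- B0 / A) with (- (B0 / A)) by (field; auto); unfold Re in *; simpl in *; lra. }
  destruct HB as [B [HB Hre]].
  assert (HBn : B <> 0) by (intros ->; apply HY; rewrite <- HB; ring).
  destruct (agm_theta_pair A B) as [M [x [HM [Hx0 [Hx [EA EB]]]]]]; auto.
  - intros ->; apply HXY; congruence.
  - intros Z; apply HXY; rewrite <- HA, <- HB; replace A with (A + B - B) by ring; rewrite Z; ring.
  - destruct (nome_surj x Hx0 Hx) as [t [Ht Et]].
    exists M, t; repeat split; auto; unfold thA, thB; rewrite Et, <- HA, <- HB, EA, EB;
      unfold eisQ, eisR; field.
Qed.

(** Q^3 - R^2 is 27/4 times the square of A^2 B^2 (A^2 - B^2), and none of these factors vanishes in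
    the disc away from 0. *)
Lemma E4_E6_disc t : upper_half_plane t ->
  eisQ (thA t * thA t) (thB t * thB t) ^ 3 <> eisR (thA t * thA t) (thB t * thB t) ^ 2.
Proof.
  intros Ht E; assert (Hx := nome_lt_1 t Ht).
  assert (HA : thA t <> 0) by (apply ev_th3sq_neq_0; auto).
  assert (HB : thB t <> 0) by (apply ev_th4sq_neq_0; auto).
  assert (HAB : thA t - thB t <> 0).
  { intros Z; apply (ev_ab_sub_neq_0 (nome t)); auto; [apply nome_neq_0|].
    fold (thA t) (thB t); replace (thA t) with (thA t - thB t + thB t) by ring; rewrite Z; ring. }
  assert (HS : thA t + thB t <> 0).
  { unfold thA, thB; rewrite ev_ab_add by auto; apply Cmult_neq_0; [apply C2_neq_0|].
    apply ev_th3sq_neq_0, Cmod_sq_lt_1; auto. }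
  set (A := thA t) in *; set (B := thB t) in *.
  assert (Z : (A * A * B * B * (A - B) * (A + B)) * (A * A * B * B * (A - B) * (A + B)) = 0).
  { transitivity (4 / 27 * (eisQ (A * A) (B * B) ^ 3 - eisR (A * A) (B * B) ^ 2)).
    - unfold eisQ, eisR; field.
    - rewrite E; ring. }
  revert Z; repeat apply Cmult_neq_0; auto.
Qed.

Open Scope C_scope.

(** * Connected open sets *)

Lemma locally_constant_R (f : R -> R) :
  (forall x, exists d, (0 < d)%R /\ forall y, (Rabs (y - x) < d)%R -> f y = f x) ->
  forall x y, f x = f y.
Proof.
  intros H.
  assert (Hd : forall x, is_derive f x 0).
  { intros x; destruct (H x) as [d [Hd0 Hd]].
    apply (is_derive_ext_loc (fun _ => f x)).
    - exists (mkposreal d Hd0); intros y Hy; symmetry; apply Hd; exact Hy.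
    - apply (is_derive_const (K := R_AbsRing) (V := R_NormedModule)). }
  intros x y; destruct (MVT_gen f x y (fun _ => 0)) as [c [_ E]].
  - intros; apply Hd.
  - intros z _; apply continuity_pt_filterlim.
    apply (ex_derive_continuous (K := R_AbsRing) (V := R_NormedModule)); eexists; apply Hd.
  - lra.
Qed.

Definition segpt (p q : C) (s : R) : C := p + RtoC s * (q - p).

(** Extends functions on [0, 1] to the whole line, where [locally_constant_R] applies without a
    special treatment of the endpoints. *)
Definition clamp (s : R) : R := Rmax 0 (Rmin 1 s).

Lemma clamp_bounds s : (0 <= clamp s <= 1)%R.
Proof. unfold clamp, Rmax, Rmin; destruct (Rle_dec 1 s), (Rle_dec 0 _); lra. Qed.

Lemma clamp_lip s t : (Rabs (clamp s - clamp t) <= Rabs (s - t))%R.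
Proof.
  unfold clamp, Rmax, Rmin, Rabs.
  destruct (Rle_dec 1 s), (Rle_dec 1 t); repeat destruct (Rle_dec 0 _); repeat destruct (Rcase_abs _); lra.
Qed.

(** The indicator function of V along the clamped segment is locally constant. *)
Lemma segment_connected (V W : C -> Prop) (p q : C) : open V -> open W ->
  (forall s, (0 <= s <= 1)%R -> V (segpt p q s) \/ W (segpt p q s)) ->
  (forall s, (0 <= s <= 1)%R -> V (segpt p q s) -> W (segpt p q s) -> False) ->
  V p -> V q.
Proof.
  intros HV HW Hc Hd Hp.
  assert (Hex : exists f : R -> R, forall s, (V (segpt p q (clamp s)) -> f s = 1%R) /\
     (W (segpt p q (clamp s)) -> f s = 0%R)).
  { exists (fun s => if excluded_middle_informative (V (segpt p q (clamp s))) then 1%R else 0%R).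
    intros s; destruct (excluded_middle_informative _) as [H|H]; split; auto; intros H'.
    - exfalso; apply (Hd (clamp s)); auto using clamp_bounds.
    - contradiction. }
  destruct Hex as [f Hf].
  assert (Hopen : forall (O : C -> Prop) s, open O -> O (segpt p q (clamp s)) ->
    exists d, (0 < d)%R /\ forall y, (Rabs (y - s) < d)%R -> O (segpt p q (clamp y))).
  { intros O s HO Hs; destruct (proj1 (open_eps O) HO _ Hs) as [d [Hd0 Hd1]].
    assert (Hm := Cmod_ge_0 (q - p)).
    exists (d / (Cmod (q - p) + 1))%R; split; [apply Rdiv_lt_0_compat; lra|].
    intros y Hy; apply Hd1; unfold segpt.
    replace (p + clamp y * (q - p) - (p + clamp s * (q - p))) with (RtoC (clamp y - clamp s) * (q - p))
      by (rewrite RtoC_minus; ring).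
    rewrite Cmod_mult, Cmod_R.
    assert (H1 := clamp_lip y s); assert (H2 := Rabs_pos (clamp y - clamp s)).
    apply Rlt_div_r in Hy; [|lra].
    eapply Rle_lt_trans; [|apply Hy]; apply Rmult_le_compat; lra. }
  assert (Hconst := locally_constant_R f).
  assert (E : f 0%R = f 1%R).
  { apply Hconst; intros s; destruct (Hc (clamp s) (clamp_bounds s)) as [H|H].
    - destruct (Hopen V s HV H) as [d [Hd0 Hd1]]; exists d; split; auto.
      intros y Hy; rewrite (proj1 (Hf s) H); apply Hf; auto.
    - destruct (Hopen W s HW H) as [d [Hd0 Hd1]]; exists d; split; auto.
      intros y Hy; rewrite (proj2 (Hf s) H); apply Hf; auto. }
  assert (C0 : clamp 0 = 0%R) by (unfold clamp, Rmax, Rmin; destruct (Rle_dec 1 0), (Rle_dec 0 _); lra).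
  assert (C1 : clamp 1 = 1%R) by (unfold clamp, Rmax, Rmin; destruct (Rle_dec 1 1), (Rle_dec 0 _); lra).
  assert (F0 : f 0%R = 1%R).
  { apply Hf; rewrite C0; unfold segpt; replace (p + 0 * (q - p)) with p by ring; auto. }
  assert (S1 : segpt p q 1 = q) by (unfold segpt; ring).
  destruct (Hc 1%R ltac:(lra)) as [H|H]; rewrite S1 in H; auto.
  exfalso; assert (F1 : f 1%R = 0%R) by (apply Hf; rewrite C1, S1; auto); lra.
Qed.

Lemma convex_connected (U : C -> Prop) :
  (forall p q s, U p -> U q -> (0 <= s <= 1)%R -> U (segpt p q s)) -> connected U.
Proof.
  intros HU V W HV HW Hc [p [Hp Vp]] [q [Hq Wq]]; apply NNPP; intros Hn.
  apply Hn; exists q; repeat split; auto.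
  apply (segment_connected V W p q); auto.
  intros s Hs H1 H2; apply Hn; exists (segpt p q s); auto.
Qed.

Definition disk (t : C) (r : R) (z : C) : Prop := (Cmod (z - t) < r)%R.

Lemma disk_open t r : open (disk t r).
Proof.
  apply open_eps; intros z Hz; exists (r - Cmod (z - t))%R; unfold disk in *; split; [lra|].
  intros w Hw; assert (H := Cmod_tri_sub w z t); lra.
Qed.

Lemma disk_convex t r p q s : disk t r p -> disk t r q -> (0 <= s <= 1)%R -> disk t r (segpt p q s).
Proof.
  unfold disk, segpt; intros Hp Hq Hs.
  replace (p + s * (q - p) - t) with ((RtoC (1 - s)) * (p - t) + RtoC s * (q - t)) by (rewrite RtoC_minus; ring).
  eapply Rle_lt_trans; [apply Cmod_triangle|].
  rewrite !Cmod_mult, !Cmod_R, !Rabs_pos_eq by lra.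
  destruct (Req_dec s 0) as [->|Hs0]; [lra|].
  assert (s * Cmod (q - t) < s * r)%R by (apply Rmult_lt_compat_l; lra).
  assert ((1 - s) * Cmod (p - t) <= (1 - s) * r)%R by (apply Rmult_le_compat_l; lra).
  lra.
Qed.

Lemma disk_center t r : (0 < r)%R -> disk t r t.
Proof. unfold disk; replace (t - t) with (RtoC 0) by ring; rewrite Cmod_0; auto. Qed.

Lemma disk_other_point t r : (0 < r)%R -> exists q, disk t r q /\ q <> t.
Proof.
  intros Hr; exists (t + RtoC (r / 2)); split.
  - unfold disk; replace (t + RtoC (r / 2) - t) with (RtoC (r / 2)) by ring.
    rewrite Cmod_R, Rabs_pos_eq; lra.
  - intros E; assert (Z : RtoC (r / 2) = 0) by (transitivity (t + RtoC (r / 2) - t); [ring|rewrite E; ring]).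
    injection Z; lra.
Qed.

Lemma disk_domain t r : (0 < r)%R -> domain (disk t r).
Proof.
  intros Hr; split; [exists t; apply disk_center; auto|split; [apply disk_open|]].
  apply convex_connected; intros; apply disk_convex; auto.
Qed.

Lemma full_domain : domain (fun _ : C => True).
Proof.
  split; [exists 0; auto|split].
  - apply open_eps; intros t _; exists 1%R; split; [lra|auto].
  - apply convex_connected; auto.
Qed.

Lemma upper_domain : domain upper_half_plane.
Proof.
  split; [exists Ci; unfold upper_half_plane, Ci, Im; simpl; lra|split; [apply open_upper|]].
  apply convex_connected; unfold upper_half_plane, segpt; intros p q s Hp Hq Hs.
  replace (Im (p + s * (q - p))) with ((1 - s) * Im p + s * Im q)%R by (unfold Im; simpl; ring).
  destruct (Req_dec s 0) as [->|Hs0]; [lra|]; assert (0 < s * Im q)%R by (apply Rmult_lt_0_compat; lra).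
  assert (0 <= (1 - s) * Im p)%R by (apply Rmult_le_pos; lra); lra.
Qed.

Lemma E2_chazy : chazy E2_sol.
Proof. apply E2_chazy_gen, upper_domain. Qed.

Lemma open_ne (p : C) : open (fun z => z <> p).
Proof.
  apply open_eps; intros t Ht; exists (Cmod (t - p)); split.
  - apply Cmod_gt_0; intros Z; apply Ht, Csub_eq; auto.
  - intros z Hz ->; rewrite Cmod_sub_sym in Hz; lra.
Qed.

Lemma segpt_ratio (p a b : C) s : segpt a b s = p ->
  (b - p) * RtoC s = - ((a - p) * RtoC (1 - s)).
Proof.
  intros E; unfold segpt in E; rewrite RtoC_minus.
  transitivity (a + RtoC s * (b - a) - p - (a - p) * (1 - RtoC s)); [ring|rewrite E; ring].
Qed.

(* If p lies on the segment [a, b], go through a point at a right angle. *)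
Lemma punctured_disk_connected (V W : C -> Prop) (p : C) (r : R) : open V -> open W ->
  (forall z, disk p r z -> z <> p -> V z \/ W z) ->
  (forall z, disk p r z -> z <> p -> V z -> W z -> False) ->
  forall a b, disk p r a -> a <> p -> disk p r b -> b <> p -> V a -> V b.
Proof.
  intros HV HW Hc Hd.
  assert (Hseg : forall a b, disk p r a -> disk p r b ->
    (forall s, (0 <= s <= 1)%R -> segpt a b s <> p) -> V a -> V b).
  { intros a b Ha Hb Hav Va; apply (segment_connected V W a b); auto;
    intros s Hs; [apply Hc|apply (Hd (segpt a b s))]; auto using disk_convex. }
  intros a b Ha Ha0 Hb Hb0 Va.
  destruct (classic (exists s, (0 <= s <= 1)%R /\ segpt a b s = p)) as [[s [Hs Es]]|Hn].
  2:{ apply (Hseg a b); auto; intros s Hs E; apply Hn; eauto. }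
  assert (Hap : a - p <> 0) by (intros Z; apply Ha0; replace a with (a - p + p) by ring; rewrite Z; ring).
  assert (Hbp : b - p <> 0) by (intros Z; apply Hb0; replace b with (b - p + p) by ring; rewrite Z; ring).
  (* As p lies on [a, b], b - p is a real multiple of a - p. In units of a - p the point m is i and
     b is real, so the real and imaginary parts show that the new segments avoid p. *)
  assert (Hreal : exists k : R, b - p = RtoC k * (a - p)).
  { assert (E := segpt_ratio p a b s Es).
    assert (Hs0 : RtoC s <> 0).
    { intros Z; injection Z; intros; subst s; revert E; replace (1 - 0)%R with 1%R by ring; intros E.
      apply Hap; transitivity (- - ((a - p) * 1)); [ring|rewrite <- E; ring]. }
    assert (s <> 0%R) by (intros ->; apply Hs0; auto).
    exists (- (1 - s) / s)%R; rewrite RtoC_div, RtoC_opp by auto.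
    transitivity ((b - p) * RtoC s / RtoC s); [field; auto|rewrite E; field; auto]. }
  destruct Hreal as [k Hk].
  assert (Hk0 : k <> 0%R) by (intros ->; apply Hbp; rewrite Hk; ring).
  set (m := p + Ci * (a - p)).
  assert (Hm : disk p r m).
  { unfold disk, m; replace (p + Ci * (a - p) - p) with (Ci * (a - p)) by ring.
    rewrite Cmod_mult, Cmod_Ci, Rmult_1_l; auto. }
  assert (Hlin : forall x y : R, (RtoC x + Ci * RtoC y) * (a - p) = 0 -> x = 0%R /\ y = 0%R).
  { intros x y E; apply Cmult_integral in E; destruct E as [E|E]; [|contradiction].
    unfold Cplus, Cmult, Ci, RtoC in E; simpl in E; injection E; intros; split; lra. }
  apply (Hseg m b); auto.
  - intros u Hu E; destruct (Hlin (u * k)%R (1 - u)%R) as [X1 X2].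
    { transitivity (segpt m b u - p); [|rewrite E; ring].
      unfold segpt; replace b with (b - p + p) by ring; rewrite Hk; unfold m.
      rewrite RtoC_mult, RtoC_minus; ring. }
    assert (u = 1%R) by lra; subst u; lra.
  - apply (Hseg a m); auto.
    intros u Hu E; destruct (Hlin (1 - u)%R u) as [X1 X2]; [|lra].
    transitivity (segpt a m u - p); [|rewrite E; ring].
    unfold segpt, m; rewrite RtoC_minus; ring.
Qed.

(** A Moebius map with c <> 0 never takes the value a / c, so the action of SL2 leads to domains
    without one point. *)
Lemma punctured_domain (U : C -> Prop) (p : C) : domain U -> domain (fun z => U z /\ z <> p).
Proof.
  intros [[t0 Ht0] [HO HC]].
  assert (HO' : open (fun z => U z /\ z <> p)) by (apply open_and; auto using open_ne).
  split; [|split; auto].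
  - destruct (classic (t0 = p)) as [->|H]; [|exists t0; auto].
    destruct (proj1 (open_eps U) HO p Ht0) as [d [Hd0 Hd]].
    destruct (disk_other_point p d Hd0) as [q [Hq Hqp]]; exists q; auto.
  - intros V W HV HW Hc HmV HmW; apply NNPP; intros Hn.
    destruct (classic (U p)) as [HUp|HUp].
    2:{ destruct (HC V W HV HW) as [z [H1 [H2 H3]]].
        - intros z Hz; apply Hc; split; auto; intros ->; auto.
        - destruct HmV as [z [[? ?] ?]]; exists z; auto.
        - destruct HmW as [z [[? ?] ?]]; exists z; auto.
        - apply Hn; exists z; repeat split; auto; intros ->; auto. }
    destruct (proj1 (open_eps U) HO p HUp) as [r [Hr0 Hr]].
    destruct (disk_other_point p r Hr0) as [q [Hq Hqp]].
    (* If V meets the punctured disc around p it fills it; then V together with the disc, and W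
       without p, would separate U itself. *)
    assert (Key : forall V W : C -> Prop, open V -> open W ->
      (forall z, U z /\ z <> p -> V z \/ W z) -> meets (fun z => U z /\ z <> p) W ->
      (forall z, U z -> z <> p -> V z -> W z -> False) -> V q -> False).
    { clear V W HV HW Hc HmV HmW Hn; intros V W HV HW Hc HmW Hn Vq.
      assert (Hall : forall z, disk p r z -> z <> p -> V z).
      { intros z Hz Hzp; apply (punctured_disk_connected V W p r) with q; auto.
        intros w Hw Hwp; apply Hn; auto. }
      destruct (HC (fun z => V z \/ disk p r z) (fun z => W z /\ z <> p)) as [z [H1 [H2 [H3 H4]]]].
      - apply open_or; auto using disk_open.
      - apply open_and; auto using open_ne.
      - intros z Hz; destruct (classic (z = p)) as [->|Hzp].
        + left; right; apply disk_center; auto.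
        + destruct (Hc z (conj Hz Hzp)); auto.
      - exists q; auto.
      - destruct HmW as [z [[? ?] ?]]; exists z; auto.
      - apply (Hn z); auto; destruct H2; auto. }
    destruct (Hc q (conj (Hr q Hq) Hqp)) as [H|H].
    + apply (Key V W); auto; intros z H1 H2 H3 H4; apply Hn; exists z; auto.
    + apply (Key W V); auto.
      * intros z Hz; destruct (Hc z Hz); auto.
      * intros z H1 H2 H3 H4; apply Hn; exists z; auto.
Qed.

(** * Local uniqueness *)

(** exp (- K s) N(s) does not increase and starts at 0. *)
Lemma gronwall_zero (N N' : R -> R) (K : R) :
  (forall s, (0 <= s <= 1)%R -> is_derive N s (N' s)) ->
  (forall s, (0 <= s <= 1)%R -> (N' s <= K * N s)%R) ->
  (forall s, (0 <= N s)%R) -> N 0%R = 0%R -> N 1%R = 0%R.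
Proof.
  intros HD HK Hpos H0.
  set (M := fun s => (exp (- K * s) * N s)%R).
  set (M' := fun s => (exp (- K * s) * (N' s - K * N s))%R).
  assert (HM : forall s, (0 <= s <= 1)%R -> is_derive M s (M' s)).
  { intros s Hs; specialize (HD s Hs).
    assert (He : is_derive (fun s => exp (- K * s)) s (- K * exp (- K * s))%R) by (auto_derive; auto; ring).
    assert (H := is_derive_mult (K := R_AbsRing) _ _ _ _ _ He HD Rmult_comm).
    unfold M, M'; eapply (eq_ind _ (is_derive _ s)); [exact H|].
    unfold plus, mult; simpl; ring. }
  destruct (MVT_gen M 0 1 M') as [c [Hc E]].
  - intros x Hx; rewrite Rmin_left, Rmax_right in Hx by lra; apply HM; lra.
  - intros x Hx; rewrite Rmin_left, Rmax_right in Hx by lra; apply continuity_pt_filterlim.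
    apply (ex_derive_continuous (K := R_AbsRing) (V := R_NormedModule)); eexists; apply HM; lra.
  - rewrite Rmin_left, Rmax_right in Hc by lra.
    specialize (HK c Hc); assert (He := exp_pos (- K * c)).
    assert (M' c <= 0)%R by (unfold M'; nra).
    unfold M in E; rewrite H0 in E; assert (He1 := exp_pos (- K * 1)); specialize (Hpos 1%R).
    destruct (Req_dec (N 1%R) 0) as [Z|Z]; auto; exfalso.
    assert (0 < exp (- K * 1) * N 1%R)%R by (apply Rmult_lt_0_compat; lra); lra.
Qed.

Lemma cder_along_line (f : C -> C) (t h l : C) (s : R) : cder f (t + RtoC s * h)%C l ->
  is_derive (fun s => Re (f (t + RtoC s * h)%C)) s (Re (l * h)%C) /\
  is_derive (fun s => Im (f (t + RtoC s * h)%C)) s (Im (l * h)%C).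
Proof.
  intros H.
  assert (Key : forall eps, (0 < eps)%R -> exists d, (0 < d)%R /\ forall k, k <> 0%R -> (Rabs k < d)%R ->
    (Cmod (f (t + RtoC (s + k) * h)%C - f (t + RtoC s * h)%C - RtoC k * (l * h)) < eps * Rabs k)%R).
  { intros eps He; assert (Hh := Cmod_ge_0 h).
    destruct (proj1 (cder_eps _ _ _) H (eps / (Cmod h + 1))%R) as [d [Hd0 Hd]].
    { apply Rdiv_lt_0_compat; lra. }
    exists (d / (Cmod h + 1))%R; split; [apply Rdiv_lt_0_compat; lra|].
    intros k Hk0 Hk; apply Rlt_div_r in Hk; [|lra]; assert (Hkp := Rabs_pos_lt k Hk0).
    assert (Eh : t + RtoC (s + k) * h - (t + RtoC s * h)%C = RtoC k * h) by (rewrite RtoC_plus; ring).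
    specialize (Hd (t + RtoC (s + k) * h)%C); rewrite Eh, Cmod_mult, Cmod_R in Hd.
    replace (RtoC k * (l * h)) with (l * (RtoC k * h)) by ring.
    eapply Rle_lt_trans; [apply Hd; nra|].
    replace (eps / (Cmod h + 1) * (Rabs k * Cmod h))%R with (eps * Rabs k * (Cmod h / (Cmod h + 1)))%R by (field; lra).
    rewrite <- (Rmult_1_r (eps * Rabs k)) at 2; apply Rmult_lt_compat_l; [nra|].
    apply Rlt_div_l; lra. }
  split; apply is_derive_Reals; intros eps He; destruct (Key eps He) as [d [Hd0 Hd]];
    exists (mkposreal d Hd0); intros k Hk0 Hk; specialize (Hd k Hk0 Hk); assert (Hkp := Rabs_pos_lt k Hk0).
  - replace ((Re (f (t + RtoC (s + k) * h)%C) - Re (f (t + RtoC s * h)%C)) / k - Re (l * h)%C)%R with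
      (Re (f (t + RtoC (s + k) * h)%C - f (t + RtoC s * h)%C - RtoC k * (l * h)) / k)%R.
    + unfold Rdiv; rewrite Rabs_mult, Rabs_inv.
      apply Rmult_lt_reg_r with (Rabs k); auto.
      rewrite Rmult_assoc, Rinv_l, Rmult_1_r by lra.
      eapply Rle_lt_trans; [apply re_le_Cmod|auto].
    + rewrite !Re_sub; replace (Re (RtoC k * (l * h))%C) with (k * Re (l * h)%C)%R by (unfold Re; simpl; ring).
      field; auto.
  - replace ((Im (f (t + RtoC (s + k) * h)%C) - Im (f (t + RtoC s * h)%C)) / k - Im (l * h)%C)%R with
      (Im (f (t + RtoC (s + k) * h)%C - f (t + RtoC s * h)%C - RtoC k * (l * h)) / k)%R.
    + unfold Rdiv; rewrite Rabs_mult, Rabs_inv.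
      apply Rmult_lt_reg_r with (Rabs k); auto.
      rewrite Rmult_assoc, Rinv_l, Rmult_1_r by lra.
      eapply Rle_lt_trans; [apply Im_le_Cmod|auto].
    + rewrite !Im_sub; replace (Im (RtoC k * (l * h))%C) with (k * Im (l * h)%C)%R by (unfold Im; simpl; ring).
      field; auto.
Qed.

(** Squared moduli, because the modulus is not differentiable at 0. *)
Lemma normsq_along_line (f : C -> C) (t h l : C) (s : R) : cder f (t + RtoC s * h)%C l ->
  exists n, is_derive (fun s => Cmod (f (t + RtoC s * h)%C) ^ 2)%R s n /\
    (n <= 2 * Cmod (f (t + RtoC s * h)%C) * Cmod l * Cmod h)%R.
Proof.
  intros H; destruct (cder_along_line f t h l s H) as [H1 H2].
  set (x := f (t + RtoC s * h)%C) in *.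
  exists (2 * (Re x * Re (l * h)%C + Im x * Im (l * h)%C))%R; split.
  - apply (is_derive_ext (fun s => Re (f (t + RtoC s * h)%C) * Re (f (t + RtoC s * h)%C) +
      Im (f (t + RtoC s * h)%C) * Im (f (t + RtoC s * h)%C))%R).
    { intros u; rewrite Cmod2_alt; simpl; ring. }
    assert (D1 := is_derive_mult (K := R_AbsRing) _ _ _ _ _ H1 H1 Rmult_comm).
    assert (D2 := is_derive_mult (K := R_AbsRing) _ _ _ _ _ H2 H2 Rmult_comm).
    assert (D := is_derive_plus (K := R_AbsRing) (V := R_NormedModule) _ _ _ _ _ D1 D2).
    eapply (eq_ind _ (is_derive _ s)); [exact D|].
    fold x; unfold plus, mult; simpl plus; simpl mult; unfold x; cbn; ring.
  - replace (Re x * Re (l * h)%C + Im x * Im (l * h)%C)%R with (Re (Cconj x * (l * h))%C) by (unfold Re, Im; simpl; ring).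
    assert (E := re_le_Cmod (Cconj x * (l * h))); rewrite !Cmod_mult, Cmod_conj in E.
    assert (E2 := Rle_abs (Re (Cconj x * (l * h))%C)).
    replace (2 * Cmod x * Cmod l * Cmod h)%R with (2 * (Cmod x * (Cmod l * Cmod h)))%R by ring; lra.
Qed.

(** Along the segment from t to z = t + h, N = |f1|^2 + |f2|^2 + |f3|^2 satisfies N' <= 6 K |h| N:
    the sum of the three derivatives is at most 2 K |h| (x1 + x2 + x3)^2, and (x1 + x2 + x3)^2 <= 3
    N. *)
Lemma linear_ode_zero (f1 f2 f3 g1 g2 g3 : C -> C) (t : C) (r K : R) : (0 <= K)%R ->
  (forall z, disk t r z -> cder f1 z (g1 z) /\ cder f2 z (g2 z) /\ cder f3 z (g3 z)) ->
  (forall z, disk t r z ->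
    (Cmod (g1 z) <= K * (Cmod (f1 z) + Cmod (f2 z) + Cmod (f3 z)))%R /\
    (Cmod (g2 z) <= K * (Cmod (f1 z) + Cmod (f2 z) + Cmod (f3 z)))%R /\
    (Cmod (g3 z) <= K * (Cmod (f1 z) + Cmod (f2 z) + Cmod (f3 z)))%R) ->
  f1 t = 0 -> f2 t = 0 -> f3 t = 0 ->
  forall z, disk t r z -> f1 z = 0.
Proof.
  intros HK HD HB Z1 Z2 Z3 z Hz.
  set (h := z - t); assert (Hh := Cmod_ge_0 h).
  assert (Hin : forall s, (0 <= s <= 1)%R -> disk t r (t + RtoC s * h)%C).
  { intros s Hs; unfold disk in *; fold h in Hz; replace (t + RtoC s * h - t) with (RtoC s * h) by ring.
    rewrite Cmod_mult, Cmod_R, Rabs_pos_eq by lra; nra. }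
  set (N := fun s => (Cmod (f1 (t + RtoC s * h)%C) ^ 2 + Cmod (f2 (t + RtoC s * h)%C) ^ 2
    + Cmod (f3 (t + RtoC s * h)%C) ^ 2)%R).
  (* The condition on s stands inside the existential so that the derivative can be chosen as a
     function on all of R. *)
  assert (HN : forall s, exists n, (0 <= s <= 1)%R -> is_derive N s n /\ (n <= 6 * K * Cmod h * N s)%R).
  { intros s; destruct (classic (0 <= s <= 1)%R) as [Hs|Hs]; [|exists 0%R; tauto].
    destruct (HD _ (Hin s Hs)) as [D1 [D2 D3]]; destruct (HB _ (Hin s Hs)) as [B1 [B2 B3]].
    destruct (normsq_along_line _ _ _ _ _ D1) as [n1 [E1 L1]].
    destruct (normsq_along_line _ _ _ _ _ D2) as [n2 [E2 L2]].
    destruct (normsq_along_line _ _ _ _ _ D3) as [n3 [E3 L3]].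
    exists (n1 + n2 + n3)%R; intros _; split.
    - apply (is_derive_plus (K := R_AbsRing) (V := R_NormedModule)); auto.
      apply (is_derive_plus (K := R_AbsRing) (V := R_NormedModule)); auto.
    - unfold N.
      set (x1 := Cmod (f1 (t + RtoC s * h)%C)) in *; set (x2 := Cmod (f2 (t + RtoC s * h)%C)) in *;
      set (x3 := Cmod (f3 (t + RtoC s * h)%C)) in *.
      assert (P1 : (0 <= x1)%R) by apply Cmod_ge_0; assert (P2 : (0 <= x2)%R) by apply Cmod_ge_0;
      assert (P3 : (0 <= x3)%R) by apply Cmod_ge_0.
      set (S := (x1 + x2 + x3)%R) in *.
      set (m1 := Cmod (g1 (t + RtoC s * h)%C)) in *; set (m2 := Cmod (g2 (t + RtoC s * h)%C)) in *;
      set (m3 := Cmod (g3 (t + RtoC s * h)%C)) in *.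
      assert (T : forall x m n, (0 <= x)%R -> (m <= K * S)%R -> (n <= 2 * x * m * Cmod h)%R ->
        (n <= 2 * x * (K * S) * Cmod h)%R).
      { intros x m n Hx Hm Hn; eapply Rle_trans; [apply Hn|].
        apply Rmult_le_compat_r; auto; apply Rmult_le_compat_l; lra. }
      assert (U1 := T _ _ _ P1 B1 L1); assert (U2 := T _ _ _ P2 B2 L2); assert (U3 := T _ _ _ P3 B3 L3).
      apply Rle_trans with (2 * (K * Cmod h) * (S * S))%R; [unfold S in *; lra|].
      replace (6 * K * Cmod h * (x1 ^ 2 + x2 ^ 2 + x3 ^ 2))%R
        with (2 * (K * Cmod h) * (3 * (x1 ^ 2 + x2 ^ 2 + x3 ^ 2)))%R by ring.
      apply Rmult_le_compat_l.
      + apply Rmult_le_pos; [lra|]; apply Rmult_le_pos; auto.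
      + unfold S; assert (Q1 := pow2_ge_0 (x1 - x2)); assert (Q2 := pow2_ge_0 (x1 - x3));
        assert (Q3 := pow2_ge_0 (x2 - x3)); simpl in *; nra. }
  assert (H1 : N 1%R = 0%R).
  { apply (gronwall_zero N (fun s => proj1_sig (constructive_indefinite_description _ (HN s))) (6 * K * Cmod h)).
    - intros s Hs; destruct (constructive_indefinite_description _ _) as [n Hn]; apply Hn; auto.
    - intros s Hs; destruct (constructive_indefinite_description _ _) as [n Hn]; apply Hn; auto.
    - intros s; unfold N; assert (A1 := pow2_ge_0 (Cmod (f1 (t + RtoC s * h)%C)));
      assert (A2 := pow2_ge_0 (Cmod (f2 (t + RtoC s * h)%C))); assert (A3 := pow2_ge_0 (Cmod (f3 (t + RtoC s * h)%C))); lra.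
    - unfold N; replace (t + 0 * h) with t by ring; rewrite Z1, Z2, Z3, Cmod_0; ring. }
  unfold N in H1; replace (t + 1 * h) with z in H1 by (unfold h; ring).
  assert (A1 := pow2_ge_0 (Cmod (f1 z))); assert (A2 := pow2_ge_0 (Cmod (f2 z)));
  assert (A3 := pow2_ge_0 (Cmod (f3 z))).
  apply Cmod_eq_0; assert (E : (Cmod (f1 z) ^ 2 = 0)%R) by lra.
  simpl in E; rewrite Rmult_1_r in E; apply Rmult_integral in E; tauto.
Qed.

Lemma cder_locally_bounded (f : C -> C) (t l : C) : cder f t l ->
  exists d, (0 < d)%R /\ forall z, disk t d z -> (Cmod (f z) <= Cmod (f t) + 1)%R.
Proof.
  intros H; destruct (cder_continuous f t l H 1%R Rlt_0_1) as [d [Hd0 Hd]]; exists d; split; auto.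
  intros z Hz; specialize (Hd z Hz); assert (E := Cmod_sub_ge (f z) (f t)); lra.
Qed.

(** The differences of y, y' and y'' satisfy a linear system, since a difference of products is
    linear in the differences of the factors; its coefficients are values of the two solutions and
    their derivatives, bounded near t. *)
Lemma chazy_local_unique (y1 y2 : dfun) (t : C) : chazy y1 -> chazy y2 -> dom y1 t -> dom y2 t ->
  val y1 t = val y2 t -> Dtau (val y1) t = Dtau (val y2) t ->
  Dtau (Dtau (val y1)) t = Dtau (Dtau (val y2)) t ->
  exists r, (0 < r)%R /\ forall z, disk t r z -> dom y1 z /\ dom y2 z /\ val y1 z = val y2 z.
Proof.
  intros H1 H2 Ht1 Ht2 E0 E1 E2.
  assert (O1 : open (dom y1)) by apply H1; assert (O2 : open (dom y2)) by apply H2.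
  destruct (proj1 (open_eps _) O1 t Ht1) as [d1 [Hd1 D1]].
  destruct (proj1 (open_eps _) O2 t Ht2) as [d2 [Hd2 D2]].
  destruct (chazy_elim y1 H1 t Ht1) as [A0 [A1 A2]].
  destruct (chazy_elim y2 H2 t Ht2) as [B0 [B1 B2]].
  destruct (cder_locally_bounded _ _ _ A0) as [d3 [Hd3 D3]].
  destruct (cder_locally_bounded _ _ _ A1) as [d4 [Hd4 D4]].
  destruct (cder_locally_bounded _ _ _ B1) as [d5 [Hd5 D5]].
  destruct (cder_locally_bounded _ _ _ B2) as [d6 [Hd6 D6]].
  set (r := Rmin (Rmin d1 d2) (Rmin (Rmin d3 d4) (Rmin d5 d6))).
  assert (Hr : (0 < r)%R) by (unfold r; repeat apply Rmin_glb_lt; auto).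
  assert (Hsmall : forall z, disk t r z -> disk t d1 z /\ disk t d2 z /\ disk t d3 z /\ disk t d4 z /\
    disk t d5 z /\ disk t d6 z).
  { unfold disk, r; intros z Hz; apply Rmin_Rgt in Hz; destruct Hz as [Ha Hb].
    apply Rmin_Rgt in Ha; apply Rmin_Rgt in Hb; destruct Hb as [Hb Hc].
    apply Rmin_Rgt in Hb; apply Rmin_Rgt in Hc; tauto. }
  exists r; split; auto; intros z Hz.
  assert (Hd : forall z, disk t r z -> dom y1 z /\ dom y2 z).
  { intros w Hw; destruct (Hsmall w Hw) as [W1 [W2 _]]; split; [apply D1|apply D2]; auto. }
  split; [apply Hd; auto|split; [apply Hd; auto|]].
  set (p0 := val y1); set (p1 := Dtau p0); set (p2 := Dtau p1).
  set (q0 := val y2); set (q1 := Dtau q0); set (q2 := Dtau q1).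
  set (m0 := (Cmod (p0 t) + 1)%R); set (m1 := (Cmod (p1 t) + 1)%R);
  set (n1 := (Cmod (q1 t) + 1)%R); set (n2 := (Cmod (q2 t) + 1)%R).
  assert (M0 : (0 <= m0)%R) by (assert (X := Cmod_ge_0 (p0 t)); unfold m0; lra).
  assert (M1 : (0 <= m1)%R) by (assert (X := Cmod_ge_0 (p1 t)); unfold m1; lra).
  assert (N1 : (0 <= n1)%R) by (assert (X := Cmod_ge_0 (q1 t)); unfold n1; lra).
  assert (N2 : (0 <= n2)%R) by (assert (X := Cmod_ge_0 (q2 t)); unfold n2; lra).
  set (T := Cmod two_pi_i); assert (HT : (0 <= T)%R) by apply Cmod_ge_0.
  set (K := (T * (1 + m0 + n2 + 3 / 2 * (m1 + n1)))%R).
  assert (HK1 : (T <= K)%R) by (unfold K; rewrite <- (Rmult_1_r T) at 1; apply Rmult_le_compat_l; lra).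
  assert (Z : p0 z - q0 z = 0).
  { apply (linear_ode_zero (fun w => p0 w - q0 w) (fun w => p1 w - q1 w) (fun w => p2 w - q2 w)
      (fun w => two_pi_i * (p1 w - q1 w)) (fun w => two_pi_i * (p2 w - q2 w))
      (fun w => two_pi_i * (p0 w * (p2 w - q2 w) + q2 w * (p0 w - q0 w)
         - 3 / 2 * ((p1 w + q1 w) * (p1 w - q1 w)))) t r K); auto.
    - lra.
    - intros w Hw; destruct (Hd w Hw) as [W1 W2].
      destruct (chazy_elim y1 H1 w W1) as [X0 [X1 X2]].
      destruct (chazy_elim y2 H2 w W2) as [Y0 [Y1 Y2]].
      fold p0 in X0, X1, X2; fold p1 in X0, X1, X2; fold p2 in X1, X2.
      fold q0 in Y0, Y1, Y2; fold q1 in Y0, Y1, Y2; fold q2 in Y1, Y2.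
      split; [|split]; (eapply cder_eq; [|apply cder_minus; eassumption]); field.
    - intros w Hw; destruct (Hsmall w Hw) as [_ [_ [W3 [W4 [W5 W6]]]]].
      specialize (D3 w W3); specialize (D4 w W4); specialize (D5 w W5); specialize (D6 w W6).
      fold p0 in D3, D4; fold p1 in D4; fold q0 in D5, D6; fold q1 in D5, D6; fold q2 in D6.
      fold m0 in D3; fold m1 in D4; fold n1 in D5; fold n2 in D6.
      set (a := p0 w - q0 w); set (b := p1 w - q1 w); set (c := p2 w - q2 w).
      assert (Pa := Cmod_ge_0 a); assert (Pb := Cmod_ge_0 b); assert (Pc := Cmod_ge_0 c).
      rewrite !Cmod_mult; fold T; split; [|split].
      + apply Rle_trans with (K * Cmod b)%R; [apply Rmult_le_compat_r; auto|apply Rmult_le_compat_l; lra].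
      + apply Rle_trans with (K * Cmod c)%R; [apply Rmult_le_compat_r; auto|apply Rmult_le_compat_l; lra].
      + unfold K; rewrite Rmult_assoc; apply Rmult_le_compat_l; auto.
        assert (S1 := Cmod_sub_le (p0 w * c + q2 w * a) (3 / 2 * ((p1 w + q1 w) * b))).
        assert (S2 := Cmod_triangle (p0 w * c) (q2 w * a)).
        assert (S3 := Cmod_triangle (p1 w) (q1 w)).
        rewrite !Cmod_mult in *.
        replace (Cmod (3 / 2)) with (3 / 2)%R in *
          by (rewrite <- RtoC_div, Cmod_R, Rabs_pos_eq by lra; auto).
        assert (R1 : (Cmod (p0 w) * Cmod c <= m0 * Cmod c)%R) by (apply Rmult_le_compat_r; auto).
        assert (R2 : (Cmod (q2 w) * Cmod a <= n2 * Cmod a)%R) by (apply Rmult_le_compat_r; auto).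
        assert (R3 : (Cmod (p1 w + q1 w) * Cmod b <= (m1 + n1) * Cmod b)%R) by (apply Rmult_le_compat_r; lra).
        assert (X1 := Rmult_le_pos _ _ M0 Pa); assert (X2 := Rmult_le_pos _ _ M0 Pb).
        assert (X3 := Rmult_le_pos _ _ N2 Pb); assert (X4 := Rmult_le_pos _ _ N2 Pc).
        assert (X5 := Rmult_le_pos _ _ M1 Pa); assert (X6 := Rmult_le_pos _ _ M1 Pc).
        assert (X7 := Rmult_le_pos _ _ N1 Pa); assert (X8 := Rmult_le_pos _ _ N1 Pc).
        lra.
    - unfold p0, q0; rewrite E0; ring.
    - unfold p1, q1, p0, q0; rewrite E1; ring.
    - unfold p2, q2, p1, q1, p0, q0; rewrite E2; ring. }
  replace (p0 z) with (p0 z - q0 z + q0 z) by ring; rewrite Z; ring.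
Qed.

Open Scope C_scope.

(** * The action of SL2 *)

Lemma moebius_inv_facts (g : SL2) (t : C) : gc g * t + gd g <> 0 ->
  ga g - gc g * moebius g t = / (gc g * t + gd g) /\
  (gd g * moebius g t - gb g) / (ga g - gc g * moebius g t) = t.
Proof.
  intros Hu; assert (D := g_det g).
  assert (E : ga g - gc g * moebius g t = / (gc g * t + gd g)).
  { unfold moebius; transitivity ((ga g * gd g - gb g * gc g) / (gc g * t + gd g)); [field; auto|].
    rewrite D; field; auto. }
  split; auto; rewrite E; unfold moebius.
  transitivity ((ga g * gd g - gb g * gc g) * t); [field; auto|rewrite D; ring].
Qed.

Lemma g_inv_det (g : SL2) : gd g * ga g - - gb g * - gc g = 1.
Proof. rewrite <- (g_det g); ring. Qed.

Definition ginv (g : SL2) : SL2 := MkSL2 (gd g) (- gb g) (- gc g) (ga g) (g_inv_det g).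

Lemma moebius_ginv (g : SL2) (w : C) : - gc g * w + ga g <> 0 ->
  gc g * moebius (ginv g) w + gd g <> 0 /\ moebius g (moebius (ginv g) w) = w.
Proof.
  intros H; destruct (moebius_inv_facts (ginv g) w H) as [E1 E2]; simpl in E1, E2.
  split.
  - replace (gc g * moebius (ginv g) w + gd g) with (gd g - - gc g * moebius (ginv g) w) by ring.
    rewrite E1; apply Cinv_neq_0; auto.
  - clear - E2; set (m := moebius (ginv g) w) in *; clearbody m; unfold moebius; rewrite <- E2; f_equal; ring.
Qed.

Lemma cder_linear (c d t : C) : cder (fun z => c * z + d) t c.
Proof.
  eapply cder_eq; [|apply cder_plus; [apply cder_scal, cder_id|apply cder_const]]; ring.
Qed.

Lemma cder_inv_linear (c d t : C) : c * t + d <> 0 ->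
  cder (fun z => / (c * z + d)) t (- c * (/ (c * t + d) * / (c * t + d))).
Proof.
  intros H; eapply cder_eq; [|apply (cder_comp (fun z => / z) (fun z => c * z + d));
    [apply cder_inv, H|apply cder_linear]]; field; auto.
Qed.

Lemma cder_moebius (g : SL2) (t : C) : gc g * t + gd g <> 0 ->
  cder (moebius g) t (/ (gc g * t + gd g) * / (gc g * t + gd g)).
Proof.
  intros H; apply (cder_ext (fun z => (ga g * z + gb g) * / (gc g * z + gd g))); [reflexivity|].
  eapply cder_eq; [|apply cder_mult; [apply cder_linear|apply cder_inv_linear; auto]].
  transitivity ((ga g * gd g - gb g * gc g) * (/ (gc g * t + gd g) * / (gc g * t + gd g)));
    [field; auto|rewrite g_det; ring].
Qed.

Lemma open_moebius_preim (g : SL2) (V : C -> Prop) : open V ->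
  open (fun t => gc g * t + gd g <> 0 /\ V (moebius g t)).
Proof.
  intros HV; apply open_eps; intros t [Hu Ht].
  destruct (cder_continuous _ _ _ (cder_linear (gc g) (gd g) t) (Cmod (gc g * t + gd g))) as [d1 [Hd1 D1]].
  { apply Cmod_gt_0; auto. }
  destruct (proj1 (open_eps V) HV _ Ht) as [e [He0 He]].
  destruct (cder_continuous _ _ _ (cder_moebius g t Hu) e He0) as [d2 [Hd2 D2]].
  exists (Rmin d1 d2); split; [apply Rmin_glb_lt; auto|].
  intros z Hz; apply Rmin_Rgt in Hz; destruct Hz as [Z1 Z2]; split.
  - intros Z; specialize (D1 z Z1); rewrite Z in D1.
    replace (0 - (gc g * t + gd g)) with (- (gc g * t + gd g)) in D1 by ring.
    rewrite Cmod_opp in D1; lra.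
  - apply He, D2; auto.
Qed.

(** g maps the new domain homeomorphically, with inverse [ginv g], onto the old one without the
    point a / c if c <> 0; a separation of one is carried to a separation of the other. *)
Lemma act_domain (y : dfun) (g : SL2) : domain (dom y) -> domain (dom (act y g)).
Proof.
  intros HU; assert (D := g_det g).
  assert (HU0 : domain (fun w => dom y w /\ - gc g * w + ga g <> 0)).
  { destruct (Ceq_dec (gc g) 0) as [Z|Z].
    - assert (Ha : ga g <> 0).
      { intros E; rewrite Z, E in D; replace (0 * gd g - gb g * 0) with (RtoC 0) in D by ring.
        injection D; lra. }
      replace (fun w => dom y w /\ - gc g * w + ga g <> 0) with (dom y); auto.
      fext; intros w; apply propositional_extensionality; split; [|tauto].
      intros Hw; split; auto; rewrite Z; replace (- 0 * w + ga g) with (ga g) by ring; auto.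
    - replace (fun w => dom y w /\ - gc g * w + ga g <> 0) with (fun w => dom y w /\ w <> ga g / gc g);
        [apply punctured_domain; auto|].
      fext; intros w; apply propositional_extensionality; split; intros [H1 H2]; split; auto; intros E; apply H2.
      + replace w with ((ga g - (- gc g * w + ga g)) / gc g) by (field; auto); rewrite E; field; auto.
      + rewrite E; field; auto. }
  assert (Hh : forall w, dom y w /\ - gc g * w + ga g <> 0 -> dom (act y g) (moebius (ginv g) w)).
  { intros w [H1 H2]; destruct (moebius_ginv g w H2) as [E1 E2]; split; auto; rewrite E2; auto. }
  assert (Hg : forall t, dom (act y g) t -> (dom y (moebius g t) /\ - gc g * moebius g t + ga g <> 0) /\
    moebius (ginv g) (moebius g t) = t).
  { intros t [H1 H2]; destruct (moebius_inv_facts g t H1) as [E1 E2]; split; [split; auto|].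
    - replace (- gc g * moebius g t + ga g) with (ga g - gc g * moebius g t) by ring.
      rewrite E1; apply Cinv_neq_0; auto.
    - clear - E2; set (m := moebius g t) in *; clearbody m; unfold moebius; simpl; rewrite <- E2; f_equal; ring. }
  destruct HU0 as [[w0 Hw0] [HO HC]]; split; [exists (moebius (ginv g) w0); auto|split].
  - apply open_moebius_preim; apply HU.
  - intros V W HV HW Hc [p [Hp Vp]] [q [Hq Wq]].
    destruct (HC (fun w => - gc g * w + ga g <> 0 /\ V (moebius (ginv g) w))
      (fun w => - gc g * w + ga g <> 0 /\ W (moebius (ginv g) w))) as [z [Hz [[_ Vz] [_ Wz]]]].
    + apply (open_moebius_preim (ginv g)); auto.
    + apply (open_moebius_preim (ginv g)); auto.
    + intros w Hw; destruct (Hc _ (Hh w Hw)); [left|right]; split; auto; apply Hw.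
    + destruct (Hg p Hp) as [H1 H2]; exists (moebius g p); split; auto; split; [apply H1|rewrite H2; auto].
    + destruct (Hg q Hq) as [H1 H2]; exists (moebius g q); split; auto; split; [apply H1|rewrite H2; auto].
    + exists (moebius (ginv g) z); auto.
Qed.

Lemma cder_moebius_comp (F : C -> C) (g : SL2) (t l : C) : gc g * t + gd g <> 0 ->
  cder F (moebius g t) l ->
  cder (fun z => F (moebius g z)) t (l * (/ (gc g * t + gd g) * / (gc g * t + gd g))).
Proof. intros Hu HF; apply (cder_comp F (moebius g)); auto; apply cder_moebius; auto. Qed.

(** With v = 1 / (c t + d) one has v' = - c v^2 and (F o g)' = v^2 (F' o g), which gives f1 and f2
    as the first two derivatives of y || g. The terms with c cancel in Q and R, which are therefore
    truly modular of weights 4 and 6. *)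
Lemma act_chazy_gen (y : dfun) (g : SL2) : chazy y ->
  chazy (act y g) /\
  (forall t, dom (act y g) t -> invQ (act y g) t = (/ (gc g * t + gd g)) ^ 4 * invQ y (moebius g t)) /\
  (forall t, dom (act y g) t -> invR (act y g) t = (/ (gc g * t + gd g)) ^ 6 * invR y (moebius g t)).
Proof.
  intros Hy; assert (HD := act_domain y g (proj1 Hy)).
  assert (HO : open (dom (act y g))) by apply HD.
  assert (P := two_pi_i_neq_0).
  pose (k := / two_pi_i); pose (c := gc g).
  set (v := fun t => / (gc g * t + gd g)).
  set (y0 := fun t => val y (moebius g t)); set (y1 := fun t => Dtau (val y) (moebius g t));
  set (y2 := fun t => Dtau (Dtau (val y)) (moebius g t)).
  set (f0 := fun t => v t * v t * y0 t - 12 * k * c * v t).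
  set (f1 := fun t => v t * v t * (v t * v t) * y1 t - 2 * k * c * (v t * v t * v t * y0 t)
    + 12 * k * k * c * c * (v t * v t)).
  set (f2 := fun t => v t * v t * (v t * v t) * (v t * v t) * y2 t - 6 * k * c * (v t * v t * (v t * v t) * v t * y1 t)
    + (6 * k * k * c * c * (v t * v t * (v t * v t) * y0 t) - 24 * k * k * k * c * c * c * (v t * v t * v t))).
  assert (Hv : forall t, dom (act y g) t -> cder v t (- c * (v t * v t))).
  { intros t [Hu _]; apply cder_inv_linear; auto. }
  assert (H0 : forall t, dom (act y g) t -> cder y0 t (two_pi_i * y1 t * (v t * v t))).
  { intros t [Hu Ht]; apply cder_moebius_comp; auto; apply (chazy_elim y Hy _ Ht). }
  assert (H1 : forall t, dom (act y g) t -> cder y1 t (two_pi_i * y2 t * (v t * v t))).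
  { intros t [Hu Ht]; apply cder_moebius_comp; auto; apply (chazy_elim y Hy _ Ht). }
  assert (H2 : forall t, dom (act y g) t ->
    cder y2 t (two_pi_i * (y0 t * y2 t - 3 / 2 * y1 t ^ 2) * (v t * v t))).
  { intros t [Hu Ht]; apply cder_moebius_comp; auto; apply (chazy_elim y Hy _ Ht). }
  assert (E0 : forall t, dom (act y g) t -> val (act y g) t = f0 t).
  { intros t [Hu _]; unfold f0, y0, v, k, c; simpl val; field; auto. }
  assert (G0 : forall t, dom (act y g) t -> cder (val (act y g)) t (two_pi_i * f1 t)).
  { intros t Ht; apply (cder_ext_open (dom (act y g)) f0); auto; [intros; symmetry; auto|].
    specialize (Hv t Ht); specialize (H0 t Ht).
    eapply cder_eq; [|apply cder_minus; [apply cder_mult; [apply cder_mult|]|apply cder_scal]; eassumption].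
    unfold f1, k; field; auto. }
  assert (G1 : forall t, dom (act y g) t -> cder f1 t (two_pi_i * f2 t)).
  { intros t Ht; specialize (Hv t Ht); specialize (H0 t Ht); specialize (H1 t Ht).
    assert (Hv2 := cder_mult _ _ _ _ _ Hv Hv).
    eapply cder_eq; [|apply cder_plus; [apply cder_minus; [apply cder_mult; [apply cder_mult; apply Hv2|apply H1]|
      apply cder_scal, cder_mult; [apply cder_mult; [apply Hv2|apply Hv]|apply H0]]|apply cder_scal, Hv2]].
    unfold f2, k; field; auto. }
  destruct (chazy_intro (act y g) f1 f2) as [HC [D1 D2]]; auto.
  { intros t Ht; rewrite E0 by auto; specialize (Hv t Ht); specialize (H0 t Ht); specialize (H1 t Ht); specialize (H2 t Ht).
    assert (Hv2 := cder_mult _ _ _ _ _ Hv Hv); assert (Hv4 := cder_mult _ _ _ _ _ Hv2 Hv2).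
    eapply cder_eq; [|apply cder_plus; [apply cder_minus; [apply cder_mult; [apply cder_mult; [apply Hv4|apply Hv2]|apply H2]|
      apply cder_scal, cder_mult; [apply cder_mult; [apply Hv4|apply Hv]|apply H1]]|
      apply cder_minus; [apply cder_scal, cder_mult; [apply Hv4|apply H0]|
        apply cder_scal, cder_mult; [apply Hv2|apply Hv]]]].
    unfold f0, f1, f2, k; field; auto. }
  split; auto; split; intros t Ht; unfold invQ, invR; rewrite E0, D1, ?D2 by auto;
    fold (y0 t) (y1 t) (y2 t) (v t); unfold f0, f1, f2; ring.
Qed.

Lemma act_chazy (y : dfun) (g : SL2) : chazy y -> chazy (act y g).
Proof. intros H; apply act_chazy_gen; auto. Qed.

(** * Restriction, continuation and matching of solutions *)

Lemma Dtau_local (U : C -> Prop) (f f' : C -> C) (t : C) : open U -> U t ->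
  (forall z, U z -> f z = f' z) ->
  ex_derive (K := C_AbsRing) (V := C_NormedModule) f' t -> Dtau f t = Dtau f' t.
Proof.
  intros HO Ht E H; apply Dtau_eq, (cder_ext_open U f'); auto; [intros; symmetry; auto|].
  apply Dtau_cder; auto.
Qed.

Lemma restricts_inv (y y' : dfun) (t : C) : restricts y y' -> dom y t ->
  dom y' t /\ val y t = val y' t /\ invQ y t = invQ y' t /\ invR y t = invR y' t.
Proof.
  intros [H1 [H2 H]] Ht; assert (HO : open (dom y)) by apply H1.
  assert (E0 : forall z, dom y z -> val y z = val y' z) by (intros z Hz; apply H; auto).
  assert (E1 : forall z, dom y z -> Dtau (val y) z = Dtau (val y') z).
  { intros z Hz; apply (Dtau_local (dom y)); auto; apply H2, H; auto. }
  assert (E2 : forall z, dom y z -> Dtau (Dtau (val y)) z = Dtau (Dtau (val y')) z).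
  { intros z Hz; apply (Dtau_local (dom y)); auto.
    destruct H2 as [_ [_ [H2 _]]]; apply H2, H; auto. }
  split; [apply H; auto|]; unfold invQ, invR; rewrite E0, E1, E2; auto.
Qed.

Lemma chazy_restrict (y : dfun) (U : C -> Prop) : chazy y -> domain U -> (forall t, U t -> dom y t) ->
  restricts (DFun U (val y)) y.
Proof.
  intros Hy HU H; split; [|split; auto].
  destruct Hy as [_ [H0 [H1 [H2 H3]]]]; split; [auto|]; repeat split.
  - intros t Ht; apply H0, H, Ht.
  - intros t Ht; apply H1, H, Ht.
  - intros t Ht; apply H2, H, Ht.
  - intros t Ht; apply H3, H, Ht.
Qed.

(** Both are extensions of their common restriction to the disc. *)
Lemma chazy_agree_same (y y' : dfun) (t : C) (r : R) : chazy y -> chazy y' -> (0 < r)%R ->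
  (forall z, disk t r z -> dom y z /\ dom y' z /\ val y z = val y' z) -> same_solution y y'.
Proof.
  intros Hy Hy' Hr H.
  assert (R1 : restricts (DFun (disk t r) (val y)) y).
  { apply chazy_restrict; auto using disk_domain; intros z Hz; apply H; auto. }
  apply rst_trans with (DFun (disk t r) (val y)); [apply rst_sym, rst_step; auto|apply rst_step].
  split; [apply R1|split; auto].
  intros z Hz; simpl in *; destruct (H z Hz) as [_ [? ?]]; auto.
Qed.

Lemma chazy_inv_unique (y y' : dfun) (t : C) : chazy y -> chazy y' -> dom y t -> dom y' t ->
  val y t = val y' t -> invQ y t = invQ y' t -> invR y t = invR y' t ->
  exists r, (0 < r)%R /\ forall z, disk t r z -> dom y z /\ dom y' z /\ val y z = val y' z.
Proof.
  intros Hy Hy' Ht Ht' E0 EQ ER.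
  assert (E1 : Dtau (val y) t = Dtau (val y') t).
  { transitivity ((val y t ^ 2 - invQ y t) / 12); [unfold invQ; field|].
    rewrite E0, EQ; unfold invQ; field. }
  apply chazy_local_unique; auto.
  transitivity ((invR y t - val y t ^ 3 + 18 * val y t * Dtau (val y) t) / 36); [unfold invR; field|].
  rewrite E0, E1, ER; unfold invR; field.
Qed.

(* The orbit of y0 is reached by choosing g with g t0 = tau and c t0 + d = 1 / M; the remaining
   parameter c of g adjusts the value of y0 || g at t0. *)
Lemma orbit_of_data (y0 y : dfun) (tau t0 M : C) : chazy y0 -> chazy y -> dom y0 tau -> dom y t0 ->
  M <> 0 -> invQ y t0 = M ^ 4 * invQ y0 tau -> invR y t0 = M ^ 6 * invR y0 tau ->
  exists (g : SL2) (r : R), (0 < r)%R /\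
    forall z, disk t0 r z -> dom y z /\ dom (act y0 g) z /\ val y z = val (act y0 g) z.
Proof.
  intros H0 Hy Htau Ht HM EQ ER; assert (P := two_pi_i_neq_0).
  (* Solves y(t0) = M^2 y0(tau) - 12 c M / (2 pi i), the value of y0 || g at t0 when c t0 + d = 1 /
     M. *)
  set (c := (M ^ 2 * val y0 tau - val y t0) * two_pi_i / (12 * M)).
  assert (Hdet : (M + tau * c) * (/ M - c * t0) - (tau / M - (M + tau * c) * t0) * c = 1) by (field; auto).
  set (g := MkSL2 (M + tau * c) (tau / M - (M + tau * c) * t0) c (/ M - c * t0) Hdet).
  assert (Eu : gc g * t0 + gd g = / M) by (simpl; ring).
  assert (Hu : gc g * t0 + gd g <> 0) by (rewrite Eu; apply Cinv_neq_0; auto).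
  assert (Em : moebius g t0 = tau) by (unfold moebius; rewrite Eu; simpl; field; auto).
  assert (Hd : dom (act y0 g) t0) by (split; auto; rewrite Em; auto).
  destruct (act_chazy_gen y0 g H0) as [HC [Q1 R1]].
  exists g; apply chazy_inv_unique; auto.
  - simpl val; rewrite Em; change (gc g * t0 + gd g) with (c * t0 + (/ M - c * t0)) in Eu.
    rewrite Eu; unfold c; field; auto.
  - rewrite Q1, Em, Eu, EQ by auto; field; auto.
  - rewrite R1, Em, Eu, ER by auto; field; auto.
Qed.

Lemma const_chazy_gen (c : C) : chazy (const_sol c) /\
  (forall t, invQ (const_sol c) t = c ^ 2) /\ (forall t, invR (const_sol c) t = c ^ 3).
Proof.
  destruct (ramanujan_chazy (const_sol c) (fun _ => c ^ 2) (fun _ => c ^ 3)) as [H [HQ HR]].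
  - apply full_domain.
  - intros t _; eapply cder_eq; [|apply (cder_const (c))]; simpl val; field.
  - intros t _; eapply cder_eq; [|apply (cder_const (c ^ 2))]; simpl val; field.
  - intros t _; eapply cder_eq; [|apply (cder_const (c ^ 3))]; simpl val; field.
  - split; auto; split; intros t; [apply HQ|apply HR]; exact I.
Qed.

Lemma const_chazy (c : C) : chazy (const_sol c).
Proof. apply const_chazy_gen. Qed.

(** * The three kinds of solutions *)

Inductive kind := KE2 | K1 | K0.

(* Invariant under (Q, R) -> (M^4 Q, M^6 R), hence constant on orbits. *)
Definition kind_cond (k : kind) (Q R : C) : Prop :=
  match k with
  | KE2 => Q ^ 3 <> R ^ 2
  | K1 => Q ^ 3 = R ^ 2 /\ Q <> 0
  | K0 => Q = 0 /\ R = 0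
  end.

Definition has_kind (k : kind) (y : dfun) : Prop :=
  forall t, dom y t -> kind_cond k (invQ y t) (invR y t).

Definition kind_rep (k : kind) : dfun :=
  match k with KE2 => E2_sol | K1 => const_sol 1 | K0 => const_sol 0 end.

Lemma kind_cond_ex (Q R : C) : exists k, kind_cond k Q R.
Proof.
  destruct (Ceq_dec (Q ^ 3) (R ^ 2)) as [E|E]; [|exists KE2; auto].
  destruct (Ceq_dec Q 0) as [Z|Z]; [|exists K1; split; auto].
  exists K0; split; auto; destruct (Ceq_dec R 0) as [Z'|Z']; auto.
  exfalso; apply (Cpow_nz R 2 Z'); rewrite <- E, Z; ring.
Qed.

Lemma kind_cond_unique (k k' : kind) (Q R : C) : kind_cond k Q R -> kind_cond k' Q R -> k = k'.
Proof.
  destruct k, k'; simpl; auto; try tauto; intros H1 H2; exfalso;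
    first [destruct H2 as [-> ->]|destruct H1 as [-> ->]]; (apply H1; ring) || (apply H2; ring).
Qed.

Lemma kind_cond_scale (k : kind) (Q R M : C) : M <> 0 -> kind_cond k Q R ->
  kind_cond k (M ^ 4 * Q) (M ^ 6 * R).
Proof.
  intros HM; assert (HM4 := Cpow_nz M 4 HM); assert (HM12 := Cpow_nz M 12 HM).
  assert (E : (M ^ 4 * Q) ^ 3 - (M ^ 6 * R) ^ 2 = M ^ 12 * (Q ^ 3 - R ^ 2)) by ring.
  destruct k; cbn [kind_cond].
  - intros H Z; apply H, Csub_eq.
    assert (E' : M ^ 12 * (Q ^ 3 - R ^ 2) = 0) by (rewrite <- E, Z; ring).
    apply Cmult_integral in E'; tauto.
  - intros [H1 H2]; split; [|apply Cmult_neq_0; auto].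
    apply Csub_eq; rewrite E, H1; ring.
  - intros [-> ->]; split; ring.
Qed.

Lemma kind_rep_chazy (k : kind) : chazy (kind_rep k).
Proof. destruct k; [apply E2_chazy|apply const_chazy|apply const_chazy]. Qed.

Lemma kind_rep_kind (k : kind) : has_kind k (kind_rep k).
Proof.
  destruct k; intros t Ht; cbn [kind_rep].
  - destruct (E2_chazy_gen upper_domain) as [_ [HQ HR]]; rewrite HQ, HR by auto.
    apply E4_E6_disc; auto.
  - destruct (const_chazy_gen 1) as [_ [HQ HR]]; rewrite HQ, HR; simpl; split; [ring|].
    rewrite !Cmult_1_r; intros H; injection H; lra.
  - destruct (const_chazy_gen 0) as [_ [HQ HR]]; rewrite HQ, HR; simpl; split; ring.
Qed.

(** For [K1] take M^2 = R / Q: then Q^3 = R^2 gives Q = M^4 and R = M^6. For [K0] any non-zero M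
    does, and [KE2] is [E4_E6_surj]. *)
Lemma kind_data (k : kind) (Q R : C) : kind_cond k Q R -> exists M t : C, M <> 0 /\ dom (kind_rep k) t /\
  Q = M ^ 4 * invQ (kind_rep k) t /\ R = M ^ 6 * invR (kind_rep k) t.
Proof.
  destruct k; cbn [kind_cond]; cbn [kind_rep].
  - intros H; destruct (E4_E6_surj Q R H) as [M [t [HM [Ht [EQ ER]]]]].
    exists M, t; destruct (E2_chazy_gen upper_domain) as [_ [HQ HR]]; rewrite HQ, HR; auto.
  - intros [H1 H2]; destruct (Csqrt_ex (R / Q)) as [M HM].
    assert (HR0 : R <> 0).
    { intros Z; apply (Cpow_nz Q 3 H2); rewrite H1, Z; ring. }
    assert (H2' : Q = R / Q * (R / Q)).
    { transitivity (Q ^ 3 / Q ^ 2); [field; auto|rewrite H1; field; auto]. }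
    assert (H3' : R = R / Q * (R / Q) * (R / Q)) by (rewrite <- H2'; field; auto).
    exists M, 0; destruct (const_chazy_gen 1) as [_ [HQ HR]]; rewrite HQ, HR.
    repeat split.
    + intros Z; rewrite Z in HM; rewrite <- HM in H2'; apply H2; rewrite H2'; ring.
    + rewrite H2' at 1; rewrite <- HM; ring.
    + rewrite H3' at 1; rewrite <- HM; ring.
  - intros [-> ->]; exists 1, 0; destruct (const_chazy_gen 0) as [_ [HQ HR]]; rewrite HQ, HR.
    repeat split; try ring; intros H; injection H; lra.
Qed.

Lemma act_kind (k : kind) (y : dfun) (g : SL2) : chazy y -> has_kind k y -> has_kind k (act y g).
Proof.
  intros Hy Hk t Ht; destruct (act_chazy_gen y g Hy) as [_ [HQ HR]]; rewrite HQ, HR by auto.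
  destruct Ht as [Hu Ht]; apply kind_cond_scale; [apply Cinv_neq_0; auto|apply Hk; auto].
Qed.

Lemma agree_inv (y y' : dfun) (t : C) (r : R) : chazy y -> chazy y' -> 
  (forall z, disk t r z -> dom y z /\ dom y' z /\ val y z = val y' z) ->
  forall z, disk t r z -> invQ y z = invQ y' z /\ invR y z = invR y' z.
Proof.
  intros Hy Hy' H z Hz.
  assert (Hr : (0 < r)%R) by (unfold disk in Hz; assert (X := Cmod_ge_0 (z - t)); lra).
  assert (R1 : restricts (DFun (disk t r) (val y)) y).
  { apply chazy_restrict; auto using disk_domain; intros w Hw; apply H; auto. }
  assert (R2 : restricts (DFun (disk t r) (val y)) y').
  { split; [apply R1|split; auto]; intros w Hw; simpl in *; destruct (H w Hw) as [_ [? ?]]; auto. }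
  destruct (restricts_inv _ _ z R1 Hz) as [_ [_ [A1 A2]]].
  destruct (restricts_inv _ _ z R2 Hz) as [_ [_ [B1 B2]]].
  rewrite <- A1, <- A2, B1, B2; auto.
Qed.

Lemma chazy_near_rep (y : dfun) (t : C) (k : kind) : chazy y -> dom y t ->
  kind_cond k (invQ y t) (invR y t) -> exists (g : SL2) (r : R), (0 < r)%R /\
    forall z, disk t r z -> dom y z /\ dom (act (kind_rep k) g) z /\ val y z = val (act (kind_rep k) g) z.
Proof.
  intros Hy Ht Hk; destruct (kind_data _ _ _ Hk) as [M [tau [HM [Htau [EQ ER]]]]].
  apply (orbit_of_data (kind_rep k) y tau t M); auto using kind_rep_chazy.
Qed.

(** Not evident for closed conditions such as Q = R = 0: near t the solution coincides with a
    transform of the representative, which has its kind everywhere. *)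
Lemma kind_open (y : dfun) (k : kind) : chazy y ->
  open (fun t => dom y t /\ kind_cond k (invQ y t) (invR y t)).
Proof.
  intros Hy; apply open_eps; intros t [Ht Hk].
  destruct (chazy_near_rep y t k Hy Ht Hk) as [g [r [Hr H]]]; exists r; split; auto.
  intros z Hz; split; [apply H; auto|].
  assert (HC := act_chazy _ g (kind_rep_chazy k)).
  destruct (agree_inv y _ t r Hy HC H z Hz) as [-> ->].
  apply act_kind; auto using kind_rep_chazy, kind_rep_kind; apply H; auto.
Qed.

(** The three kinds partition the connected domain into open sets; W collects the two kinds other
    than k. *)
Lemma kind_propagates (y : dfun) (k : kind) (t : C) : chazy y -> dom y t ->
  kind_cond k (invQ y t) (invR y t) -> has_kind k y.
Proof.
  intros Hy Ht Hk s Hs.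
  destruct (kind_cond_ex (invQ y s) (invR y s)) as [k' Hk'].
  set (V := fun t => dom y t /\ kind_cond k (invQ y t) (invR y t)).
  set (O := fun k t => dom y t /\ kind_cond k (invQ y t) (invR y t)).
  set (W := fun t => (k <> KE2 /\ O KE2 t) \/ (k <> K1 /\ O K1 t) \/ (k <> K0 /\ O K0 t)).
  assert (HW : open W).
  { assert (Hk0 : forall j, open (fun t => k <> j /\ O j t)).
    { intros j; apply open_and; [|apply kind_open; auto].
      apply open_eps; intros u Hu; exists 1%R; split; [lra|auto]. }
    apply open_or; [apply Hk0|apply open_or; apply Hk0]. }
  assert (HWn : forall u, W u -> ~ kind_cond k (invQ y u) (invR y u)).
  { intros u Hu Hku; destruct Hu as [[Hn [_ H]]|[[Hn [_ H]]|[Hn [_ H]]]];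
      apply Hn, (kind_cond_unique _ _ _ _ Hku H). }
  destruct (classic (k = k')) as [->|Hne]; auto; exfalso.
  assert (HC : connected (dom y)) by apply Hy.
  assert (Hcase : forall u k'', dom y u -> kind_cond k'' (invQ y u) (invR y u) -> k <> k'' -> W u).
  { intros u k'' Hu Hk'' Hn; unfold W, O; destruct k''; auto. }
  destruct (HC V W (kind_open y k Hy) HW) as [z [_ [[_ H1] H2]]].
  - intros u Hu; destruct (kind_cond_ex (invQ y u) (invR y u)) as [k'' Hk''].
    destruct (classic (k = k'')) as [->|Hn]; [left; split; auto|right; apply (Hcase u k''); auto].
  - exists t; split; auto; split; auto.
  - exists s; split; auto; apply (Hcase s k'); auto.
  - apply (HWn z H2 H1).
Qed.

Lemma restricts_kind (y y' : dfun) (k : kind) : restricts y y' -> has_kind k y <-> has_kind k y'.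
Proof.
  intros H; split; intros Hk.
  - destruct (proj1 (proj1 (proj1 H))) as [t Ht].
    destruct (restricts_inv y y' t H Ht) as [Ht' [_ [EQ ER]]].
    apply (kind_propagates y' k t); [apply H|auto|]; rewrite <- EQ, <- ER; apply Hk; auto.
  - intros t Ht; destruct (restricts_inv y y' t H Ht) as [Ht' [_ [-> ->]]]; apply Hk; auto.
Qed.

Lemma same_kind (y y' : dfun) (k : kind) : same_solution y y' -> has_kind k y <-> has_kind k y'.
Proof.
  induction 1 as [y y' H| |y y' _ IH|y y' y'' _ IH1 _ IH2]; try tauto.
  apply restricts_kind; auto.
Qed.

(** * Orbits *)

Lemma act_restricts (y y' : dfun) (g : SL2) : restricts y y' -> restricts (act y g) (act y' g).
Proof.
  intros [H1 [H2 H]]; split; [apply act_chazy; auto|split; [apply act_chazy; auto|]].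
  intros t [Hu Ht]; destruct (H _ Ht) as [Ht' E]; split; [split; auto|].
  simpl; rewrite E; auto.
Qed.

Lemma act_same (y y' : dfun) (g : SL2) : same_solution y y' -> same_solution (act y g) (act y' g).
Proof.
  induction 1 as [y y' H| |y y' _ IH|y y' y'' _ IH1 _ IH2].
  - apply rst_step, act_restricts; auto.
  - apply rst_refl.
  - apply rst_sym; auto.
  - eapply rst_trans; eauto.
Qed.

Lemma act_id (y : dfun) (g : SL2) : chazy y -> ga g = 1 -> gb g = 0 -> gc g = 0 -> gd g = 1 ->
  restricts y (act y g).
Proof.
  intros Hy Ea Eb Ec Ed; split; [auto|split; [apply act_chazy; auto|]].
  assert (H1 : RtoC 1 <> 0) by (intros H; injection H; lra).
  intros t Ht; simpl; unfold moebius; rewrite Ea, Eb, Ec, Ed.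
  replace (0 * t + 1) with (RtoC 1) by ring.
  replace ((1 * t + 0) / 1) with t by field.
  repeat split; auto; assert (P := two_pi_i_neq_0); field; auto.
Qed.

Lemma gmul_det (g h : SL2) : (ga g * ga h + gb g * gc h) * (gc g * gb h + gd g * gd h)
  - (ga g * gb h + gb g * gd h) * (gc g * ga h + gd g * gc h) = 1.
Proof.
  transitivity ((ga g * gd g - gb g * gc g) * (ga h * gd h - gb h * gc h)); [ring|].
  rewrite !g_det; ring.
Qed.

Definition gmul (g h : SL2) : SL2 := MkSL2 _ _ _ _ (gmul_det g h).

(** A right action, but only up to restriction: y || gh may be defined at a point that h sends to
    infinity. *)
Lemma act_act (y : dfun) (g h : SL2) : chazy y -> restricts (act (act y g) h) (act y (gmul g h)).
Proof.
  intros Hy; split; [do 2 apply act_chazy; auto|split; [apply act_chazy; auto|]].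
  intros t [Hu [Hu' Ht]].
  assert (P := two_pi_i_neq_0).
  assert (E : gc (gmul g h) * t + gd (gmul g h) = (gc g * moebius h t + gd g) * (gc h * t + gd h)).
  { unfold moebius; simpl; field; auto. }
  assert (E2 : moebius (gmul g h) t = moebius g (moebius h t)).
  { unfold moebius at 1; rewrite E; unfold moebius at 2.
    transitivity ((ga g * moebius h t + gb g) * (gc h * t + gd h) / ((gc g * moebius h t + gd g) * (gc h * t + gd h)));
      [f_equal; unfold moebius; simpl; field; auto|field; auto]. }
  split; [split|].
  - rewrite E; apply Cmult_neq_0; auto.
  - rewrite E2; auto.
  - simpl val at 2; change (gc g * ga h + gd g * gc h) with (gc (gmul g h)).
    change (gc g * gb h + gd g * gd h) with (gd (gmul g h)).
    rewrite E, E2; simpl val.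
    set (u := gc h * t + gd h) in *; set (w := gc g * moebius h t + gd g) in *.
    (* The cocycle relation that makes the two inhomogeneous terms add up to that of the product; it
       rests on det h = 1. *)
    assert (Ew : gc (gmul g h) = (gc h * w * u + gc g) / u).
    { assert (Ewu : w * u = gc g * (ga h * t + gb h) + gd g * u).
      { unfold w, moebius; fold u; field; auto. }
      transitivity ((gc h * (w * u) + gc g * (ga h * gd h - gb h * gc h)) / u).
      - rewrite Ewu; unfold u; simpl gc; field; auto.
      - rewrite g_det; field; auto. }
    rewrite Ew; field; auto.
Qed.

Definition geqv (y y' : dfun) : Prop := exists g, same_solution y (act y' g).

Lemma geqv_same (y y' : dfun) : chazy y' -> same_solution y y' -> geqv y y'.
Proof.
  intros Hy' H.
  assert (D : 1 * 1 - 0 * 0 = RtoC 1) by ring.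
  exists (MkSL2 1 0 0 1 D); eapply rst_trans; [apply H|].
  apply rst_step, act_id; auto.
Qed.

Lemma geqv_refl (y : dfun) : chazy y -> geqv y y.
Proof. intros H; apply geqv_same; auto; apply rst_refl. Qed.

Lemma geqv_sym (y y' : dfun) : chazy y' -> geqv y y' -> geqv y' y.
Proof.
  intros Hy' [g H]; exists (ginv g).
  apply rst_trans with (act (act y' g) (ginv g)); [|apply rst_sym, act_same, H].
  apply rst_trans with (act y' (gmul g (ginv g))); [|apply rst_sym, rst_step, act_act; auto].
  assert (D := g_det g).
  apply rst_step, act_id; auto; simpl; try ring; rewrite <- D; ring.
Qed.

Lemma geqv_trans (y y' y'' : dfun) : chazy y'' -> geqv y y' -> geqv y' y'' -> geqv y y''.
Proof.
  intros Hy'' [g H] [h H']; exists (gmul h g).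
  eapply rst_trans; [apply H|]; eapply rst_trans; [apply act_same, H'|].
  apply rst_step, act_act; auto.
Qed.

Lemma orbit_eq (y y' : dfun) : chazy y -> chazy y' -> geqv y y' -> orbit y = orbit y'.
Proof.
  intros Hy Hy' H; fext; intros z; apply propositional_extensionality; split; intros [Hz Hg]; split; auto.
  - apply (geqv_trans z y y'); auto.
  - apply (geqv_trans z y' y); auto; apply geqv_sym; auto.
Qed.

Lemma orbit_refl (y : dfun) : chazy y -> orbit y y.
Proof. intros H; split; auto; apply geqv_refl; auto. Qed.

Lemma geqv_kind (y y' : dfun) (k : kind) : chazy y' -> geqv y y' -> has_kind k y' -> has_kind k y.
Proof. intros Hy' [g H] Hk; apply (same_kind _ _ k H), act_kind; auto. Qed.

Lemma has_kind_unique (y : dfun) (k k' : kind) : chazy y -> has_kind k y -> has_kind k' y -> k = k'.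
Proof.
  intros [[[t Ht] _] _] H H'; apply (kind_cond_unique _ _ _ _ (H t Ht) (H' t Ht)).
Qed.

Lemma orbits_distinct (k k' : kind) : k <> k' -> orbit (kind_rep k) <> orbit (kind_rep k').
Proof.
  intros Hn E; assert (H := orbit_refl _ (kind_rep_chazy k)); rewrite E in H; destruct H as [_ H].
  apply Hn, (has_kind_unique (kind_rep k)); auto using kind_rep_chazy, kind_rep_kind.
  apply (geqv_kind _ (kind_rep k')); auto using kind_rep_chazy, kind_rep_kind.
Qed.

Lemma chazy_geqv_rep (y : dfun) : chazy y -> exists k, geqv y (kind_rep k).
Proof.
  intros Hy; destruct (proj1 (proj1 Hy)) as [t Ht].
  destruct (kind_cond_ex (invQ y t) (invR y t)) as [k Hk]; exists k.
  destruct (chazy_near_rep y t k Hy Ht Hk) as [g [r [Hr H]]]; exists g.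
  apply (chazy_agree_same _ _ t r); auto using act_chazy, kind_rep_chazy.
Qed.

(** * Families of two-valued groups *)

(* Testing on pairs (s, - s): the coefficients of z^2 and z are then 1 - k4 s^2 + (...) s^4 / 4
   and - k2 s^2 + k6 s^4. *)
Lemma Bpoly_diag (k2 k4 k6 s z : C) : Bpoly k2 k4 k6 z s (- s) =
  (1 - k4 * (s * s) + (k4 ^ 2 - k6 * k2) / 4 * (s * s) * (s * s)) * z ^ 2
  + (k6 * (s * s) - k2) * (s * s) * z + 4 * (s * s).
Proof. unfold Bpoly; field. Qed.

Lemma quad_coefs (a b c a' b' c' : C) : (forall z, a * z ^ 2 + b * z + c = a' * z ^ 2 + b' * z + c') ->
  a = a' /\ b = b' /\ c = c'.
Proof.
  intros H; assert (H0 := H 0); assert (H1 := H 1); assert (H2 := H (-1)).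
  assert (Ec : c = c') by (transitivity (a * 0 ^ 2 + b * 0 + c); [ring|rewrite H0; ring]).
  subst c'.
  split; [|split; auto].
  - transitivity (((a * 1 ^ 2 + b * 1 + c) + (a * (-1) ^ 2 + b * -1 + c)) / 2 - c); [field|].
    rewrite H1, H2; field.
  - transitivity (((a * 1 ^ 2 + b * 1 + c) - (a * (-1) ^ 2 + b * -1 + c)) / 2); [field|].
    rewrite H1, H2; field.
Qed.

Lemma quad_factor (a b c : C) : a <> 0 -> exists z1 z2, forall z, a * z ^ 2 + b * z + c = a * (z - z1) * (z - z2).
Proof.
  intros Ha; destruct (Csqrt_ex (b * b - 4 * a * c)) as [w Hw].
  exists ((- b + w) / (2 * a)), ((- b - w) / (2 * a)); intros z.
  transitivity (a * z ^ 2 + b * z + (b * b - (b * b - 4 * a * c)) / (4 * a)); [field; auto|].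
  rewrite <- Hw; field; auto.
Qed.

(** Equal multisets of roots make the two quadratics proportional, and their common constant term c
    <> 0 forces the factor 1. *)
Lemma GC_quad (B B' : C -> C -> C -> C) (x y a b c a' b' : C) : GC B = GC B' -> c <> 0 -> a <> 0 ->
  (forall z, B z x y = a * z ^ 2 + b * z + c) -> (forall z, B' z x y = a' * z ^ 2 + b' * z + c) ->
  a = a' /\ b = b'.
Proof.
  intros E Hc Ha HB HB'.
  destruct (quad_factor a b c Ha) as [z1 [z2 Hz]].
  assert (T : tv_mul (GC B) x y z1 z2) by (exists a; split; auto; intros z; rewrite HB; auto).
  rewrite E in T; destruct T as [e [He T]].
  assert (Q1 : a = a /\ b = - (a * (z1 + z2)) /\ c = a * z1 * z2).
  { apply quad_coefs; intros z; rewrite Hz; ring. }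
  assert (Q2 : a' = e /\ b' = - (e * (z1 + z2)) /\ c = e * z1 * z2).
  { apply quad_coefs; intros z; rewrite <- HB', T; ring. }
  destruct Q1 as [_ [Qb Qc]], Q2 as [Qa' [Qb' Qc']].
  assert (Ee : e = a).
  { apply Csub_eq; assert (Z : (e - a) * (z1 * z2) = 0) by (transitivity (e * z1 * z2 - a * z1 * z2); [ring|rewrite <- Qc, <- Qc'; ring]).
    apply Cmult_integral in Z; destruct Z as [Z|Z]; auto.
    exfalso; apply Hc; rewrite Qc; transitivity (a * (z1 * z2)); [ring|rewrite Z; ring]. }
  subst e; split; [auto|rewrite Qb, Qb', Ee; auto].
Qed.

(** The pairs (s, - s) and (s / 2, - s / 2) yield k6 s^2 - k2 at two values of s, which determine
    k2. On this rests the action of G on families, where only the groups are given. *)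
Lemma GC_Bpoly_inj (k2 k4 k6 k2' k4' k6' : C) :
  GC (Bpoly k2 k4 k6) = GC (Bpoly k2' k4' k6') -> k2 = k2'.
Proof.
  intros E.
  set (K := (k4 ^ 2 - k6 * k2) / 4).
  set (a := fun s : C => 1 - k4 * (s * s) + K * (s * s) * (s * s)).
  assert (Key : forall s : C, s <> 0 -> a s <> 0 -> k6 * (s * s) - k2 = k6' * (s * s) - k2').
  { intros s Hs Ha.
    assert (Hs2 : s * s <> 0) by (apply Cmult_neq_0; auto).
    assert (H4 : RtoC 4 <> 0) by (intros H; injection H; lra).
    destruct (GC_quad _ _ s (- s) _ _ (4 * (s * s)) _ _ E (Cmult_neq_0 _ _ H4 Hs2) Ha
      (Bpoly_diag k2 k4 k6 s) (Bpoly_diag k2' k4' k6' s)) as [_ H].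
    transitivity ((k6 * (s * s) - k2) * (s * s) / (s * s)); [field; auto|].
    rewrite H; field; auto. }
  set (N := (Cmod k4 + Cmod K + 1)%R).
  assert (P4 := Cmod_ge_0 k4); assert (PK := Cmod_ge_0 K).
  (* For small s the coefficient [a s] of z^2 is close to 1. *)
  assert (Hsmall : forall s : R, (0 < s)%R -> (s * N <= / 2)%R -> RtoC s <> 0 /\ a s <> 0).
  { intros s Hs HsN; assert (Hs1 : (s <= 1)%R) by (unfold N in HsN; nra).
    split; [intros H; injection H; lra|]; intros Z.
    assert (E1 : RtoC 1 = k4 * (s * s) - K * (s * s) * (s * s)).
    { transitivity (a s + (k4 * (s * s) - K * (s * s) * (s * s))); [unfold a; ring|rewrite Z; ring]. }
    assert (H := Cmod_sub_le (k4 * (s * s)) (K * (s * s) * (s * s))).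
    rewrite <- E1, Cmod_1, !Cmod_mult, !Cmod_R, (Rabs_pos_eq s) in H by lra.
    assert (Hss : (s * s <= s)%R) by nra.
    assert (H4 : (s * s * (s * s) <= s)%R) by nra.
    assert (Cmod k4 * (s * s) <= Cmod k4 * s)%R by (apply Rmult_le_compat_l; lra).
    assert (Cmod K * (s * s * (s * s)) <= Cmod K * s)%R by (apply Rmult_le_compat_l; lra).
    unfold N in HsN; lra. }
  set (s := (/ (2 * N))%R); assert (HN : (0 < N)%R) by (unfold N; lra).
  assert (Hs : (0 < s)%R) by (apply Rinv_0_lt_compat; lra).
  assert (HsN : (s * N = / 2)%R) by (unfold s; field; lra).
  destruct (Hsmall s Hs) as [S1 S2]; [lra|]; destruct (Hsmall (s / 2)%R) as [T1 T2]; [lra|lra|].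
  assert (E1 := Key _ S1 S2); assert (E2 := Key _ T1 T2).
  rewrite RtoC_div in E2 by lra.
  (* Eliminates k6: for f(s) = k6 s^2 - k2 the combination (f(s) - 4 f(s / 2)) / 3 is k2. *)
  transitivity ((k6 * (s * s) - k2 - 4 * (k6 * (s / 2 * (s / 2)) - k2)) / 3); [field|].
  rewrite E1, E2; field.
Qed.

Open Scope C_scope.

(** * Families and their Chazy solutions *)

Lemma associated_chazy (lam : C) (F : tv_family) (y : dfun) : associated lam F y -> chazy y.
Proof.
  intros [k2 [k4 [k6 [[HD [H2 [H4 [H6 H]]]] [_ [Hdom Hval]]]]]].
  assert (Ed : dom y = fdom F) by (fext; intros t; apply propositional_extensionality; auto).
  assert (HO : open (dom y)) by (rewrite Ed; apply HD).
  assert (C2 : forall t, dom y t -> cder k2 t (two_pi_i * (lam / 2 * k4 t))).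
  { intros t Ht; apply Hdom in Ht; rewrite <- (proj1 (H t Ht)); apply Dtau_cder, H2; auto. }
  assert (C4 : forall t, dom y t -> cder k4 t (two_pi_i * (3 * lam / 4 * k6 t))).
  { intros t Ht; apply Hdom in Ht; rewrite <- (proj1 (proj2 (H t Ht))); apply Dtau_cder, H4; auto. }
  assert (C6 : forall t, dom y t -> cder k6 t (two_pi_i * (lam / 4 * (k4 t ^ 2 - k2 t * k6 t)))).
  { intros t Ht; apply Hdom in Ht; rewrite <- (proj2 (proj2 (H t Ht))); apply Dtau_cder, H6; auto. }
  apply (chazy_intro y (fun t => - lam ^ 2 / 8 * k4 t) (fun t => - (3 * lam ^ 3) / 32 * k6 t)).
  - rewrite Ed; auto.
  - intros t Ht; apply (cder_ext_open (dom y) (fun t => - lam / 4 * k2 t)); auto.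
    { intros z Hz; rewrite Hval by auto; field. }
    eapply cder_eq; [|apply cder_scal, C2; auto]; field.
  - intros t Ht; eapply cder_eq; [|apply cder_scal, C4; auto]; field.
  - intros t Ht; eapply cder_eq; [|apply cder_scal, C6; auto]; rewrite Hval by auto; field.
Qed.

(** The groups determine k2 by [GC_Bpoly_inj], hence y; so any associated solution may represent the
    family. *)
Lemma associated_same (lam : C) (F : tv_family) (y y' : dfun) :
  associated lam F y -> associated lam F y' -> same_solution y y'.
Proof.
  intros H H'; apply rst_step; split; [eapply associated_chazy; eauto|split; [eapply associated_chazy; eauto|]].
  destruct H as [k2 [k4 [k6 [_ [HG [Hdom Hval]]]]]], H' as [k2' [k4' [k6' [_ [HG' [Hdom' Hval']]]]]].
  intros t Ht; assert (HF : fdom F t) by (apply Hdom; auto).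
  assert (Ht' : dom y' t) by (apply Hdom'; auto).
  assert (Ek : k2 t = k2' t).
  { apply (GC_Bpoly_inj _ (k4 t) (k6 t) _ (k4' t) (k6' t)); rewrite <- HG, <- HG'; auto. }
  split; auto; rewrite Hval, Hval', Ek; auto.
Qed.

Lemma family_of_chazy_associated (lam : C) (y : dfun) : lam <> 0 -> chazy y ->
  associated lam (family_of_chazy lam y) y.
Proof.
  intros Hl Hy.
  assert (HO : open (dom y)) by apply Hy.
  set (k2 := fun t => - 4 * val y t / lam).
  set (k4 := fun t => 2 / lam * Dtau k2 t).
  set (k6 := fun t => 4 / (3 * lam) * Dtau k4 t).
  set (y1 := Dtau (val y)); set (y2 := Dtau y1).
  assert (C2 : forall t, dom y t -> cder k2 t (two_pi_i * (- 4 / lam * y1 t))).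
  { intros t Ht; destruct (chazy_elim y Hy t Ht) as [H _].
    apply (cder_ext (fun t => - 4 / lam * val y t)); [intros z; unfold k2; field; auto|].
    eapply cder_eq; [|apply cder_scal, H]; unfold y1; field; auto. }
  assert (E4 : forall t, dom y t -> k4 t = - 8 / lam ^ 2 * y1 t).
  { intros t Ht; unfold k4; rewrite (Dtau_eq _ _ _ (C2 t Ht)); field; auto. }
  assert (C4 : forall t, dom y t -> cder k4 t (two_pi_i * (- 8 / lam ^ 2 * y2 t))).
  { intros t Ht; destruct (chazy_elim y Hy t Ht) as [_ [H _]].
    apply (cder_ext_open (dom y) (fun t => - 8 / lam ^ 2 * y1 t)); auto; [intros; symmetry; auto|].
    eapply cder_eq; [|apply cder_scal, H]; unfold y2, y1; field; auto. }
  assert (E6 : forall t, dom y t -> k6 t = - 32 / (3 * lam ^ 3) * y2 t).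
  { assert (H3 : RtoC 3 <> 0) by (intros H; injection H; lra).
    intros t Ht; unfold k6; rewrite (Dtau_eq _ _ _ (C4 t Ht)); field; auto. }
  assert (C6 : forall t, dom y t ->
    cder k6 t (two_pi_i * (- 32 / (3 * lam ^ 3) * (val y t * y2 t - 3 / 2 * y1 t ^ 2)))).
  { intros t Ht; destruct (chazy_elim y Hy t Ht) as [_ [_ H]].
    apply (cder_ext_open (dom y) (fun t => - 32 / (3 * lam ^ 3) * y2 t)); auto; [intros; symmetry; auto|].
    eapply cder_eq; [|apply cder_scal, H]; unfold y2, y1; field; auto. }
  exists k2, k4, k6; split; [|split; [reflexivity|split; [reflexivity|]]].
  - split; [apply Hy|split; [|split; [|split]]].
    + intros t Ht; eexists; apply C2; auto.
    + intros t Ht; eexists; apply C4; auto.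
    + intros t Ht; eexists; apply C6; auto.
    + intros t Ht; rewrite (Dtau_eq _ _ _ (C2 t Ht)), (Dtau_eq _ _ _ (C4 t Ht)), (Dtau_eq _ _ _ (C6 t Ht)).
      rewrite E4, E6 by auto; unfold k2; repeat split; field; auto.
  - intros t _; unfold k2; field; auto.
Qed.

Lemma const_family_associated (lam c : C) :
  associated lam (family_of (fun _ => True) (fun _ => c) (fun _ => 0) (fun _ => 0)) (const_sol (- lam * c / 4)).
Proof.
  assert (HC : forall d t : C, cder (fun _ => d) t (two_pi_i * 0)).
  { intros d t; eapply cder_eq; [|apply cder_const]; ring. }
  exists (fun _ => c), (fun _ => 0), (fun _ => 0); split; [|split; [reflexivity|split; [reflexivity|]]].
  - split; [apply full_domain|split; [|split; [|split]]]; try (intros t _; eexists; apply HC).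
    intros t _; rewrite !(Dtau_eq _ _ _ (HC _ t)); repeat split; field.
  - intros t _; reflexivity.
Qed.

Lemma has_kind_geqv (k : kind) (y : dfun) : chazy y -> has_kind k y -> geqv y (kind_rep k).
Proof.
  intros Hy Hk; destruct (chazy_geqv_rep y Hy) as [k' H'].
  assert (k = k') as ->; auto.
  apply (has_kind_unique y); auto; apply (geqv_kind y (kind_rep k')); auto using kind_rep_chazy, kind_rep_kind.
Qed.

Definition rep_family (lam : C) (k : kind) : tv_family :=
  match k with
  | KE2 => family_of_chazy lam E2_sol
  | K1 => family_of (fun _ => True) (fun _ => 1) (fun _ => 0) (fun _ => 0)
  | K0 => family_of (fun _ => True) (fun _ => 0) (fun _ => 0) (fun _ => 0)
  end.

(** The family with k2 = 1 belongs to the constant solution - lam / 4 and not to 1; being a non-zero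
    constant it is of kind [K1], hence equivalent to 1. *)
Lemma rep_family_associated (lam : C) (k : kind) : lam <> 0 ->
  exists y, associated lam (rep_family lam k) y /\ geqv y (kind_rep k).
Proof.
  intros Hl; destruct k; cbn [rep_family].
  - exists E2_sol; split; [apply family_of_chazy_associated; auto using E2_chazy|].
    apply geqv_refl, E2_chazy.
  - exists (const_sol (- lam * 1 / 4)); split; [apply const_family_associated|].
    apply (has_kind_geqv K1); [apply const_chazy|].
    intros t _; destruct (const_chazy_gen (- lam * 1 / 4)) as [_ [HQ HR]]; rewrite HQ, HR; split; [ring|].
    apply Cpow_nz; intros Z; apply Hl; transitivity (-4 * (- lam * 1 / 4)); [field|rewrite Z; ring].
  - exists (const_sol (- lam * 0 / 4)); split; [apply const_family_associated|].
    replace (- lam * 0 / 4) with (RtoC 0) by field; apply geqv_refl, const_chazy.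
Qed.

Lemma G_class_spec (lam : C) (F F' : tv_family) (y : dfun) : associated lam F y ->
  G_class lam F F' <-> exists y', associated lam F' y' /\ geqv y' y.
Proof.
  intros Hy; split.
  - intros [g [y0 [y1 [H0 [H1 H]]]]]; exists y1; split; auto; exists g.
    eapply rst_trans; [apply H|apply act_same, (associated_same lam F); auto].
  - intros [y' [Hy' [g H]]]; exists g, y, y'; auto.
Qed.

Lemma G_class_eq (lam : C) (F F' : tv_family) (y y' : dfun) : associated lam F y -> associated lam F' y' ->
  G_class lam F = G_class lam F' <-> geqv y y'.
Proof.
  intros H H'; assert (Hc := associated_chazy _ _ _ H); assert (Hc' := associated_chazy _ _ _ H'); split; intros E.
  - assert (HF : G_class lam F F) by (apply (G_class_spec lam F F y H); exists y; auto using geqv_refl).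
    rewrite E in HF; apply (G_class_spec lam F' F y' H') in HF; destruct HF as [y1 [H1 E1]].
    apply (geqv_trans y y1 y'); auto; apply geqv_same; [eapply associated_chazy; eauto|].
    apply (associated_same lam F); auto.
  - fext; intros F1; apply propositional_extensionality.
    rewrite (G_class_spec lam F F1 y H), (G_class_spec lam F' F1 y' H').
    split; intros [y1 [H1 E1]]; exists y1; split; auto.
    + apply (geqv_trans y1 y y'); auto.
    + apply (geqv_trans y1 y' y); auto; apply geqv_sym; auto.
Qed.

Lemma orbit_geqv (y y' : dfun) : chazy y -> chazy y' -> orbit y = orbit y' <-> geqv y y'.
Proof.
  intros Hy Hy'; split; [|apply orbit_eq; auto].
  intros E; assert (H := orbit_refl y Hy); rewrite E in H; apply H.
Qed.

(** The union over all families of the class and all their solutions, so that no representative has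
    to be chosen; [class_orbit_spec] shows that they all contribute the same orbit. *)
Definition class_orbit (lam : C) (c : tv_family -> Prop) : dfun -> Prop :=
  fun z => exists F y, associated lam F y /\ c = G_class lam F /\ orbit y z.

Lemma class_orbit_spec (lam : C) (F : tv_family) (y : dfun) : associated lam F y ->
  class_orbit lam (G_class lam F) = orbit y.
Proof.
  intros H; fext; intros z; apply propositional_extensionality; split.
  - intros [F' [y' [H' [E Hz]]]]; apply (G_class_eq lam F F' y y' H H') in E.
    apply orbit_geqv in E; [rewrite E; auto|eapply associated_chazy; eauto|eapply associated_chazy; eauto].
  - intros Hz; exists F, y; auto.
Qed.

Lemma three_orbits_rep (k : kind) : three_orbits (orbit (kind_rep k)).
Proof. unfold three_orbits; destruct k; auto. Qed.

Lemma family_obtained (lam : C) (F : tv_family) (y : dfun) (k : kind) : lam <> 0 ->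
  associated lam F y -> geqv y (kind_rep k) -> exists g, obtained_by lam g (rep_family lam k) F.
Proof.
  intros Hl H Hk; destruct (rep_family_associated lam k Hl) as [y0 [H0 E0]].
  assert (Hc := associated_chazy _ _ _ H0).
  destruct (geqv_trans y (kind_rep k) y0) as [g Hg]; auto.
  - apply geqv_sym; auto using kind_rep_chazy.
  - exists g, y0, y; auto.
Qed.

Theorem theorem5 : forall (lam : C) (hlam : lam <> 0),
  let F_E2 := family_of_chazy lam E2_sol in
  let F_1 := family_of (fun _ => True) (fun _ => 1) (fun _ => 0) (fun _ => 0) in
  let F_0 := family_of (fun _ => True) (fun _ => 0) (fun _ => 0) (fun _ => 0) in
  (associated lam F_E2 E2_sol /\ is_family lam F_1 /\ is_family lam F_0) /\
  (forall F : tv_family, is_family lam F ->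
     exists g : SL2,
       obtained_by lam g F_E2 F \/ obtained_by lam g F_1 F \/ obtained_by lam g F_0 F) /\
  (exists Phi : (tv_family -> Prop) -> (dfun -> Prop),
     (forall (F : tv_family) (y : dfun), associated lam F y ->
        Phi (G_class lam F) = orbit y) /\
     bijection_between (G_classes lam) three_orbits Phi) /\
  (chazy E2_sol /\ chazy (const_sol 0) /\ chazy (const_sol 1)) /\
  (orbit E2_sol <> orbit (const_sol 0) /\
   orbit E2_sol <> orbit (const_sol 1) /\
   orbit (const_sol 0) <> orbit (const_sol 1)) /\
  (forall y : dfun, chazy y ->
     orbit E2_sol y \/ orbit (const_sol 0) y \/ orbit (const_sol 1) y).
Proof.
  intros lam hlam F_E2 F_1 F_0.
  split; [|split; [|split; [|split; [|split]]]].
  - split; [apply family_of_chazy_associated; auto using E2_chazy|].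
    split; eexists; apply const_family_associated.
  - intros F [y Hy]; destruct (chazy_geqv_rep y (associated_chazy _ _ _ Hy)) as [k Hk].
    destruct (family_obtained lam F y k hlam Hy Hk) as [g Hg]; exists g.
    destruct k; auto.
  - exists (class_orbit lam); split; [apply class_orbit_spec|split; [|split]].
    + intros c [F [[y Hy] ->]]; rewrite (class_orbit_spec lam F y Hy).
      assert (Hc := associated_chazy _ _ _ Hy).
      destruct (chazy_geqv_rep y Hc) as [k Hk].
      rewrite (orbit_eq y (kind_rep k)) by auto using kind_rep_chazy; apply three_orbits_rep.
    + intros c c' [F [[y Hy] ->]] [F' [[y' Hy'] ->]] E.
      rewrite (class_orbit_spec lam F y Hy), (class_orbit_spec lam F' y' Hy') in E.
      apply (G_class_eq lam F F' y y' Hy Hy').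
      apply orbit_geqv; auto; eapply associated_chazy; eauto.
    + intros O HO.
      assert (HO' : exists k, O = orbit (kind_rep k))
        by (destruct HO as [->|[->| ->]]; [exists KE2|exists K0|exists K1]; reflexivity).
      destruct HO' as [k ->].
      destruct (rep_family_associated lam k hlam) as [y [Hy Hk]].
      exists (G_class lam (rep_family lam k)); split.
      * exists (rep_family lam k); split; [exists y; auto|reflexivity].
      * rewrite (class_orbit_spec lam _ y Hy).
        apply orbit_eq; auto using kind_rep_chazy; eapply associated_chazy; eauto.
  - auto using E2_chazy, const_chazy.
  - split; [|split]; [apply (orbits_distinct KE2 K0)|apply (orbits_distinct KE2 K1)|apply (orbits_distinct K0 K1)];
      discriminate.
  - intros y Hy; destruct (chazy_geqv_rep y Hy) as [k Hk].
    destruct k; [left|right; right|right; left]; split; auto.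
Qed.
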